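(* Let $V\in L^\infty(\mathbb{R}^+)$ be complex-valued with $V_I:=\operatorname{Im}V\ge0$ almost everywhere. Let $h\in\mathbb{C}$ and $k\in\operatorname{Ran}(V_I^{1/2})$ satisfy $$\frac14\int_{\mathcal{E}}\frac{|k(x)|^2}{V_I(x)}\,dx=\operatorname{Im}(h)>0,\qquad \mathcal{E}=\{x\in\mathbb{R}^+:V_I(x)\neq0\},$$ and let $A_{h,k}$ be the maximally dissipative operator in $L^2(\mathbb{R}^+)$ given by $$\mathcal{D}(A_{h,k})=\{f\in H^2(\mathbb{R}^+): f'(0)=hf(0)\},\qquad (A_{h,k}f)(x)=-f''(x)+V(x)f(x)+f(0)k(x).$$ Then $A_{h,k}$ has a non-trivial reducing selfadjoint subspace if and only if there exists a function $K_V\in\mathcal{D}(A_{h,k})$ with $K_V(0)\neq0$ such that (i) $V_IK_V=\frac{i}{2}K_V(0)k$, and (ii) $A_{h,k}K_V\in\operatorname{span}\{K_V\}$. Moreover, if both conditions (i) and (ii) are satisfied by such a $K_V$, then $\mathcal{H}_{sa}(A_{h,k})=\operatorname{span}\{K_V\}$.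
   Context: $\mathbb{R}^+=(0,\infty)$, $H^2(\mathbb{R}^+)$ is the usual Sobolev space; $V_I$ and $V_I^{1/2}$ also denote multiplication operators on $L^2(\mathbb{R}^+)$; the inner product is linear in the second component. A densely defined linear operator $A$ is dissipative if $\operatorname{Im}\langle u,Au\rangle\ge0$ for all $u\in\mathcal{D}(A)$, and maximally dissipative if moreover it has no non-trivial dissipative extension. A closed subspace $\mathcal{M}$ of a Hilbert space $\mathcal{H}$ is a reducing subspace of $A$ if $\mathcal{D}(A)=\mathcal{D}(A)\cap\mathcal{M}+\mathcal{D}(A)\cap\mathcal{M}^\perp$, $A(\mathcal{D}(A)\cap\mathcal{M})\subset\mathcal{M}$ and $A(\mathcal{D}(A)\cap\mathcal{M}^\perp)\subset\mathcal{M}^\perp$. A reducing selfadjoint subspace is a reducing subspace $\mathcal{M}$ such that the restriction of $A$ to $\mathcal{D}(A)\cap\mathcal{M}$ is selfadjoint in $\mathcal{M}$; non-trivial means $\neq\{0\}$. $A$ is completely non-selfadjoint if it has no non-trivial reducing selfadjoint subspace. For a maximally dissipative operator $A$ on $\mathcal{H}$ there is a unique orthogonal decomposition $\mathcal{H}=\mathcal{H}_{sa}(A)\oplus\mathcal{H}_{cns}(A)$ into reducing subspaces for $A$ such that the restriction of $A$ to $\mathcal{H}_{sa}(A)$ is selfadjoint and the restriction to $\mathcal{H}_{cns}(A)$ is completely non-selfadjoint (Langer decomposition); this defines $\mathcal{H}_{sa}(A)$. *)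

(* Defs.v *)
From HB Require Import structures.
From mathcomp Require Import all_boot all_order all_algebra.
From mathcomp Require Import ring_quotient complex ring.
From mathcomp Require Import all_classical all_reals all_analysis.
From mathcomp Require Import measurable_realfun.
Import Order.TTheory GRing.Theory Num.Theory.
Import numFieldNormedType.Exports.

Set Implicit Arguments.
Unset Strict Implicit.
Unset Printing Implicit Defensive.

Local Open Scope classical_set_scope.
Local Open Scope ring_scope.

Local Notation Re := complex.Re.
Local Notation Im := complex.Im.
Notation normc := ComplexField.Normc.normc.

Definition Rpos (R : realType) : set R := `]0, +oo[%classic.
Arguments Rpos : clear implicits.

Definition cmeasurable (R : realType) (f : R -> R[i]) : Prop :=
  measurable_fun (Rpos R) (fun x => Re (f x)) /\
  measurable_fun (Rpos R) (fun x => Im (f x)).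

Definition ae_eq_Rpos (R : realType) (f g : R -> R[i]) : Prop :=
  {ae @lebesgue_measure R, forall x, Rpos R x -> f x = g x}.

Definition cintegral (R : realType) (f : R -> R[i]) : R[i] :=
  ((\int[@lebesgue_measure R]_(x in Rpos R) Re (f x)) +i*
   (\int[@lebesgue_measure R]_(x in Rpos R) Im (f x)))%C.

(* Values outside (0, oo) are irrelevant throughout: functions on (0, oo) are
   represented by functions on R, taken modulo equality a.e. on (0, oo).      *)
Section SquareIntegrable.
Variable R : realType.
Local Notation mu := (@lebesgue_measure R).

Definition square_integrable (f : R -> R[i]) : Prop :=
  cmeasurable f /\
  (\int[mu]_(x in Rpos R) ((normc (f x)) ^+ 2)%:E < +oo)%E.

Definition sqint : {pred R -> R[i]} := mem [set f | square_integrable f].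

Lemma normcsq (z : R[i]) : normc z ^+ 2 = Re z ^+ 2 + Im z ^+ 2.
Proof. by case: z => a b /=; rewrite sqr_sqrtr // addr_ge0 ?sqr_ge0. Qed.

Lemma Re_lin (a z w : R[i]) :
  Re (a * z + w) = Re a * Re z - Im a * Im z + Re w.
Proof. by case: a z w => ? ? [? ?] [? ?]. Qed.

Lemma Im_lin (a z w : R[i]) :
  Im (a * z + w) = Re a * Im z + Im a * Re z + Im w.
Proof. by case: a z w => ? ? [? ?] [? ?]. Qed.

Lemma measurable_normcsq (f : R -> R[i]) : cmeasurable f ->
  measurable_fun (Rpos R) (fun x => (normc (f x) ^+ 2 : R)).
Proof.
case=> mr mi; 
under eq_fun do rewrite normcsq.
by apply: measurable_funD; apply: measurable_funX.
Qed.

Lemma measurable_normcsqE (f : R -> R[i]) : cmeasurable f ->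
  measurable_fun (Rpos R) (fun x => ((normc (f x)) ^+ 2)%:E).
Proof. by move=> /measurable_normcsq H; apply/measurable_EFinP. Qed.

Lemma sqint_submod_closed : submod_closed sqint.
Proof.
split.
  rewrite inE /=; split.
    by split; apply: measurable_cst.
  under eq_integral => x _ do rewrite normcsq /= expr0n /= addr0.
  by rewrite integral0 ltry.
move=> a f g; rewrite !inE /= => -[mf If] [mg Ig].
have mfg : cmeasurable (a *: f + g).
  have [fr fi] := mf; have [gr gi] := mg.
  have E x : (a *: f + g) x = a * f x + g x by [].
  split.
    have -> : (fun x => Re ((a *: f + g) x)) =
      (fun x => (Re a * Re (f x) - Im a * Im (f x)) + Re (g x)).
      by apply/funext => x; rewrite E Re_lin.
    apply: measurable_funD gr.
    by apply: measurable_funB; apply: measurable_funM => //; apply: measurable_cst.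
  have -> : (fun x => Im ((a *: f + g) x)) =
    (fun x => (Re a * Im (f x) + Im a * Re (f x)) + Im (g x)).
    by apply/funext => x; rewrite E Im_lin.
  apply: measurable_funD gi.
  by apply: measurable_funD; apply: measurable_funM => //; apply: measurable_cst.
split=> //.
pose c := 2 * normc a ^+ 2.
have c0 : 0 <= c by rewrite mulr_ge0 // sqr_ge0.
have mR : measurable (Rpos R) by exact: measurable_itv.
apply: (@le_lt_trans _ _ (\int[mu]_(x in Rpos R)
   (c%:E * ((normc (f x)) ^+ 2)%:E + 2%:E * ((normc (g x)) ^+ 2)%:E))%E).
  apply: ge0_le_integral => //.
  - by move=> x _; rewrite lee_fin sqr_ge0.
  - exact: measurable_normcsqE.
  - apply: emeasurable_funD; apply: measurable_funeM; exact: measurable_normcsqE.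
  move=> x _; rewrite -!EFinM -EFinD lee_fin /c.
  rewrite (_ : (a *: f + g) x = a * f x + g x) //.
  have := le_normcD (a * f x) (g x).
  rewrite ComplexField.Normc.normcM; set p := normc a; set q := normc (f x); set r := normc (g x).
  move=> H.
  have n0 (z : R[i]) : 0 <= normc z by case: z => ? ?; exact: sqrtr_ge0.
  apply: (@le_trans _ _ ((p * q + r) ^+ 2)).
    by rewrite ler_sqr ?nnegrE ?(addr_ge0, mulr_ge0) //; exact: n0.
  rewrite -mulrA -exprMn -mulrDr; set s := p * q.
  rewrite -subr_ge0 (_ : _ - _ = (s - r) ^+ 2) ?sqr_ge0 //.
  by rewrite sqrrB sqrrD mulr_natl mulrnDl mulr2n [r ^+ 2 *+ 2]mulr2n; ring.
rewrite ge0_integralD //.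
- rewrite ge0_integralZl_EFin //; last 2 first.
    by move=> x _; rewrite lee_fin sqr_ge0.
    exact: measurable_normcsqE.
  rewrite ge0_integralZl_EFin //; last 2 first.
    by move=> x _; rewrite lee_fin sqr_ge0.
    exact: measurable_normcsqE.
  by rewrite lte_add_pinfty // lte_mul_pinfty.
- by move=> x _; rewrite -EFinM lee_fin mulr_ge0 // sqr_ge0.
- by apply: measurable_funeM; exact: measurable_normcsqE.
- by move=> x _; rewrite -EFinM lee_fin mulr_ge0 // sqr_ge0.
- by apply: measurable_funeM; exact: measurable_normcsqE.
Qed.

HB.instance Definition _ :=
  GRing.isSubmodClosed.Build _ _ sqint sqint_submod_closed.

Record sqfun := Sqfun { sqfun_val :> R -> R[i]; _ : sqfun_val \in sqint }.
HB.instance Definition _ := [isSub for sqfun_val].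
HB.instance Definition _ := [Choice of sqfun by <:].
HB.instance Definition _ := [SubChoice_isSubLmodule of sqfun by <:].

Definition sqnull : {pred sqfun} := mem [set f : sqfun | ae_eq_Rpos f (fun=> 0)].

Lemma sqnull_zmod_closed : zmod_closed sqnull.
Proof.
split; first by rewrite inE /=; exact: aeW.
move=> f g; rewrite !inE /= /ae_eq_Rpos => Hf Hg.
have F := ae_filter_ringOfSetsType mu.
apply: filterS2 Hf Hg => x fx gx x0.
by change (f x - g x = 0); rewrite fx // gx // subrr.
Qed.

HB.instance Definition _ :=
  GRing.isZmodClosed.Build _ sqnull sqnull_zmod_closed.

End SquareIntegrable.

Section L2.
Variable R : realType.
Local Open Scope quotient_scope.

Definition L2 : Type := Quotient.quot (@sqnull R).
HB.instance Definition _ := GRing.Zmodule.on L2.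
HB.instance Definition _ := EqQuotient.on L2.

Definition L2_fun (u : L2) : R -> R[i] := sqfun_val (repr u).

(* Junk value: the zero class when f is not square integrable.                *)
Definition L2_of (f : R -> R[i]) : L2 := \pi_L2 (insubd (0 : sqfun R) f).

Lemma L2_piP (f g : sqfun R) : \pi_L2 f = \pi_L2 g <-> ae_eq_Rpos f g.
Proof.
have sub : (f - g \in @sqnull R) <-> ae_eq_Rpos f g.
  have F := ae_filter_ringOfSetsType (@lebesgue_measure R).
  rewrite inE /= /ae_eq_Rpos; split=> H; apply: filterS H => x + x0.
    by move=> /(_ x0) E; apply: subr0_eq; exact: E.
  by move=> /(_ x0) E; change (f x - g x = 0); rewrite E subrr.
by rewrite -sub Quotient.idealrBE; split=> [->|/eqP].
Qed.

Lemma L2_funK (u : L2) : L2_of (L2_fun u) = u.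
Proof.
rewrite /L2_of /L2_fun -[RHS]reprK; congr (\pi_L2 _); apply: val_inj.
by rewrite insubdK //; exact: (valP (repr u)).
Qed.

Lemma L2_ofK (f : R -> R[i]) :
  square_integrable f -> ae_eq_Rpos (L2_fun (L2_of f)) f.
Proof.
move=> sf; have : ae_eq_Rpos (L2_fun (L2_of f)) (insubd (0 : sqfun R) f).
  by apply/L2_piP; rewrite reprK.
by rewrite insubdK // inE.
Qed.

Definition L2_scale (a : R[i]) (u : L2) : L2 := \pi_L2 (a *: repr u).

Lemma L2_scale_pi a (f : sqfun R) : L2_scale a (\pi_L2 f) = \pi_L2 (a *: f).
Proof.
apply/L2_piP; have : ae_eq_Rpos (repr (\pi_L2 f)) f by apply/L2_piP; rewrite reprK.
have F := ae_filter_ringOfSetsType (@lebesgue_measure R).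
apply: filterS => x + x0; move=> /(_ x0) E.
by change (a * repr (\pi_L2 f) x = a * f x); rewrite E.
Qed.

Lemma L2_piD (f g : sqfun R) : \pi_L2 f + \pi_L2 g = \pi_L2 (f + g).
Proof. by rewrite (@raddfD _ _ (\pi_(Quotient.quot (@sqnull R)))). Qed.

Lemma L2_ind (P : L2 -> Prop) : (forall f, P (\pi_L2 f)) -> forall u, P u.
Proof. by move=> H u; rewrite -[u]reprK; exact: H. Qed.

Fact L2_scaleA a b u : L2_scale a (L2_scale b u) = L2_scale (a * b) u.
Proof.
by elim/L2_ind: u => f; rewrite (L2_scale_pi b) !L2_scale_pi scalerA.
Qed.

Fact L2_scale1 : left_id 1 L2_scale.
Proof. by elim/L2_ind=> f; rewrite L2_scale_pi scale1r. Qed.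

Fact L2_scaleDr : right_distributive L2_scale +%R.
Proof.
move=> a; elim/L2_ind=> f; elim/L2_ind=> g.
by rewrite L2_piD !L2_scale_pi scalerDr -L2_piD.
Qed.

Fact L2_scaleDl u : {morph L2_scale^~ u : a b / a + b}.
Proof.
by elim/L2_ind: u => f a b; rewrite !L2_scale_pi scalerDl -L2_piD.
Qed.

HB.instance Definition _ := GRing.Zmodule_isLmodule.Build R[i] L2
  L2_scaleA L2_scale1 L2_scaleDr L2_scaleDl.

End L2.

Coercion L2_fun : L2 >-> Funclass.

Section Operators.
Variable R : realType.
Local Notation H := (L2 R).
Implicit Types (u v w : H) (M N : set H).

Definition ip u v : R[i] := cintegral (fun x => (u x)^*%C * v x).

Definition hnorm u : R := Num.sqrt (Re (ip u u)).

Definition hclosure M : set H :=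
  [set u | forall e : R, 0 < e -> exists2 v, M v & hnorm (u - v) < e].

Definition closed_subspace M : Prop :=
  [/\ M 0, (forall (a : R[i]) u v, M u -> M v -> M (a *: u + v))
    & hclosure M `<=` M].

Definition span1 u : set H := [set a *: u | a in [set: R[i]]].

(* An operator acting in the closed subspace [space] (a Hilbert space in its
   own right); [act] is only meaningful on [dom].                             *)
Record operator := Operator { space : set H; dom : set H; act : H -> H }.

Implicit Type A : operator.

Definition orth A M : set H :=
  [set u | space A u /\ forall v, M v -> ip v u = 0].

Definition restriction A M : operator := Operator M (dom A `&` M) (act A).

Definition adjoint_graph A v w : Prop :=
  [/\ space A v, space A w & forall u, dom A u -> ip v (act A u) = ip w u].

Definition densely_defined A : Prop :=
  dom A `<=` space A /\ space A `<=` hclosure (dom A).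

Definition selfadjoint A : Prop :=
  densely_defined A /\
  forall v w, adjoint_graph A v w <-> dom A v /\ act A v = w.

Definition reducing A M : Prop :=
  [/\ closed_subspace M, M `<=` space A,
      dom A = [set u + v | u in dom A `&` M & v in dom A `&` orth A M],
      act A @` (dom A `&` M) `<=` M
    & act A @` (dom A `&` orth A M) `<=` orth A M].

Definition reducing_selfadjoint A M : Prop :=
  reducing A M /\ selfadjoint (restriction A M).

Definition completely_non_selfadjoint A : Prop :=
  forall M, reducing_selfadjoint A M -> M = [set 0].

Definition langer_decomposition A M N : Prop :=
  [/\ reducing A M, reducing A N,
      (forall u v, M u -> N v -> ip u v = 0),
      space A = [set u + v | u in M & v in N]
    & selfadjoint (restriction A M) /\
      completely_non_selfadjoint (restriction A N)].

(* For maximally dissipative A the pair (M, N) exists and is unique; the junk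
   value set0 is never a subspace.                                            *)
Definition H_sa A : set H :=
  xget set0 [set M | exists N, langer_decomposition A M N].

End Operators.

Section Sobolev.
Variable R : realType.
Local Notation mu := (@lebesgue_measure R).

Definition Linfty (V : R -> R[i]) : Prop :=
  cmeasurable V /\
  exists C : R, {ae mu, forall x, Rpos R x -> normc (V x) <= C}.

Definition mulL2 (w : R -> R[i]) (u : L2 R) : L2 R :=
  L2_of (fun x => w x * u x).

(* Weak derivatives are tested against C^1_c((0, oo)); by mollification,
   C^oo_c((0, oo)) yields the same weak derivatives. Real-valued test functions
   suffice by linearity.                                                      *)
Definition test_function (phi : R -> R) : Prop :=
  [/\ (forall x, derivable phi x 1), continuous (derive1 phi)
    & exists a b : R, 0 < a /\ forall x, x \notin `[a, b] -> phi x = 0].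

Definition is_weak_derivative (f g : L2 R) : Prop :=
  forall phi, test_function phi ->
    cintegral (fun x => f x * (derive1 phi x)%:C%C) =
    - cintegral (fun x => g x * (phi x)%:C%C).

Definition H2 : set (L2 R) :=
  [set f | exists f1 f2, is_weak_derivative f f1 /\ is_weak_derivative f1 f2].

Definition weak_derivative (f : L2 R) : L2 R := xget 0 (is_weak_derivative f).

(* f(0): the value at 0 of the representative of f continuous on [0, oo).     *)
Definition trace0 (f : L2 R) : R[i] :=
  xget 0 [set c | exists g : R -> R[i],
    [/\ {within `[0, +oo[, continuous (fun x => Re (g x))},
        {within `[0, +oo[, continuous (fun x => Im (g x))},
        ae_eq_Rpos f g & g 0 = c]].

Definition A_hk (V : R -> R[i]) (h : R[i]) (k : L2 R) : operator R :=
  Operator [set: L2 R]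
    [set f | H2 f /\ trace0 (weak_derivative f) = h * trace0 f]
    (fun f => - weak_derivative (weak_derivative f) + mulL2 V f
              + trace0 f *: k).

End Sobolev.

(* Main.v *)
(* Green's formula and |k / sqrt V_I|^2 = 4 Im h turn the boundary form of A
   into 4j <Du, Dv>, where j = i/2 and
   Du = sqrt V_I u - j u(0) k / sqrt V_I. So Du = 0 on a reducing selfadjoint
   subspace M, which is (i). On N = {u in M : V_I u = 0}, A restricts to a
   selfadjoint operator whose domain has zero Cauchy data u(0) = u'(0) = 0; it is
   bounded below, and for (A + c) p_(n+1) = p_n selfadjointness makes |p_n|
   log-convex, while the Volterra estimate gives super-geometric decay of p_n on
   bounded intervals: hence N = 0. As dom A meets M in functions determined modulo
   N by u(0), M is spanned by one eigenvector. Two such eigenvectors are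
   proportional: the difference u of their normalisations has zero Cauchy data
   and V_I u = 0; a second derivative vanishes a.e. where the function does, so
   V_I (A u) = 0, the eigenvalues agree, and u = 0 by uniqueness for the ODE. *)
Require Import Defs.
From mathcomp Require Import all_boot all_order all_algebra.
From mathcomp Require Import complex ring lra.
From mathcomp Require Import all_classical all_reals all_analysis.
From mathcomp Require Import measurable_realfun.
Import Order.TTheory GRing.Theory Num.Theory.
Import numFieldNormedType.Exports.
Set Implicit Arguments.
Unset Strict Implicit.
Unset Printing Implicit Defensive.
Local Open Scope classical_set_scope.
Local Open Scope ring_scope.

(** The main obstacle is [N = 0]. The operator may have continuous spectrum on [N], so no
    eigenfunction need exist to which uniqueness for the ODE could be applied; powers of the inverse
    of [A + c] take its place. Their decay is known on bounded intervals only, whereas log-convexity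
    concerns the norm over the whole half-line. The bridge is the choice of the start: [p_0] is the
    projection to [N] of a function [f] supported in []0, X]]. As every [p_n] lies in [N], one has
    [<f, p_2n> = <p_0, p_2n> = |p_n|^2], and the left side involves [p_2n] on []0, X]] only. So
    [p_0 = 0], that is, [f] is orthogonal to [N]; taking for [f] the cutoff of an element of [N]
    shows that this element vanishes on []0, X]].

    Selfadjointness is used only through the adjoint graph: a vector is put into the domain by
    verifying the adjoint identity. This yields solvability of [(A + c) u = v], and also the
    eigenvector, which arises as the part of a domain vector orthogonal to [N] and is not visibly in
    the domain itself. *)

(** * Smoothed steps and their tent-shaped derivatives *)

Section Steps.
Variable R : realType.
Implicit Types c e x y : R.

Definition ramp x : R := Num.max 0 x.

Lemma ramp_ge0 x : 0 <= ramp x.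
Proof. by rewrite /ramp le_max lexx. Qed.

Lemma ramp_pos x : 0 <= x -> ramp x = x.
Proof. by move=> x0; apply/max_idPr. Qed.

Lemma ramp_neg x : x <= 0 -> ramp x = 0.
Proof. by move=> x0; apply/max_idPl. Qed.

Lemma continuous_ramp : continuous ramp.
Proof. by move=> x; apply: continuous_max; [exact: cvg_cst|exact: cvg_id]. Qed.

Lemma is_derive_ramp2 x : is_derive x 1 (fun y => ramp y ^+ 2) (2 * ramp x).
Proof.
have [x0|x0|<-] := ltgtP 0 x.
- rewrite (ramp_pos (ltW x0)).
  apply: (@near_eq_is_derive _ _ _ (fun y => y ^+ 2)).
    by near=> y; rewrite ramp_pos // ltW //; near: y; exact: lt_nbhsr.
  by apply: is_derive_eq; rewrite /GRing.scale /=; ring.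
- rewrite (ramp_neg (ltW x0)) mulr0.
  apply: (@near_eq_is_derive _ _ _ (fun=> 0)).
  by near=> y; rewrite ramp_neg ?expr0n // ltW //; near: y; exact: lt_nbhsl.
rewrite ramp_neg // mulr0.
(* At the kink the difference quotient is [ramp h ^+ 2 / h], of size at most [|h|]. *)
have L : (fun h => h^-1 *: (((fun y => ramp y ^+ 2) \o shift 0) (h *: 1) - ramp 0 ^+ 2))
   @ 0^' --> (0:R).
  rewrite ramp_neg // expr0n /=.
  apply/cvgrPdist_le => /= e e0; near=> h.
  rewrite sub0r normrN subr0 addr0 [h *: 1]mulr1 normrM normrV ?unitfE; last first.
    by near: h; exact: nbhs_dnbhs_neq.
  rewrite ler_pdivrMl ?normr_gt0; last by near: h; exact: nbhs_dnbhs_neq.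
  rewrite ger0_norm ?sqr_ge0 // expr2.
  have h1 : ramp h <= `|h| by rewrite ge_max normr_ge0 ler_norm.
  apply: ler_pM; rewrite ?ramp_ge0 //.
  apply: le_trans h1 _; near: h; apply: dnbhs0_le => //.
by apply: DeriveDef; [apply/cvg_ex; exists 0|exact/cvg_lim].
Unshelve. all: by end_near. Qed.

(** Test functions need to be only C^1, so the normalised second difference of squared ramps
    suffices: it rises from 0 at [c - e] to 1 at [c + e]. Its derivative [tent] is the second
    difference of ramps, a hat of mass 1. *)
Definition step c e x : R :=
  (ramp (x - c + e) ^+ 2 - 2 * ramp (x - c) ^+ 2 + ramp (x - c - e) ^+ 2) / (2 * e ^+ 2).

Definition tent c e x : R :=
  (ramp (x - c + e) - 2 * ramp (x - c) + ramp (x - c - e)) / e ^+ 2.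

Lemma is_derive_step c e x : 0 < e -> is_derive x 1 (step c e) (tent c e x).
Proof.
move=> e0.
have D (a : R) : is_derive x 1 (fun y => ramp (y + a) ^+ 2) (2 * ramp (x + a)).
  have := is_derive1_comp (f := fun y => ramp y ^+ 2) (g := fun y => y + a) (x := x) (a := 2 * ramp (x + a)) (b := 1).
  have d1 := is_derive_ramp2 (x + a).
  rewrite mulr1; apply=> //.
  by apply: is_derive_eq; rewrite addr0.
have D1 := D (- c + e); have D2 := D (- c); have D3 := D (- c - e).
rewrite /step /tent.
have -> : (fun x0 : R => (ramp (x0 - c + e) ^+ 2 - 2 * ramp (x0 - c) ^+ 2 + ramp (x0 - c - e) ^+ 2) / (2 * e ^+ 2)) =
  ((2 * e ^+ 2)^-1 *: ((fun y => ramp (y + (- c + e)) ^+ 2) - 2 *: (fun y => ramp (y + (- c)) ^+ 2) + (fun y => ramp (y + (- c - e)) ^+ 2)) : R -> R).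
  by apply/funext => y; rewrite !fctE /= [RHS]mulrC !addrA.
apply: is_derive_eq.
rewrite !addrA /GRing.scale /=; field; exact: lt0r_neq0.
Qed.

Lemma tent_ge0 c e x : 0 < e -> 0 <= tent c e x.
Proof.
move=> e0; rewrite /tent divr_ge0 ?sqr_ge0 // /ramp.
by case: (lerP 0 (x - c + e)) => ?; case: (lerP 0 (x - c)) => ?; case: (lerP 0 (x - c - e)) => ?; lra.
Qed.

Lemma tent_le c e x : 0 < e -> tent c e x <= e^-1.
Proof.
move=> e0; rewrite /tent ler_pdivrMr ?exprn_gt0 // expr2 mulKf ?gt_eqF // /ramp.
by case: (lerP 0 (x - c + e)) => ?; case: (lerP 0 (x - c)) => ?; case: (lerP 0 (x - c - e)) => ?; lra.
Qed.

Lemma tent0 c e x : 0 < e -> e <= `|x - c| -> tent c e x = 0.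
Proof.
move=> e0; rewrite ler_normr /tent /ramp => H; apply/eqP; rewrite mulf_eq0; apply/orP; left; apply/eqP.
by move: H => /orP[] H; case: (lerP 0 (x - c + e)) => ?; case: (lerP 0 (x - c)) => ?; case: (lerP 0 (x - c - e)) => ?; lra.
Qed.

Lemma step_ge0 c e x : 0 < e -> 0 <= step c e x.
Proof.
move=> e0; rewrite /step divr_ge0 ?mulr_ge0 ?sqr_ge0 ?ler0n ?(ltW e0) // /ramp.
by case: (lerP 0 (x - c + e)) => ?; case: (lerP 0 (x - c)) => ?; case: (lerP 0 (x - c - e)) => ?; nra.
Qed.

Lemma step_le1 c e x : 0 < e -> step c e x <= 1.
Proof.
move=> e0; rewrite /step ler_pdivrMr ?mulr_gt0 ?exprn_gt0 // /ramp.
by case: (lerP 0 (x - c + e)) => ?; case: (lerP 0 (x - c)) => ?; case: (lerP 0 (x - c - e)) => ?; nra.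
Qed.

Lemma step0 c e x : 0 < e -> x <= c - e -> step c e x = 0.
Proof.
by move=> e0 H; rewrite /step !ramp_neg ?expr0n /= ?mulr0 ?subr0 ?addr0 ?mul0r //; lra.
Qed.

Lemma step1 c e x : 0 < e -> c + e <= x -> step c e x = 1.
Proof.
move=> e0 H; rewrite /step !ramp_pos; try lra.
by field; exact: lt0r_neq0.
Qed.

Lemma continuous_tent c e : continuous (tent c e).
Proof.
have D (a : R) : continuous (fun y => ramp (y + a)).
  move=> x; apply: (@continuous_comp _ _ _ (fun y => y + a) ramp); last exact: continuous_ramp.
  by apply: cvgD; [exact: cvg_id|exact: cvg_cst].
have E : tent c e = (fun y => (ramp (y + (- c + e)) - 2 * ramp (y + (- c)) + ramp (y + (- c - e))) * (e ^+ 2)^-1).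
  by apply/funext => y; rewrite /tent !addrA.
rewrite E => x; apply: cvgM; last exact: cvg_cst.
apply: cvgD; last exact: D.
apply: cvgB; first exact: D.
by apply: cvgM; [exact: cvg_cst|exact: D].
Qed.

Lemma continuous_step c e : 0 < e -> continuous (step c e).
Proof.
by move=> e0 x; apply: differentiable_continuous; apply/derivable1_diffP; case: (is_derive_step c x e0).
Qed.

Lemma derive1_step c e : 0 < e -> derive1 (step c e) = tent c e.
Proof.
by move=> e0; apply/funext => x; rewrite derive1E; have D := is_derive_step c x e0; rewrite derive_val.
Qed.

(** A smoothed indicator of []a, b]]: tested against a weak derivative it gives the integral between
    [a] and [b], while its own derivative, a difference of tents, samples the function at both ends.
    The conditions [e < a] and [d < b] keep the support away from 0. *)
Lemma test_step a b e d : 0 < e -> 0 < d -> e < a -> d < b ->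
  test_function (step a e - step b d).
Proof.
move=> e0 d0 ea db; split.
- by move=> x; apply: derivableB; [case: (is_derive_step a x e0)|case: (is_derive_step b x d0)].
- have -> : derive1 (step a e - step b d) = tent a e - tent b d.
    apply/funext => x; rewrite derive1E.
    have D1 := is_derive_step a x e0; have D2 := is_derive_step b x d0.
    by rewrite derive_val.
  by move=> x; apply: cvgB; exact: continuous_tent.
exists (Num.min (a - e) (b - d)), (Num.max (a + e) (b + d)); split.
  by rewrite lt_min !subr_gt0 ea.
move=> x; rewrite in_itv /= negb_and -!ltNge lt_min gt_max !fctE => /orP[] /andP[H1 H2].
  by rewrite !step0 ?subr0 // ltW.
by rewrite !step1 ?subrr // ltW.
Qed.

Lemma derive1_test_step a b e d : 0 < e -> 0 < d ->
  derive1 (step a e - step b d) = tent a e - tent b d.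
Proof.
move=> e0 d0; apply/funext => x; rewrite derive1E.
have D1 := is_derive_step a x e0; have D2 := is_derive_step b x d0.
by rewrite derive_val.
Qed.

End Steps.

(** * Real-valued Lebesgue integrals; tents as an approximate identity *)

Section RealIntegrals.
Variable R : realType.
Local Notation mu := (@lebesgue_measure R).
Local Notation rint D f := (mu.-integrable D (EFin \o f)).
Local Notation mset := (set (measurableTypeR R)).
Implicit Types (D : mset) (f g : R -> R).

Lemma rintD D f g : measurable D -> rint D f -> rint D g ->
  rint D (fun x => f x + g x).
Proof. by move=> mD intf intg; apply: (@eq_integrable _ _ _ _ _ mD (fun x => (f x)%:E + (g x)%:E)%E) => //; exact: integrableD. Qed.

Lemma rintZ D c f : measurable D -> rint D f -> rint D (fun x => c * f x).
Proof. by move=> mD intf; apply: (@eq_integrable _ _ _ _ _ mD (fun x => c%:E * (f x)%:E)%E) => //; exact: integrableZl. Qed.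

Lemma rintN D f : measurable D -> rint D f -> rint D (fun x => - f x).
Proof. by move=> mD intf; apply: (@eq_integrable _ _ _ _ _ mD (fun x => - (f x)%:E)%E) => //; exact: integrableN. Qed.

Lemma rintB D f g : measurable D -> rint D f -> rint D g ->
  rint D (fun x => f x - g x).
Proof. by move=> mD intf intg; apply: rintD => //; exact: rintN. Qed.

Lemma rint_measurable D f : rint D f -> measurable_fun D f.
Proof. by move=> /integrableP[/measurable_EFinP]. Qed.

Lemma rint_norm D f : measurable D -> rint D f -> rint D (fun x => `|f x|).
Proof. by move=> mD /integrable_norm. Qed.

Lemma rint_le D f g : measurable D -> measurable_fun D f ->
  (forall x, D x -> `|f x| <= g x) -> rint D g -> rint D f.
Proof.
move=> mD mf fg ig; apply: (le_integrable mD _ _ ig); first exact/measurable_EFinP.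
by move=> x Dx /=; rewrite lee_fin (le_trans (fg _ Dx)) ?ler_norm.
Qed.

Lemma rintM D f g C : measurable D -> rint D f -> measurable_fun D g ->
  (forall x, D x -> `|g x| <= C) -> rint D (fun x => f x * g x).
Proof.
move=> mD intf mg gC; apply: (@rint_le _ _ (fun x => C * `|f x|)) => //.
- by apply: measurable_funM => //; exact: rint_measurable.
- by move=> x Dx; rewrite normrM mulrC ler_wpM2r // gC.
- by apply: rintZ => //; exact: rint_norm.
Qed.

Lemma Rdominated D (f_ : nat -> R -> R) f g : measurable D ->
  (forall n, measurable_fun D (f_ n)) -> measurable_fun D f ->
  {ae mu, forall x, D x -> f_ ^~ x @ \oo --> f x} ->
  rint D g -> (forall n x, D x -> `|f_ n x| <= g x) ->
  rint D f /\ \int[mu]_(x in D) f_ n x @[n --> \oo] --> \int[mu]_(x in D) f x.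
Proof.
move=> mD mf_ mf cf ig fg.
have [] := @dominated_convergence _ _ _ mu D mD (fun n => EFin \o f_ n) (EFin \o f) (EFin \o g).
- by move=> n; apply/measurable_EFinP; exact: mf_.
- by apply/measurable_EFinP.
- have F := ae_filter_ringOfSetsType mu.
  apply: filterS cf => x H Dx; apply: cvg_comp (H Dx) _.
  by apply: cvg_EFin => //; exact: nearW.
- by [].
- by apply: aeW => x n Dx /=; rewrite lee_fin fg.
move=> intf _ H; split=> //.
by apply: fine_cvg; rewrite fineK //; exact: integrable_fin_num.
Qed.

Lemma le_norm_Rint D f g : measurable D -> rint D f -> rint D g ->
  (forall x, D x -> `|f x| <= g x) ->
  `|\int[mu]_(x in D) f x| <= \int[mu]_(x in D) g x.
Proof.
move=> mD intf intg fg; apply: (le_trans (le_normr_Rintegral _ _)) => //.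
by apply: le_Rintegral => //; exact: rint_norm.
Qed.

Lemma ae_eq_Rint D f g : measurable D -> measurable_fun D f -> measurable_fun D g ->
  {ae mu, forall x, D x -> f x = g x} ->
  \int[mu]_(x in D) f x = \int[mu]_(x in D) g x.
Proof.
move=> mD mf mg fg; congr fine; apply: ae_eq_integral => //; try exact/measurable_EFinP.
have F := ae_filter_ringOfSetsType mu.
by apply: filterS fg => x H Dx; rewrite H.
Qed.

Lemma eq_Rint D f g : (forall x : R, D x -> f x = g x) ->
  \int[mu]_(x in D) f x = \int[mu]_(x in D) g x.
Proof. by move=> fg; apply: eq_Rintegral => x; rewrite inE => /fg. Qed.

Lemma rint_eq D f g : measurable D -> (forall x : R, D x -> f x = g x) ->
  rint D f -> rint D g.
Proof.
move=> mD fg; apply: eq_integrable => // x; rewrite inE => Dx /=.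
by rewrite fg.
Qed.

Lemma rint_cst D (c : R) : measurable D -> (mu D < +oo)%E -> rint D (fun=> c).
Proof.
move=> mD muD; apply/integrableP; split; first exact/measurable_EFinP/measurable_cst.
by rewrite integral_cst //= lte_mul_pinfty.
Qed.

Lemma tent_int (a e : R) : 0 < e ->
  rint setT (tent a e) /\ \int[mu]_x tent a e x = 1.
Proof.
move=> e0.
have ab : a - e < a + e by lra.
have H : (\int[mu]_(x in `[(a - e)%R, (a + e)%R]) (tent a e x)%:E = 1)%E.
  rewrite (@continuous_FTC2 _ _ (step a e)) //.
  - by rewrite step1 // step0 //; rewrite sube0.
  - exact/continuous_subspaceT/continuous_tent.
  - split.
    + by move=> x _; case: (is_derive_step a x e0).
    + apply: cvg_at_right_filter; exact: continuous_step.
    + apply: cvg_at_left_filter; exact: continuous_step.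
  - by move=> x _; rewrite derive1_step.
have E : (tent a e \_ `[(a - e)%R, (a + e)%R]) = tent a e.
  apply/funext => x; rewrite patchE; case: ifPn => // /negP nx; rewrite tent0 //.
  rewrite leNgt; apply/negP => xe; apply: nx; rewrite inE /= in_itv /=.
  by move: xe; rewrite ltr_norml => /andP[? ?]; apply/andP; split; lra.
have int : rint setT (tent a e).
  have : mu.-integrable `[(a - e)%R, (a + e)%R] (EFin \o tent a e).
    apply: continuous_compact_integrable; first exact: segment_compact.
    exact/continuous_subspaceT/continuous_tent.
  by rewrite integrable_mkcond //= restrict_EFin E.
split=> //; rewrite -E -Rintegral_mkcond /Rintegral H //.
Qed.

Lemma mu_ball (a e : R) : 0 < e -> mu (ball a e) = (2 * e)%:E.
Proof. by move=> e0; rewrite lebesgue_measure_ball ?ltW // mulr_natl. Qed.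

(** The tent has height at most [1 / e] on a ball of measure [2 * e], so the error is at most twice
    the mean of [|f - f a|] over that ball, which tends to 0 at a Lebesgue point. *)
Lemma tent_cvg f a : rint setT f -> lebesgue_pt f a ->
  \int[mu]_x (f x * tent a (harmonic n) x) @[n --> \oo] --> f a.
Proof.
move=> intf la.
have h0 n : 0 < (@harmonic R n) by exact: harmonic_gt0.
have intfa n : rint (ball a (harmonic n)) (fun x => f x - f a).
  apply: rintB; first exact: measurable_ball.
    by apply: integrableS intf => //; exact: measurable_ball.
  apply: rint_cst; first exact: measurable_ball.
  by rewrite [X in (X < _)%E]mu_ball // ltry.
pose d n := fine (davg f a (harmonic n)).
have dE n : \int[mu]_(x in ball a (harmonic n)) `|f x - f a| = 2 * harmonic n * d n.
  rewrite /d /davg /iavg [X in (X^-1 * _)%E]mu_ball // fineM //.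
  - rewrite inver gt_eqF ?mulr_gt0 //= /Rintegral mulrA mulfV ?mul1r // gt_eqF // mulr_gt0 //.
  - by rewrite inver gt_eqF ?mulr_gt0.
  - apply: integrable_fin_num; first exact: measurable_ball.
    by have /rint_norm := intfa n; apply; exact: measurable_ball.
have d0 : d n @[n --> \oo] --> 0.
  apply: fine_cvg.
  have hr : (@harmonic R) @ \oo --> (0:R)^'+.
    move=> A [e /= e0 H].
    have /cvgrPdist_lt /(_ e e0) := @cvg_harmonic R.
    by apply: filterS => n hn; apply: H => //; exact: h0.
  exact: cvg_comp hr la.
apply/subr_cvg0; apply: norm_cvg0.
have cv : 2 * d n @[n --> \oo] --> 0.
  by rewrite -[X in _ --> X](mulr0 2); apply: cvgM => //; exact: cvg_cst.
apply: squeeze_cvgr cv; last exact: cvg_cst.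
apply: nearW => n; rewrite normr_ge0 /=.
have [it t1] := tent_int a (h0 n).
have mt : measurable_fun setT (tent a (harmonic n)) by exact: rint_measurable it.
have tb x : `|tent a (harmonic n) x| <= (harmonic n)^-1.
  by rewrite ger0_norm ?tent_le ?tent_ge0.
have ift : rint setT (fun x => f x * tent a (harmonic n) x).
  by apply: rintM => // x _; exact: tb.
have -> : f a = \int[mu]_x (f a * tent a (harmonic n) x).
  by rewrite RintegralZl // t1 mulr1.
rewrite -RintegralB //; last exact: rintZ.
have -> : \int[mu]_x (f x * tent a (harmonic n) x - f a * tent a (harmonic n) x) =
  \int[mu]_(x in ball a (harmonic n)) ((f x - f a) * tent a (harmonic n) x).
  rewrite [RHS]Rintegral_mkcond; apply: eq_Rintegral => x _; rewrite patchE.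
  case: ifPn => [_|/negP nx]; first by rewrite mulrBl.
  rewrite tent0 ?mulr0 ?subr0 // leNgt; apply/negP => H; apply: nx.
  by rewrite inE /ball /= distrC.
apply: (@le_trans _ _ (\int[mu]_(x in ball a (harmonic n)) ((harmonic n)^-1 * `|f x - f a|))).
  apply: le_norm_Rint; [exact: measurable_ball| | |].
  - apply: rintM; [exact: measurable_ball|exact: intfa| |by move=> x _; exact: tb].
    exact: measurable_funTS.
  - by apply: rintZ; [exact: measurable_ball|apply: rint_norm => //; exact: measurable_ball].
  - by move=> x _; rewrite normrM mulrC ler_wpM2r.
rewrite RintegralZl //; [|exact: measurable_ball|by apply: rint_norm => //; exact: measurable_ball].
rewrite dE le_eqVlt; apply/orP; left; apply/eqP; field.
exact: lt0r_neq0.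
Qed.

End RealIntegrals.

(** * Weak derivatives on the half-line and the lemma of du Bois-Reymond *)

Section WeakDerivative.
Variable R : realType.
Local Notation mu := (@lebesgue_measure R).
Local Notation rint D f := (mu.-integrable D (EFin \o f)).
Local Notation mset := (set (measurableTypeR R)).
Local Notation Rp := (Rpos R).
Implicit Types (D : mset) (f g : R -> R).

Definition wderiv f g := forall phi, test_function phi ->
  \int[mu]_(x in Rp) (f x * derive1 phi x) = - \int[mu]_(x in Rp) (g x * phi x).

(** Integrability is required up to the endpoint 0, so that primitives can start there and give
    boundary values. *)
Definition locint f := forall b, rint `]0, b] f.

Lemma RposE x : Rp x = (0 < x) :> Prop.
Proof. by rewrite /Rpos /= in_itv /= andbT. Qed.

Lemma measurable_Rpos : measurable (Rp : mset).
Proof. exact: measurable_itv. Qed.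

Lemma Rint_sub D (A : mset) f : A `<=` D -> (forall x : R, D x -> ~ A x -> f x = 0) ->
  \int[mu]_(x in D) f x = \int[mu]_(x in A) f x.
Proof.
move=> AD f0; rewrite Rintegral_mkcond [RHS]Rintegral_mkcond.
apply: eq_Rintegral => x _; rewrite !patchE; case: ifPn => [|/negP] Dx; last first.
  by rewrite ifN //; apply/negP => Ax; apply: Dx; rewrite inE; apply: AD; rewrite -inE.
by case: ifPn => // /negP Ax; apply: f0; [rewrite -inE|move=> ?; apply: Ax; rewrite inE].
Qed.

Lemma ae_neq (a : R) : {ae mu, forall x, x != a}.
Proof.
exists [set a]; split; [exact: measurable_set1|exact: lebesgue_measure_set1|].
by move=> x /= /negP; rewrite negbK => /eqP.
Qed.

Lemma ae_exists (P : R -> Prop) : {ae mu, forall x, P x} -> exists2 x, 0 < x & P x.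
Proof.
move=> [N [mN N0 sN]]; apply: contrapT => nex.
have : (mu Rp <= mu N)%E.
  apply: le_measure; rewrite ?inE //; first exact: measurable_Rpos.
  by move=> x; rewrite RposE => x0; apply: sN => Px; apply: nex; exists x.
by rewrite N0 /Rpos lebesgue_measure_itv /= ltry.
Qed.

Lemma harmonic_le1 n : @harmonic R n <= 1.
Proof. by rewrite /= invf_le1 // ler1n. Qed.

Lemma near_harmonic_lt (e : R) : 0 < e -> \forall n \near \oo, @harmonic R n < e.
Proof.
move=> e0; have /cvgrPdist_lt /(_ e e0) := @cvg_harmonic R.
by apply: filterS => n; rewrite sub0r normrN ger0_norm ?harmonic_ge0.
Qed.

(** At [x = a] the value is [1/2] for every width, which is why this null set is excluded. *)
Lemma step_cvg (a x : R) : x != a ->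
  step a (harmonic n) x @[n --> \oo] --> ((a < x)%R%:R : R).
Proof.
rewrite neq_lt => /orP[xa|ax].
  have -> : (a < x) = false by apply/negbTE; rewrite -leNgt ltW.
  apply: cvg_near_cst; have ax0 : 0 < a - x by lra.
  apply: filterS (near_harmonic_lt ax0) => n H.
  by rewrite step0 ?harmonic_gt0 //; lra.
rewrite ax; apply: cvg_near_cst; have ax0 : 0 < x - a by lra.
apply: filterS (near_harmonic_lt ax0) => n H.
by rewrite step1 ?harmonic_gt0 //; lra.
Qed.

Lemma step_int_cvg g (a b : R) : locint g -> 0 < a -> a < b ->
  \int[mu]_(x in Rp) (g x * (step a (harmonic n) x - step b (harmonic n) x))
    @[n --> \oo] --> \int[mu]_(x in `]a, b]) g x.
Proof.
move=> lg a0 ab.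
have h0 n : 0 < (@harmonic R n) by exact: harmonic_gt0.
have mst (c e : R) : 0 < e -> measurable_fun (`]0, b + 1] : mset) (step c e).
  by move=> e0; apply: measurable_funTS; apply: continuous_measurable_fun; exact: continuous_step.
(* The widths are at most 1, so both steps equal 1 beyond [b + 1] and cancel; the integrand is
   supported in []0, b + 1]], where [|g|] dominates. *)
have [] := @Rdominated R `]0, b + 1] (fun n x => g x * (step a (harmonic n) x - step b (harmonic n) x))
  (fun x => g x * ((a < x)%R%:R - (b < x)%R%:R)) (fun x => `|g x|).
- exact: measurable_itv.
- move=> n; apply: measurable_funM; first exact: rint_measurable (lg _).
  by apply: measurable_funB; exact: mst.
- apply: measurable_funM; first exact: rint_measurable (lg _).
  have mi (c : R) : measurable_fun (`]0, b + 1] : mset) (fun x => (c < x)%R%:R : R).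
    rewrite (_ : (fun x => _) = \1_(`]c, +oo[)); first exact: measurable_indic.
    by apply/funext => x; rewrite indicE; congr (_%:R); rewrite mem_setE in_itv /= andbT.
  by apply: measurable_funB; exact: mi.
- have F := ae_filter_ringOfSetsType mu.
  apply: filterS2 (ae_neq a) (ae_neq b) => x xa xb _.
  apply: cvgM; first exact: cvg_cst.
  by apply: cvgB; exact: step_cvg.
- by apply: rint_norm; [exact: measurable_itv|exact: lg].
- move=> n x _; rewrite normrM ler_piMr // ler_norml.
  have := step_le1 a x (h0 n); have := step_ge0 a x (h0 n).
  have := step_le1 b x (h0 n); have := step_ge0 b x (h0 n).
  by move=> *; apply/andP; split; lra.
move=> _; rewrite (@Rint_sub _ `]a, b]); last 2 first.
- by move=> x /=; rewrite !in_itv /= => /andP[? ?]; apply/andP; split; lra.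
- move=> x /=; rewrite !in_itv /= => _ H.
  have [ax|xa] := ltP a x; have [bx|xb] := ltP b x; rewrite ?subrr ?mulr0 //.
    by exfalso; apply: H; rewrite ax.
  by exfalso; lra.
rewrite (_ : \int[mu]_(x in `]a, b]) (g x * _) = \int[mu]_(x in `]a, b]) g x); last first.
  apply: eq_Rintegral => x; rewrite inE /= in_itv /= => /andP[ax xb].
  by rewrite ax (leNgt x b) in xb *; rewrite (negbTE xb) subr0 mulr1.
apply: cvg_trans; apply: near_eq_cvg; apply: nearW => n /=; rewrite [RHS](@Rint_sub _ `]0, b + 1]) //.
- by move=> x /=; rewrite in_itv /= RposE => /andP[].
- move=> x; rewrite RposE /= in_itv /= => -> /= /negP; rewrite -ltNge => bx.
  have /= hn := harmonic_le1 n; have /= e0 := h0 n.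
  move: (n.+1%:R^-1) hn e0 => e hn e0.
  by rewrite !step1 ?subrr ?mulr0 //; lra.
Qed.

(** The weak identity is tested with [step a - step b] and the width is sent to 0: the tents
    converge to [f a] and [f b] at Lebesgue points, the steps to the integral over []a, b]].
    Truncation at [u > b] makes [f] globally integrable without changing it near [a] and [b]. *)
Lemma wderiv_sub f g (a b u : R) : locint f -> locint g -> wderiv f g ->
  0 < a -> a < b -> b < u ->
  lebesgue_pt (f \_ `]0, u]) a -> lebesgue_pt (f \_ `]0, u]) b ->
  f b - f a = \int[mu]_(x in `]a, b]) g x.
Proof.
move=> lf lg w a0 ab bu la lb.
have h0 n : 0 < (@harmonic R n) by exact: harmonic_gt0.
set F := f \_ `]0, u] in la lb.
have intF : rint setT F.
  have := lf u; rewrite integrable_mkcond; last exact: measurable_itv.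
  by rewrite restrict_EFin.
have tc (c : R) : 0 < c -> c < u -> lebesgue_pt F c ->
  \int[mu]_(x in Rp) (f x * tent c (harmonic n) x) @[n --> \oo] --> f c.
  move=> c0 cu /(tent_cvg intF).
  rewrite {2}/F patchE mem_set /= ?in_itv /= ?c0 ?(ltW cu) //.
  apply: cvg_trans; apply: near_eq_cvg.
  have uc : 0 < u - c by lra.
  apply: filterS2 (near_harmonic_lt c0) (near_harmonic_lt uc) => n /= H1 H2.
  rewrite [LHS](@Rint_sub setT Rp) //; last first.
    move=> x _; rewrite RposE => /negP; rewrite -leNgt => x0.
    by rewrite /F patchE ifN ?mul0r // notin_setE /= in_itv /= ltNge x0.
  apply: eq_Rint => x; rewrite RposE => x0; rewrite /F patchE.
  case: ifPn => //; rewrite notin_setE /= in_itv /= x0 /= => /negP; rewrite -ltNge => ux.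
  have /= e0 := h0 n; move: (n.+1%:R^-1) H1 H2 e0 => e H1 H2 e0.
  by rewrite !tent0 ?mulr0 // ler_normr; apply/orP; left; lra.
have L1 := tc a a0 (lt_trans ab bu) la.
have L2 := tc b (lt_trans a0 ab) bu lb.
have L3 := step_int_cvg lg a0 ab.
have tint (c e : R) : 0 < e -> c + e <= u -> rint Rp (fun x => f x * tent c e x).
  move=> e0 ce.
  have : rint Rp (fun x => F x * tent c e x).
    apply: (@rintM _ _ _ _ e^-1); first exact: measurable_Rpos.
    - by apply: integrableS intF => //; exact: measurable_Rpos.
    - exact: measurable_funTS (rint_measurable (tent_int c e0).1).
    - by move=> x _; rewrite ger0_norm ?tent_le ?tent_ge0.
  apply: rint_eq; first exact: measurable_Rpos.
  move=> x; rewrite RposE => x0.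
  rewrite /F patchE; case: ifPn => //; rewrite notin_setE /= in_itv /= x0 /= => /negP; rewrite -ltNge => ux.
  by rewrite tent0 ?mulr0 // ler_normr; apply/orP; left; lra.
have L4 : (- \int[mu]_(x in Rp) (g x * (step a (harmonic n) x - step b (harmonic n) x)))
    @[n --> \oo] --> f a - f b.
  apply: cvg_trans (cvgB L1 L2); apply: near_eq_cvg.
  have ub : 0 < u - b by lra.
  apply: filterS2 (near_harmonic_lt a0) (near_harmonic_lt ub) => n /= H1 H2.
  rewrite /= -[LHS]RintegralB; [|exact: measurable_Rpos| |]; last 2 first.
  - apply: tint; first exact: h0.
    by move: (n.+1%:R^-1) H1 H2 => e; lra.
  - apply: tint; first exact: h0.
    by move: (n.+1%:R^-1) H1 H2 => e; lra.
  have /= <- := w _ (test_step (h0 n) (h0 n) H1 (lt_trans H1 ab)).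
  apply: eq_Rintegral => x _.
  by rewrite derive1_test_step // !fctE mulrBr.
have := cvg_unique _ L4 (cvgN L3) => /(_ (@Rhausdorff R)) H.
by rewrite -opprB H opprK.
Qed.

Lemma locint_Chasles f (a b : R) : 0 <= a -> a <= b -> locint f ->
  \int[mu]_(x in `]0, b]) f x = \int[mu]_(x in `]0, a]) f x + \int[mu]_(x in `]a, b]) f x.
Proof.
move=> a0 ab lf; rewrite -(@Rintegral_itvB _ f (BRight 0) (BRight b) a); last 3 first.
- exact: lf.
- by rewrite bnd_simp.
- by rewrite bnd_simp.
by rewrite addrC subrK.
Qed.

Lemma locint_lebesgue f : locint f -> {ae mu, forall x, forall n : nat, lebesgue_pt (f \_ `]0, n%:R]) x}.
Proof.
move=> lf.
have H (n : nat) : {ae mu, forall x, lebesgue_pt (f \_ `]0, n%:R]) x}.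
  apply: lebesgue_differentiation.
  by apply: integrable_locally; [exact: measurable_itv|exact: lf].
exact: ae_foralln H.
Qed.

(** Almost every point is a Lebesgue point of all integer truncations of [f]. One such positive
    point [a] is fixed, and [wderiv_sub] compares it with every other one, on either side. *)
Lemma dubois_reymond f g : locint f -> locint g -> wderiv f g ->
  exists c, {ae mu, forall x, Rp x -> f x = c + \int[mu]_(t in `]0, x]) g t}.
Proof.
move=> lf lg w.
have L := locint_lebesgue lf.
have [a a0 La] := ae_exists L.
exists (f a - \int[mu]_(t in `]0, a]) g t).
have F := ae_filter_ringOfSetsType mu.
apply: filterS L => x Lx; rewrite RposE => x0.
have [n an xn] : exists2 n : nat, a < n%:R & x < n%:R.
  exists (Num.truncn (a + x)).+1.
    by rewrite (le_lt_trans _ (truncnS_gt _)) // lerDl ltW.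
  by rewrite (le_lt_trans _ (truncnS_gt _)) // lerDr ltW.
have [ax|xa|<-] := ltgtP a x; last by rewrite subrK.
- have H := wderiv_sub lf lg w a0 ax xn (La n) (Lx n).
  by rewrite (locint_Chasles (ltW a0) (ltW ax) lg) -H; ring.
- have H := wderiv_sub lf lg w x0 xa an (Lx n) (La n).
  by rewrite (locint_Chasles (ltW x0) (ltW xa) lg) -H; ring.
Qed.

End WeakDerivative.

(** * Primitives from 0, their boundary values and limits, and square integrable functions *)

Section Primitive.
Variable R : realType.
Local Notation mu := (@lebesgue_measure R).
Local Notation rint D f := (mu.-integrable D (EFin \o f)).
Local Notation mset := (set (measurableTypeR R)).
Local Notation Rp := (Rpos R).
Implicit Types (D : mset) (f g : R -> R) (x a b : R).

Definition prim g x : R := \int[mu]_(t in `]0, x]) g t.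

Lemma prim0 g x : x <= 0 -> prim g x = 0.
Proof.
by move=> x0; rewrite /prim set_itv_ge ?Rintegral_set0 // bnd_simp -leNgt.
Qed.

Lemma prim_sub g a b : 0 <= a -> a <= b -> locint g ->
  prim g b - prim g a = \int[mu]_(t in `]a, b]) g t.
Proof. by move=> a0 ab lg; rewrite /prim (locint_Chasles a0 ab lg) addrAC subrr add0r. Qed.

Lemma continuous_prim g : locint g -> continuous (prim g).
Proof.
move=> lg x.
pose b := `|x| + 1; pose a := - b.
have xb : a < x < b.
  rewrite /a /b; have := ler_norm x; have := ler_norm (- x); rewrite normrN => *.
  by apply/andP; split; lra.
pose G := g \_ `]0, b].
have iG : rint setT G.
  have := lg b; rewrite integrable_mkcond; last exact: measurable_itv.
  by rewrite restrict_EFin.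
have ab : a <= b by case/andP: xb => *; lra.
have := @parameterized_integral_continuous R a b G ab.
have -> : mu.-integrable `[a, b] (EFin \o G).
  by apply: integrableS iG => //; exact: measurable_itv.
move=> /(_ isT) H.
have [ax bx] := andP xb.
have : {for x, continuous (fun y => \int[mu]_(t in `[a, y]) G t)}.
  have ab' : a < b by lra.
  have [+ _ _] := (continuous_within_itvP (parameterized_integral mu a ^~ G) ab').1 H.
  by move=> /(_ x); apply; rewrite in_itv /= ax bx.
have E y : y < b -> \int[mu]_(t in `[a, y]) G t = prim g y.
  move=> yb; rewrite (@Rint_sub _ _ `]0, y]) //.
  - apply: eq_Rint => t /=; rewrite in_itv /= => /andP[t0 ty].
    by rewrite /G patchE mem_set //= in_itv /= t0 (le_trans ty) // ltW.
  - move=> t /=; rewrite !in_itv /= => /andP[t0 ->]; rewrite andbT.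
    by rewrite /a (le_trans _ (ltW t0)) // oppr_le0 /b addr_ge0.
  - move=> t /=; rewrite !in_itv /= => /andP[at_ ty]; rewrite ty andbT => /negP t0.
    by rewrite /G patchE ifN // notin_setE /= in_itv /= (negbTE t0).
rewrite /continuous_at /prop_for /= E // => Hc.
apply: cvg_trans Hc; apply: near_eq_cvg; near=> y; rewrite E //.
by near: y; exact: lt_nbhsl.
Unshelve. all: by end_near. Qed.

Lemma derive_prim g x : locint g -> 0 < x -> {for x, continuous g} ->
  is_derive x 1 (prim g) (g x).
Proof.
move=> lg x0 cg.
have x1 : x < x + 1 by lra.
have [//|d1 d2] := continuous_FTC1 (a := BRight 0) x1 (lg (x + 1)) _ cg.
by split; [exact: d1|rewrite -derive1E; exact: d2].
Qed.

Lemma derive_prim_ae g : locint g ->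
  {ae mu, forall x, 0 < x -> is_derive x 1 (prim g) (g x)}.
Proof.
move=> lg; have F := ae_filter_ringOfSetsType mu.
apply: filterS (locint_lebesgue lg) => x Lx x0.
pose n := (Num.truncn x).+1.
have xn : x < n%:R by exact: truncnS_gt.
set G := g \_ `]0, n%:R] in Lx *.
have iG : rint setT G.
  have := lg n%:R; rewrite integrable_mkcond; last exact: measurable_itv.
  by rewrite restrict_EFin.
have iG' : rint `]0, n%:R] G.
  by apply: integrableS iG => //; exact: measurable_itv.
have [//|d1 d2] := FTC1_lebesgue_pt (a := BRight 0) xn iG' _ (Lx n).
have E : \forall y \near x, \int[mu]_(t in `]0, y]) G t = prim g y.
  near=> y; apply: eq_Rint => t /=; rewrite in_itv /= => /andP[t0 ty].
  rewrite /G patchE mem_set //= in_itv /= t0 (le_trans ty) // ltW //.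
  by near: y; exact: lt_nbhsl.
have -> : g x = G x by rewrite /G patchE mem_set //= in_itv /= x0 ltW.
apply: near_eq_is_derive E _.
by split; [exact: d1|rewrite -derive1E; exact: d2].
Unshelve. all: by end_near. Qed.

Lemma ae_itv_exists (P : R -> Prop) a b : a < b -> {ae mu, forall x, P x} ->
  exists2 x, a < x < b & P x.
Proof.
move=> ab [N [mN N0 sN]]; apply: contrapT => nex.
have : (mu `]a, b[ <= mu N)%E.
  apply: le_measure; rewrite ?inE //.
  by move=> x /= ; rewrite in_itv /= => xab; apply: sN => Px; apply: nex; exists x.
by rewrite N0 lebesgue_measure_itv /= lte_fin ab -EFinB lee_fin leNgt subr_gt0 ab.
Qed.

(** Only right neighbourhoods of [x] are used, and these meet the complement of every null set.
    Hence the conclusion reaches the boundary point 0, which makes traces well defined. *)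
Lemma right_cvg_ae_eq f g x : 0 <= x ->
  f y @[y --> x^'+] --> f x -> g y @[y --> x^'+] --> g x ->
  {ae mu, forall y, Rp y -> f y = g y} -> f x = g x.
Proof.
move=> x0 cf cg fg; apply/eqP; apply: contrapT => /negP nfg.
have c : f y - g y @[y --> x^'+] --> f x - g x by exact: cvgB.
have [e /= e0 H] : \forall t \near x^'+, f t - g t != 0.
  by apply: cvgr_neq0 c _; rewrite subr_eq0.
have xe : x < x + e by rewrite ltrDl.
have [y /andP[xy ye] Hy] := ae_itv_exists xe fg.
have := H y; rewrite /= distrC ger0_norm ?subr_ge0 ?ltW // => /(_ _ xy).
rewrite ltrBlDl => /(_ ye); rewrite Hy ?subrr ?eqxx // RposE.
exact: le_lt_trans x0 xy.
Qed.

Lemma within_right_cvg f x : {within `[0, +oo[, continuous f} -> 0 <= x ->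
  f y @[y --> x^'+] --> f x.
Proof.
move=> /continuous_within_itvcyP[c1 c2]; rewrite le_eqVlt => /predU1P[<- //|x0].
by apply: cvg_at_right_filter; apply: c1; rewrite in_itv /= x0.
Qed.

Lemma continuous_ae_eq f g x :
  {within `[0, +oo[, continuous f} -> {within `[0, +oo[, continuous g} ->
  {ae mu, forall y, Rp y -> f y = g y} -> 0 <= x -> f x = g x.
Proof.
by move=> cf cg fg x0; apply: right_cvg_ae_eq => //; exact: within_right_cvg.
Qed.

Definition sq f := measurable_fun Rp f /\ rint Rp (fun x => f x ^+ 2).

Lemma sqM_rint f g : sq f -> sq g -> rint Rp (fun x => f x * g x).
Proof.
move=> [mf f2] [mg g2].
apply: (@rint_le _ _ _ (fun x => f x ^+ 2 + g x ^+ 2)).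
- exact: measurable_Rpos.
- exact: measurable_funM.
- move=> x _; rewrite normrM -(normr_id (f x)) -(real_normK (num_real (f x))) -(real_normK (num_real (g x))).
  rewrite normr_id; move: (normr_ge0 (f x)) (normr_ge0 (g x)).
  move: `|f x| `|g x| => a b a0 b0; have := sqr_ge0 (a - b); rewrite sqrrB => H; nra.
- by apply: rintD => //; exact: measurable_Rpos.
Qed.

Lemma sq_le f g : measurable_fun Rp f -> sq g ->
  (forall x, Rp x -> `|f x| <= `|g x|) -> sq f.
Proof.
move=> mf [mg g2] fg; split=> //; apply: (@rint_le _ _ _ (fun x => g x ^+ 2)) => //.
- exact: measurable_Rpos.
- exact: measurable_funX.
- by move=> x Dx; rewrite normrX -(real_normK (num_real (g x))) ler_sqr ?nnegrE // fg.
Qed.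

Lemma sqD f g : sq f -> sq g -> sq (fun x => f x + g x).
Proof.
move=> sf sg; have [mf f2] := sf; have [mg g2] := sg; split; first exact: measurable_funD.
apply: (@rint_eq _ _ (fun x => f x ^+ 2 + (2 * (f x * g x) + g x ^+ 2))).
- exact: measurable_Rpos.
- by move=> x _; ring.
- apply: rintD => //; first exact: measurable_Rpos.
  apply: rintD => //; first exact: measurable_Rpos.
  by apply: rintZ; [exact: measurable_Rpos|exact: sqM_rint].
Qed.

Lemma sqMb f g C : sq f -> measurable_fun Rp g -> (forall x, Rp x -> `|g x| <= C) ->
  sq (fun x => g x * f x).
Proof.
move=> [mf f2] mg gC; split; first exact: measurable_funM.
apply: (@rint_eq _ _ (fun x => f x ^+ 2 * g x ^+ 2)); first exact: measurable_Rpos.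
  by move=> x _; ring.
apply: (@rintM _ _ _ _ (C ^+ 2)) => //; first exact: measurable_Rpos.
  exact: measurable_funX.
by move=> x Dx; rewrite normrX ler_sqr ?nnegrE ?gC // (le_trans _ (gC x Dx)).
Qed.

Lemma sqZ c f : sq f -> sq (fun x => c * f x).
Proof.
by move=> sf; apply: (sqMb (g := fun=> c) (C := `|c|)) => //; exact: measurable_cst.
Qed.

Lemma sqN f : sq f -> sq (fun x => - f x).
Proof.
move=> sf; have -> : (fun x => - f x) = (fun x => (-1) * f x) by apply/funext => x; rewrite mulN1r.
exact: sqZ.
Qed.

Lemma rint_locint f : rint Rp f -> locint f.
Proof.
move=> intf b; apply: integrableS intf; [exact: measurable_Rpos|exact: measurable_itv|].
by move=> x; rewrite RposE /= in_itv /= => /andP[].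
Qed.

Lemma locint_cst (c : R) : locint (fun=> c).
Proof.
move=> b; apply: rint_cst; first exact: measurable_itv.
by have := lebesgue_measure_itv `]0, b] => ->; case: ifPn => // _; rewrite sube0 ltry.
Qed.

Lemma locintD f g : locint f -> locint g -> locint (fun x => f x + g x).
Proof. by move=> lf lg b; apply: rintD => //; exact: measurable_itv. Qed.

Lemma sq_locint f : sq f -> locint f.
Proof.
move=> [mf f2] b; apply: (@rint_le _ _ _ (fun x => 1 + f x ^+ 2)).
- exact: measurable_itv.
- apply: measurable_funS mf; first exact: measurable_Rpos.
  by move=> x; rewrite RposE /= in_itv /= => /andP[].
- move=> x _; rewrite -(real_normK (num_real (f x))).
  by have := sqr_ge0 (`|f x| - 1); rewrite sqrrB1 => H; have := sqr_ge0 `|f x|; nra.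
- by apply: locintD; [exact: locint_cst|exact: rint_locint].
Qed.

Lemma prim_cvg g : rint Rp g -> prim g n%:R @[n --> \oo] --> \int[mu]_(x in Rp) g x.
Proof.
move=> ig.
have [] := @Rdominated R Rp (fun n x => g x * \1_(`]0, n%:R]) x) g (fun x => `|g x|).
- exact: measurable_Rpos.
- move=> n; apply: measurable_funM; first exact: rint_measurable.
  by apply: measurable_indic; exact: measurable_itv.
- exact: rint_measurable.
- apply: aeW => x; rewrite RposE => x0; apply: cvg_near_cst.
  near=> n; rewrite indicE mem_set ?mulr1 //= in_itv /= x0.
  by near: n; exact: nbhs_infty_ger.
- by apply: rint_norm => //; exact: measurable_Rpos.
- by move=> n x _; rewrite normrM ler_piMr // indicE; case: (_ \in _); rewrite ?normr1 ?normr0.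
move=> _; apply: cvg_trans; apply: near_eq_cvg; apply: nearW => n.
rewrite [LHS](@Rint_sub _ _ `]0, n%:R]).
- by apply: eq_Rint => x Dx; rewrite indicE mem_set // mulr1.
- by move=> x; rewrite RposE /= in_itv /= => /andP[].
- by move=> x _ nx; rewrite indicE memNset // mulr0.
Unshelve. all: by end_near. Qed.

(** The boundary term at infinity is 0: [c + prim g] tends to [c] plus the integral of [g], and a
    nonzero limit would keep [|f|] above a positive constant on a half-line, against
    integrability. *)
Lemma rint_prim_lim f g c : rint Rp f -> rint Rp g ->
  {ae mu, forall x, Rp x -> f x = c + prim g x} -> \int[mu]_(x in Rp) g x = - c.
Proof.
move=> intf intg fE.
have lg := rint_locint intg.
set l := \int[mu]_(x in Rp) g x.
have ing : rint Rp (fun x => `|g x|) by apply: rint_norm => //; exact: measurable_Rpos.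
apply/eqP; rewrite -addr_eq0; apply: contrapT => /negP; rewrite addrC => lc.
pose d := `|c + l| / 2.
have d0 : 0 < d by rewrite divr_gt0 // normr_gt0.
(* [prim_cvg] moves along integers only; the tail of [|g|] beyond [N] controls all real [x] past
   [N]. As [d] is half of the supposed limit, a tail below [d] leaves at least [d]. *)
have [N HN] : exists N : nat, forall x, N%:R <= x -> d <= `|c + prim g x|.
  have /cvgrPdist_lt /(_ d d0) [N _ HN] := prim_cvg ing.
  exists N => x Nx.
  have H1 : `|l - prim g x| <= d.
    have E : forall h, rint Rp h -> \int[mu]_(t in Rp) h t - prim h x = \int[mu]_(t in `]x, +oo[) h t.
      move=> h inth.
      rewrite -(@Rintegral_itvB R h (BRight 0) (BInfty _ false) x) //.
      by rewrite bnd_simp (le_trans _ Nx).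
    rewrite E //; apply: (@le_trans _ _ (\int[mu]_(t in `]x, +oo[) `|g t|)).
      apply: le_normr_Rintegral; first exact: measurable_itv.
      apply: integrableS intg; [exact: measurable_Rpos|exact: measurable_itv|].
      by move=> t; rewrite RposE /= in_itv /= andbT; apply: le_lt_trans; rewrite (le_trans _ Nx).
    rewrite -E //.
    have := HN N (leqnn N); rewrite /= => H.
    have N0 : (0 : R) <= N%:R by [].
    have H2 : prim (fun x => `|g x|) N%:R <= prim (fun x => `|g x|) x.
      have lng := rint_locint ing.
      by rewrite -subr_ge0 prim_sub //; apply: Rintegral_ge0.
    have := ler_norm (\int[mu]_(x in Rp) `|g x| - prim (fun x => `|g x|) N%:R).
    lra.
  have -> : c + prim g x = (c + l) - (l - prim g x) by ring.
  have := lerB_dist (c + l) (l - prim g x); rewrite /d in H1 *; lra.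
have intnf : rint Rp (fun x => `|f x|) by apply: rint_norm => //; exact: measurable_Rpos.
(* The interval from [N] to [N + m] has length [m] and carries [|f| >= d] almost everywhere; [m] is
   unbounded, the right side is not. *)
have key (m : nat) : d * m%:R <= \int[mu]_(x in Rp) `|f x|.
  have sub : `]N%:R, (N + m)%:R] `<=` Rp.
    by move=> x; rewrite RposE /= in_itv /= => /andP[+ _]; apply: le_lt_trans.
  apply: (@le_trans _ _ (\int[mu]_(x in `]N%:R, (N + m)%:R]) `|f x|)); last first.
    rewrite [leRHS](_ : _ = \int[mu]_(x in `]N%:R, (N + m)%:R] `|` (Rp `\` `]N%:R, (N + m)%:R])) `|f x|); last first.
      by rewrite setDUK.
    rewrite Rintegral_setU.
    - by rewrite lerDl; apply: Rintegral_ge0.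
    - exact: measurable_itv.
    - by apply: measurableD; [exact: measurable_Rpos|exact: measurable_itv].
    - by rewrite setDUK.
    - by apply/disj_setPS => x [Hx [_]].
  have int1 : rint `]N%:R, (N + m)%:R] (fun x => `|f x|).
    by apply: integrableS intnf => //; [exact: measurable_Rpos].
  have muE : mu `]N%:R, (N + m)%:R] = (m%:R)%:E.
    rewrite lebesgue_measure_itv /= lte_fin ltr_nat; case: ifPn => [_|].
      by rewrite -EFinB natrD addrAC subrr add0r.
    by rewrite -leqNgt -{2}(addn0 N) leq_add2l leqn0 => /eqP ->.
  have intd : rint `]N%:R, (N + m)%:R] (fun=> d).
    by apply: rint_cst; [exact: measurable_itv|rewrite [X in (X < _)%E]muE ltry].
  have -> : d * m%:R = \int[mu]_(x in `]N%:R, (N + m)%:R]) d.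
    by rewrite Rintegral_cst; [congr (_ * _); exact: (esym (congr1 fine muE))|exact: measurable_itv].
  rewrite /Rintegral fine_le //.
  - exact: integrable_fin_num intd.
  - exact: integrable_fin_num int1.
  apply: ae_ge0_le_integral; [exact: measurable_itv| | | | |].
  - by move=> x _; rewrite lee_fin ltW.
  - exact: measurable_cst.
  - by move=> x _; rewrite lee_fin.
  - exact: (measurable_int mu int1).
  - have F := ae_filter_ringOfSetsType mu.
    apply: filterS fE => x Hx Dx; rewrite lee_fin Hx; last exact: sub.
    by apply: HN; move: Dx; rewrite /= in_itv /= => /andP[/ltW].
have := key (Num.truncn (\int[mu]_(x in Rp) `|f x| / d)).+1.
rewrite leNgt => /negP; apply.
by rewrite mulrC -ltr_pdivrMr //; exact: truncnS_gt.
Qed.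

End Primitive.

(** * Product rule and integration by parts; derivatives on zero sets *)

Section ByParts.
Variable R : realType.
Local Notation mu := (@lebesgue_measure R).
Local Notation rint D f := (mu.-integrable D (EFin \o f)).
Local Notation mset := (set (measurableTypeR R)).
Local Notation Rp := (Rpos R).
Implicit Types (D : mset) (f g : R -> R) (x a b : R).

Lemma compact_supp_bounded f : continuous f ->
  (exists a b, forall x, x \notin `[a, b] -> f x = 0) ->
  exists2 C, 0 <= C & forall x, `|f x| <= C.
Proof.
move=> cf [a [b f0]].
have [ab|ba] := leP a b; last first.
  by exists 0 => // x; rewrite f0 ?normr0 // in_itv /= negb_and -!ltNge; case: (ltP x a) => //= ?; exact: lt_le_trans ba _.
have cnf : {within `[a, b], continuous (fun x => `|f x|)}.
  apply: continuous_subspaceT => x; apply: (@continuous_comp _ _ _ f Num.norm); first exact: cf.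
  exact: norm_continuous.
have [c _ Hc] := EVT_max ab cnf.
exists `|f c| => // x; case: (boolP (x \in `[a, b])) => [|/f0 ->]; first exact: Hc.
by rewrite normr0.
Qed.

Lemma derive1_supp f a b : (forall x, x \notin `[a, b] -> f x = 0) ->
  forall x, x \notin `[a, b] -> is_derive x 1 f 0.
Proof.
move=> f0 x xab.
apply: (@near_eq_is_derive _ _ _ (fun=> 0)).
move: xab; rewrite in_itv /= negb_and -!ltNge => /orP[xa|bx]; near=> y; rewrite f0 // in_itv /= negb_and -!ltNge; apply/orP.
  by left; near: y; exact: lt_nbhsl.
by right; near: y; exact: lt_nbhsr.
Unshelve. all: by end_near. Qed.

Lemma test_bounded (phi : R -> R) : test_function phi ->
  [/\ measurable_fun Rp phi, measurable_fun Rp (derive1 phi) &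
  exists C, forall x, `|phi x| <= C /\ `|derive1 phi x| <= C].
Proof.
move=> [dphi cphi [a [b [a0 supp]]]].
have cphi0 : continuous phi.
  by move=> x; apply: differentiable_continuous; apply/derivable1_diffP.
split.
- by apply: measurable_funTS; apply: continuous_measurable_fun.
- by apply: measurable_funTS; apply: continuous_measurable_fun.
have [C1 _ H1] := compact_supp_bounded cphi0 (ex_intro _ a (ex_intro _ b supp)).
have [|C2 _ H2] := compact_supp_bounded cphi.
  exists a, b => x xab; rewrite derive1E.
  by have D := derive1_supp supp xab; rewrite derive_val.
by exists (Num.max C1 C2) => x; rewrite !le_max H1 H2 orbT.
Qed.

(** [f] is differentiable on the open half-line only, but [phi] vanishes to the left of some
    [a > 0], so the product is C^1 on the whole line. *)
Lemma test_mul (phi f f1 : R -> R) : test_function phi -> continuous f1 ->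
  (forall x, 0 < x -> is_derive x 1 f (f1 x)) ->
  test_function (fun x => f x * phi x) /\
  (forall x, 0 < x -> derive1 (fun x => f x * phi x) x = f x * derive1 phi x + f1 x * phi x).
Proof.
move=> tphi cf1 df.
have [dphi cphi [a [b [a0 supp]]]] := tphi.
have D x : 0 < x -> is_derive x 1 (fun x => f x * phi x) (f x * derive1 phi x + f1 x * phi x).
  move=> x0; have d1 := df x x0.
  have d2 : is_derive x 1 phi (derive1 phi x) by split; [exact: dphi|rewrite derive1E].
  rewrite (_ : (fun x => _) = f * phi) //.
  apply: is_derive_eq; rewrite /GRing.scale /=; ring.
have supp' x : x \notin `[a, b] -> f x * phi x = 0 by move=> /supp ->; rewrite mulr0.
have D0 x : x < a -> is_derive x 1 (fun x => f x * phi x) 0.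
  by move=> xa; apply: (derive1_supp supp'); rewrite in_itv /= leNgt xa.
have E x : 0 < x -> derive1 (fun x => f x * phi x) x = f x * derive1 phi x + f1 x * phi x.
  by move=> x0; rewrite derive1E; have := D x x0 => d; rewrite derive_val.
have E0 x : x < a -> derive1 (fun x => f x * phi x) x = 0.
  by move=> x0; rewrite derive1E; have := D0 x x0 => d; rewrite derive_val.
split=> //; split.
- move=> x; have [x0|x0] := ltP 0 x; first by case: (D x x0).
  by case: (D0 x (le_lt_trans x0 a0)).
- move=> x; have [x0|x0] := ltP 0 x.
    have : {for x, continuous (fun x => f x * derive1 phi x + f1 x * phi x)}.
      apply: cvgD; apply: cvgM.
      + by apply: differentiable_continuous; apply/derivable1_diffP; case: (df x x0).
      + exact: cphi.
      + exact: cf1.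
      + by apply: differentiable_continuous; apply/derivable1_diffP.
    rewrite /prop_for /continuous_at -E //; apply: cvg_trans; apply: near_eq_cvg.
    by near=> y; rewrite E //; near: y; exact: lt_nbhsr.
  have xa := le_lt_trans x0 a0.
  rewrite /continuous_at E0 //; apply: cvg_near_cst; near=> y; rewrite E0 //.
  by near: y; exact: lt_nbhsl.
- by exists a, b.
Unshelve. all: by end_near. Qed.

(** The C^1 factor is absorbed into the test function, so that only the classical product rule is
    needed. *)
Lemma wderiv_mul (f f1 v w : R -> R) : continuous f1 -> measurable_fun Rp f ->
  (forall x, 0 < x -> is_derive x 1 f (f1 x)) ->
  sq f -> sq f1 -> sq v -> sq w -> wderiv v w ->
  wderiv (fun x => f x * v x) (fun x => f1 x * v x + f x * w x).
Proof.
move=> cf1 mf df sf sf1 sv sw vw phi tphi.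
have [mphi mphi' [C HC]] := test_bounded tphi.
have [tfp dfp] := test_mul tphi cf1 df.
have mRp := @measurable_Rpos R.
have i1 : rint Rp (fun x => f x * v x * derive1 phi x).
  by apply: (@rintM _ _ _ _ C) => //; [exact: sqM_rint|move=> x _; exact: (HC x).2].
have i2 : rint Rp (fun x => f1 x * v x * phi x).
  by apply: (@rintM _ _ _ _ C) => //; [exact: sqM_rint|move=> x _; exact: (HC x).1].
have i3 : rint Rp (fun x => f x * w x * phi x).
  by apply: (@rintM _ _ _ _ C) => //; [exact: sqM_rint|move=> x _; exact: (HC x).1].
have := vw _ tfp.
rewrite (@eq_Rint _ _ _ (fun x => f x * v x * derive1 phi x + f1 x * v x * phi x)); last first.
  by move=> x; rewrite RposE => x0; rewrite dfp //; ring.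
rewrite (@eq_Rint _ _ (fun x => w x * _) (fun x => f x * w x * phi x)); last first.
  by move=> x _; ring.
rewrite RintegralD // => H.
rewrite (@eq_Rint _ _ (fun x => _ * phi x) (fun x => f1 x * v x * phi x + f x * w x * phi x)); last first.
  by move=> x _; ring.
by rewrite RintegralD // opprD -H; ring.
Qed.

Lemma wderiv_rep f f1 : sq f -> sq f1 -> wderiv f f1 ->
  exists c, {ae mu, forall x, Rp x -> f x = c + prim f1 x}.
Proof. by move=> sf sf1 w; apply: dubois_reymond => //; exact: sq_locint. Qed.

Lemma prim_ae f g : locint f -> measurable_fun Rp g ->
  {ae mu, forall x, Rp x -> f x = g x} -> prim f = prim g.
Proof.
move=> lf mg fg; apply/funext => x; rewrite /prim.
have mx : measurable_fun (`]0, x] : mset) g.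
  apply: measurable_funS mg; first exact: measurable_Rpos.
  by move=> y; rewrite RposE /= in_itv /= => /andP[].
apply: ae_eq_Rint => //; first exact: rint_measurable (lf x).
have F := ae_filter_ringOfSetsType mu.
apply: filterS fg => y H Dy; apply: H; rewrite RposE.
by move: Dy; rewrite /= in_itv /= => /andP[].
Qed.

(** The product [f v] and its weak derivative are both integrable, so by [rint_prim_lim] the
    integral is minus the value of [f v] at 0. That value is [c * d], because the representative
    from du Bois-Reymond and the product of the two given ones are continuous and agree almost
    everywhere. *)
Lemma by_parts (f f1 v w : R -> R) c d : continuous f1 ->
  f = (fun x => c + prim f1 x) ->
  sq f -> sq f1 -> sq v -> sq w -> wderiv v w ->
  {ae mu, forall x, Rp x -> v x = d + prim w x} ->
  \int[mu]_(x in Rp) (f1 x * v x + f x * w x) = - (c * d).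
Proof.
move=> cf1 fE sf sf1 sv sw vw vE.
have mRp := @measurable_Rpos R.
have cf : continuous f.
  rewrite fE => x; apply: cvgD; first exact: cvg_cst.
  by apply: continuous_prim; exact: sq_locint.
have df x : 0 < x -> is_derive x 1 f (f1 x).
  move=> x0; rewrite fE; have d1 := derive_prim (sq_locint sf1) x0 (cf1 x).
  rewrite (_ : (fun x => _) = cst c + prim f1) //.
  by apply: is_derive_eq; rewrite add0r.
have H := wderiv_mul cf1 sf.1 df sf sf1 sv sw vw.
have i1 := sqM_rint sf sv.
have i2 : rint Rp (fun x => f1 x * v x + f x * w x) by apply: rintD => //; exact: sqM_rint.
have [e He] := dubois_reymond (rint_locint i1) (rint_locint i2) H.
rewrite (rint_prim_lim i1 i2 He); congr (- _).
pose G1 x := e + prim (fun x => f1 x * v x + f x * w x) x.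
pose G2 x := f x * (d + prim w x).
have c1 : continuous G1.
  move=> x; apply: cvgD; first exact: cvg_cst.
  by apply: continuous_prim; exact: rint_locint.
have c2 : continuous G2.
  move=> x; apply: cvgM; first exact: cf.
  apply: cvgD; first exact: cvg_cst.
  by apply: continuous_prim; exact: sq_locint.
have : G1 0 = G2 0.
  apply: continuous_ae_eq => //; try exact: continuous_subspaceT.
  have F := ae_filter_ringOfSetsType mu.
  by apply: filterS2 He vE => x H1 H2 x0; rewrite /G1 /G2 -H1 // -H2.
by rewrite /G1 /G2 fE !prim0 // !addr0.
Qed.

(* The zeros at which f1 <> 0 are isolated in the zero set, hence countable. *)
Lemma ae_derive_vanish f f1 (E : set R) :
  {ae mu, forall x, 0 < x -> is_derive x 1 f (f1 x)} ->
  {ae mu, forall x, Rp x -> E x -> f x = 0} ->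
  {ae mu, forall x, Rp x -> E x -> f1 x = 0}.
Proof.
move=> df f0; have F := ae_filter_ringOfSetsType mu.
pose Z := [set x | f x = 0].
have iso : {ae mu, forall x, ~ isolated Z x}.
  exists (isolated Z); split.
  - by apply: countable_measurable; [move=> t; exact: measurable_set1|exact: countable_isolated].
  - by apply: countable_lebesgue_measure0; exact: countable_isolated.
  - by move=> x /= /contrapT.
apply: filterS3 df f0 iso => x dx fx nx x0 Ex.
have zx := fx x0 Ex; rewrite RposE in x0.
have [d1 d2] := dx x0.
have lx : limit_point Z x.
  have : (closure Z) x by apply: subset_closure.
  by rewrite closure_isolated_limit_point => -[].
apply/eqP; apply: contrapT => /negP f1x.
have c : (fun h => h^-1 *: ((f \o shift x) (h *: 1) - f x)) @ 0^' --> f1 x.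
  by rewrite -d2; exact: d1.
have [e /= e0 He] := cvgr_neq0 (f1 x) c f1x.
have [y [yx Zy]] := lx _ (nbhsx_ballx x e e0).
rewrite /ball /= => xy.
have := He (y - x); rewrite /= sub0r normrN distrC => /(_ xy).
rewrite subr_eq0 yx => /(_ isT).
by rewrite [(y - x) *: 1]mulr1 subrK zx Zy subr0 scaler0 eqxx.
Qed.

End ByParts.

(** * Completeness of the real space of square integrable functions *)

Section Completeness.
Variable R : realType.
Local Notation mu := (@lebesgue_measure R).
Local Notation rint D f := (mu.-integrable D (EFin \o f)).
Local Notation mset := (set (measurableTypeR R)).
Local Notation Rp := (Rpos R).
Local Notation h := (2^-1 : R).

Lemma cvg_half (c : R) : c * h ^+ n @[n --> \oo] --> 0.
Proof.
rewrite -[X in _ --> X](mulr0 c); apply: cvgM; first exact: cvg_cst.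
by apply: cvg_expr; rewrite ger0_norm ?invr_ge0 // invf_lt1 // ltr1n.
Qed.

(** The envelopes [u n - 2 c h^n] and [u n + 2 c h^n] are monotone and adjacent; their common limit
    comes with the rate of convergence. *)
Lemma geom_cvg (u : nat -> R) c : (forall n, `|u n.+1 - u n| <= c * h ^+ n) ->
  exists2 l, u n @[n --> \oo] --> l & forall n, `|l - u n| <= 2 * c * h ^+ n.
Proof.
move=> uc.
pose a n := u n - 2 * c * h ^+ n; pose b n := u n + 2 * c * h ^+ n.
have c0 : 0 <= c by have := le_trans (normr_ge0 _) (uc 0%N); rewrite expr0 mulr1.
have h0 n : 0 <= h ^+ n by rewrite exprn_ge0 ?invr_ge0.
have step n : a n <= a n.+1 /\ b n.+1 <= b n.
  have := uc n; rewrite ler_norml /a /b exprS => /andP[H1 H2].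
  by split; move: (h ^+ n) (h0 n) H1 H2 => t t0 H1 H2; lra.
have nda : nondecreasing_seq a by apply/nondecreasing_seqP => n; exact: (step n).1.
have nib : nonincreasing_seq b by apply/nonincreasing_seqP => n; exact: (step n).2.
have ab n m : a n <= b m.
  apply: (@le_trans _ _ (a (maxn n m))); first by apply: nda; rewrite leq_maxl.
  apply: (@le_trans _ _ (b (maxn n m))); last by apply: nib; rewrite leq_maxr.
  by rewrite /a /b lerD2l ge0_cp // !mulr_ge0.
have ca : a n @[n --> \oo] --> limn a.
  apply: nondecreasing_is_cvgn => //; exists (b 0%N) => _ [n _ <-]; exact: ab.
exists (limn a).
  have -> : u = a \+ (fun n => 2 * c * h ^+ n) by apply/funext => n; rewrite /a /= subrK.
  by rewrite -[X in _ --> X]addr0; apply: cvgD => //; exact: cvg_half.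
move=> n; rewrite ler_norml.
have H1 : a n <= limn a by apply: nondecreasing_cvgn_le => //; apply: cvgP ca.
have H2 : limn a <= b n by apply: limr_le; [apply: cvgP ca|apply: nearW => m; exact: ab].
by move: H1 H2; rewrite /a /b => *; apply/andP; split; lra.
Qed.

Lemma sq_complete (f_ : nat -> R -> R) : (forall n, sq (f_ n)) ->
  (forall n, \int[mu]_(x in Rp) (f_ n.+1 x - f_ n x) ^+ 2 <= (8^-1) ^+ n) ->
  exists2 f, sq f & \int[mu]_(x in Rp) (f x - f_ n x) ^+ 2 @[n --> \oo] --> 0.
Proof.
move=> sf df.
have mRp := @measurable_Rpos R.
have sd n : sq (fun x => f_ n.+1 x - f_ n x) by apply: sqD => //; exact: sqN.
(* The weight [4 ^+ n] splits the rate [8^-n]: the integrals of [w n] are still summable, with sum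
   at most 2, and finiteness of the sum at a point bounds the increments there by a multiple of
   [2^-n]. *)
pose w n x := 4 ^+ n * (f_ n.+1 x - f_ n x) ^+ 2.
have w0 n x : 0 <= w n x by rewrite /w mulr_ge0 ?sqr_ge0 ?exprn_ge0 ?ler0n.
have iw n : rint Rp (w n) by apply: rintZ => //; exact: (sd n).2.
pose S x := (\sum_(0 <= n <oo) (w n x)%:E)%E.
have mS : measurable_fun Rp S.
  apply: (ge0_emeasurable_sum (h := fun n x => (w n x)%:E)) => //.
    by move=> k x _ _; rewrite lee_fin.
  by move=> k _; exact: (measurable_int mu (iw k)).
have S0 x : (0 <= S x)%E by apply: nneseries_ge0 => n _ _; rewrite lee_fin.
have iS : mu.-integrable Rp S.
  apply/integrableP; split => //.
  under eq_integral => x _ do rewrite gee0_abs //.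
  rewrite integral_nneseries //; last 2 first.
  - by move=> n; exact: (measurable_int mu (iw n)).
  - by move=> n x _; rewrite lee_fin.
  apply: (@le_lt_trans _ _ 2%:E); last by rewrite ltry.
  have le1 n : (\int[mu]_(x in Rp) (w n x)%:E <= (h ^+ n)%:E)%E.
    rewrite -[leLHS]fineK; last exact: integrable_fin_num (iw n).
    rewrite lee_fin -/(Rintegral _ _ _) RintegralZl //; last exact: (sd n).2.
    have := ler_wpM2l (exprn_ge0 n (ler0n R 4)) (df n).
    by rewrite -exprMn (_ : 4 * 8^-1 = h) //; lra.
  apply: lime_le; first by apply: is_cvg_nneseries => n _ _; apply: integral_ge0 => x _; rewrite lee_fin.
  apply: nearW => n.
  apply: (@le_trans _ _ (\sum_(0 <= i < n) (h ^+ i)%:E)%E); first by apply: lee_sum => i _.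
  rewrite sumEFin lee_fin.
  have -> : \sum_(0 <= i < n) h ^+ i = 2 - 2 * h ^+ n.
    elim: n => [|n IH]; first by rewrite big_geq // expr0 mulr1 subrr.
    by rewrite big_nat_recr //= IH exprS; field.
  by rewrite lerBlDr lerDl mulr_ge0 ?exprn_ge0 ?invr_ge0.
have fS : {ae mu, forall x, Rp x -> (S x < +oo)%E}.
  have F := ae_filter_ringOfSetsType mu.
  by apply: filterS (integrable_ae mRp iS) => x H /H; rewrite ge0_fin_numE.
pose A := Rp `&` [set x | (S x < +oo)%E].
have mA : measurable (A : mset) by exact: emeasurable_fun_infty_o.
have dS x n : A x -> `|f_ n.+1 x - f_ n x| <= Num.sqrt (fine (S x)) * h ^+ n.
  move=> [x0 Sx].
  have H : w n x <= fine (S x).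
    rewrite -lee_fin fineK ?ge0_fin_numE //.
    apply: (@le_trans _ _ (\sum_(0 <= i < n.+1) (w i x)%:E)%E).
      rewrite big_nat_recr //= leeDr // sume_ge0 // => i _; by rewrite lee_fin.
    by apply: nneseries_lim_ge => i _ _; rewrite lee_fin.
  have s0 : 0 <= fine (S x) by rewrite fine_ge0.
  rewrite -ler_sqr ?nnegrE ?mulr_ge0 ?sqrtr_ge0 ?exprn_ge0 ?invr_ge0 //.
  rewrite exprMn sqr_sqrtr // real_normK ?num_real // -exprM mulnC exprM.
  have -> : h ^+ 2 = 4^-1 by rewrite exprVn -natrX.
  by rewrite exprVn ler_pdivlMr ?exprn_gt0 // mulrC.
(* Multiplication by the indicator of [A] makes the sequence converge at every point, to 0 off the
   full set [A], so the limit is measurable. *)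
pose f x := limn (fun n => f_ n x * \1_A x).
have cf x n : Rp x -> f_ n x * \1_A x @[n --> \oo] --> f x /\
    (A x -> `|f x - f_ n x| <= 2 * Num.sqrt (fine (S x)) * h ^+ n).
  move=> x0; have [Ax|nAx] := pselect (A x).
    have [l cl Hl] := geom_cvg (fun n => dS x n Ax).
    have cl' : f_ n x * \1_A x @[n --> \oo] --> l.
      by rewrite indicE mem_set // -[l]mulr1; apply: cvgM => //; exact: cvg_cst.
    have -> : f x = l by apply/cvg_lim.
    by split.
  split=> //; have c0 : f_ n x * \1_A x @[n --> \oo] --> (0:R).
    apply: cvg_near_cst; apply: nearW => m.
    by rewrite indicE memNset // mulr0.
  by rewrite [f x](_ : _ = 0) //; apply/cvg_lim.
have mf : measurable_fun Rp f.
  apply: (@measurable_fun_cvg _ _ _ _ (fun n x => f_ n x * \1_A x)).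
    by move=> n; apply: measurable_funM; [exact: (sf n).1|exact: measurable_indic].
  by move=> x x0; exact: (cf x 0%N x0).1.
have mfn n : measurable_fun Rp (fun x => (f x - f_ n x) ^+ 2).
  by apply: measurable_funX; apply: measurable_funB => //; exact: (sf n).1.
have SM : (\int[mu]_(x in Rp) S x)%E \is a fin_num by exact: integrable_fin_num.
set M := fine (\int[mu]_(x in Rp) S x)%E.
have bound n : (\int[mu]_(x in Rp) ((f x - f_ n x) ^+ 2)%:E <= (4 * (h ^+ n) ^+ 2 * M)%:E)%E.
  rewrite EFinM /M fineK // -ge0_integralZl_EFin //.
  apply: ae_ge0_le_integral => //.
  - by move=> x _; rewrite lee_fin sqr_ge0.
  - by apply/measurable_EFinP; exact: mfn.
  - by move=> x _; rewrite mule_ge0 // lee_fin mulr_ge0 // sqr_ge0.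
  - by apply: measurable_funeM.
  - have F := ae_filter_ringOfSetsType mu.
    apply: filterS fS => x Sx x0; have Ax : A x by split=> //; exact: Sx.
    rewrite -[S x]fineK ?ge0_fin_numE ?Sx // -EFinM lee_fin.
    have := (cf x n x0).2 Ax; rewrite -[_ <= _]ler_sqr ?nnegrE ?mulr_ge0 ?sqrtr_ge0 ?exprn_ge0 ?invr_ge0 //.
    rewrite real_normK ?num_real // !exprMn sqr_sqrtr ?fine_ge0 // => H.
    by apply: le_trans H _; rewrite le_eqVlt; apply/orP; left; apply/eqP; ring.
have sfn n : sq (fun x => f x - f_ n x).
  split; first by apply: measurable_funB => //; exact: (sf n).1.
  apply/integrableP; split; first by apply/measurable_EFinP; exact: mfn.
  apply: le_lt_trans (ltry (4 * (h ^+ n) ^+ 2 * M)).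
  apply: le_trans (bound n); rewrite le_eqVlt; apply/orP; left; apply/eqP.
  by apply: eq_integral => x _; rewrite gee0_abs // lee_fin sqr_ge0.
exists f.
  have -> : f = (fun x => (f x - f_ 0%N x) + f_ 0%N x) by apply/funext => x; rewrite subrK.
  exact: sqD.
have M0 : 0 <= M by rewrite fine_ge0 // integral_ge0.
apply: (squeeze_cvgr (f := fun=> 0) (h := fun n => (4 * M) * h ^+ n)); last exact: cvg_half.
  apply: nearW => n; apply/andP; split; first by apply: Rintegral_ge0 => x _; rewrite sqr_ge0.
  have B := bound n; rewrite -[leLHS]fineK in B; last exact: integrable_fin_num (sfn n).2.
  rewrite lee_fin in B; apply: le_trans B _.
  have t0 : 0 <= h ^+ n by rewrite exprn_ge0 ?invr_ge0.
  have t1 : h ^+ n <= 1 by rewrite exprn_ile1 ?invr_ge0 // invf_le1 // ler1n.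
  by rewrite mulrAC ler_wpM2l ?mulr_ge0 // expr2 ler_piMl.
exact: cvg_cst.
Qed.

End Completeness.

(** * The complex Hilbert space: inner product, completeness and orthogonal projection *)

Section HilbertSpace.
Variable R : realType.
Local Notation mu := (@lebesgue_measure R).
Local Notation rint D f := (mu.-integrable D (EFin \o f)).
Local Notation Rp := (Rpos R).
Local Notation Re := complex.Re.
Local Notation Im := complex.Im.
Local Notation H := (L2 R).
Implicit Types (f g : R -> R) (u v w : H) (a : R[i]) (M : set H).

Definition rip f g : R := \int[mu]_(x in Rp) (f x * g x).

Lemma ripC f g : rip f g = rip g f.
Proof. by apply: eq_Rint => x _; rewrite mulrC. Qed.

Lemma ripDr f g k : sq f -> sq g -> sq k -> rip f (fun x => g x + k x) = rip f g + rip f k.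
Proof.
move=> sf sg sk; rewrite -RintegralD; [|exact: measurable_Rpos|exact: sqM_rint|exact: sqM_rint].
by apply: eq_Rint => x _; rewrite mulrDr.
Qed.

Lemma ripZr c f g : sq f -> sq g -> rip f (fun x => c * g x) = c * rip f g.
Proof.
move=> sf sg; rewrite -RintegralZl; [|exact: measurable_Rpos|exact: sqM_rint].
by apply: eq_Rint => x _; ring.
Qed.

Lemma rip_ae f g f' g' : measurable_fun Rp f -> measurable_fun Rp g ->
  measurable_fun Rp f' -> measurable_fun Rp g' ->
  {ae mu, forall x, Rp x -> f x = f' x} -> {ae mu, forall x, Rp x -> g x = g' x} ->
  rip f g = rip f' g'.
Proof.
move=> mf mg mf' mg' ff gg; apply: ae_eq_Rint; [exact: measurable_Rpos| | |].
- exact: measurable_funM.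
- exact: measurable_funM.
have F := ae_filter_ringOfSetsType mu.
by apply: filterS2 ff gg => x + + x0 => /(_ x0) -> /(_ x0) ->.
Qed.

Lemma rip_ge0 f : 0 <= rip f f.
Proof. by apply: Rintegral_ge0 => x _; rewrite -expr2 sqr_ge0. Qed.

Lemma rip_eq0 f : sq f -> rip f f = 0 -> {ae mu, forall x, Rp x -> f x = 0}.
Proof.
move=> sf f0; have i2 := sqM_rint sf sf.
have := (ae_eq_integral_abs mu (measurable_Rpos (R := R)) (measurable_int mu i2)).1.
have -> : (\int[mu]_(x in Rp) `|(EFin \o (fun y : R => f y * f y)%R) x| = 0)%E.
  under eq_integral => x _ do rewrite gee0_abs ?lee_fin -?expr2 ?sqr_ge0 //.
  by rewrite -[LHS]fineK; [congr EFin; exact: f0|apply: integrable_fin_num => //; exact: measurable_Rpos].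
move=> /(_ erefl); have F := ae_filter_ringOfSetsType mu.
by apply: filterS => x + x0 => /(_ x0) /eqP; rewrite /= eqe mulf_eq0 orbb => /eqP.
Qed.

Definition re u x : R := Re (u x).
Definition im u x : R := Im (u x).

Lemma sqintP (f : R -> R[i]) :
  square_integrable f <-> sq (fun x => Re (f x)) /\ sq (fun x => Im (f x)).
Proof.
have E : (fun x => (normc (f x) ^+ 2)%:E) =
    (EFin \o (fun x => Re (f x) ^+ 2 + Im (f x) ^+ 2)).
  by apply/funext => x; rewrite normcsq.
have mRp := @measurable_Rpos R.
split=> [[[mr mi] I]|[[mr i1] [mi i2]]].
  have i : rint Rp (fun x => Re (f x) ^+ 2 + Im (f x) ^+ 2).
    apply/integrableP; split.
      by apply/measurable_EFinP; apply: measurable_funD; exact: measurable_funX.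
    rewrite E in I; apply: le_lt_trans I; rewrite le_eqVlt; apply/orP; left; apply/eqP.
    by apply: eq_integral => x _; rewrite gee0_abs // lee_fin addr_ge0 ?sqr_ge0.
  split; split=> //; apply: rint_le i => //; try exact: measurable_funX.
    by move=> x _; rewrite ger0_norm ?sqr_ge0 // lerDl sqr_ge0.
  by move=> x _; rewrite ger0_norm ?sqr_ge0 // lerDr sqr_ge0.
split; first by split.
rewrite E; have /integrableP[_] := rintD mRp i1 i2; apply: le_lt_trans.
rewrite le_eqVlt; apply/orP; left; apply/eqP.
by apply: eq_integral => x _; rewrite gee0_abs // lee_fin addr_ge0 ?sqr_ge0.
Qed.

Lemma L2_sqint u : square_integrable u.
Proof. by have := valP (repr u); rewrite inE. Qed.

Lemma sq_re u : sq (re u).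
Proof. exact: ((sqintP _).1 (L2_sqint u)).1. Qed.

Lemma sq_im u : sq (im u).
Proof. exact: ((sqintP _).1 (L2_sqint u)).2. Qed.

Lemma L2_ext u v : ae_eq_Rpos u v -> u = v.
Proof. by move=> uv; rewrite -[u]reprK -[v]reprK; apply/L2_piP. Qed.

Lemma L2_fun_pi (f : sqfun R) : ae_eq_Rpos (L2_fun (\pi_(L2 R)%qT f)) f.
Proof. by apply/L2_piP; rewrite reprK. Qed.

Lemma L2_funD u v : ae_eq_Rpos (L2_fun (u + v)) (fun x => u x + v x).
Proof.
rewrite -{1}[u]reprK -{1}[v]reprK L2_piD; exact: L2_fun_pi.
Qed.

Lemma L2_funZ a u : ae_eq_Rpos (L2_fun (a *: u)) (fun x => a * u x).
Proof. exact: (L2_fun_pi (a *: repr u)). Qed.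

Lemma L2_fun0 : ae_eq_Rpos (L2_fun (0 : H)) (fun=> 0).
Proof.
have F := ae_filter_ringOfSetsType mu.
have := L2_funZ 0 0; rewrite scale0r; apply: filterS => x + x0 => /(_ x0) ->.
by rewrite mul0r.
Qed.

Lemma L2_lin a u v : ae_eq_Rpos (L2_fun (a *: u + v)) (fun x => a * u x + v x).
Proof.
have F := ae_filter_ringOfSetsType mu.
by apply: filterS2 (L2_funD (a *: u) v) (L2_funZ a u) => x + + x0 => /(_ x0) -> /(_ x0) ->.
Qed.

Lemma re_lin a u v : {ae mu, forall x, Rp x ->
  re (a *: u + v) x = Re a * re u x + ((- Im a) * im u x + re v x)}.
Proof.
have F := ae_filter_ringOfSetsType mu.
by apply: filterS (L2_lin a u v) => x + x0 => /(_ x0); rewrite /re => ->; rewrite Re_lin mulNr addrA.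
Qed.

Lemma im_lin a u v : {ae mu, forall x, Rp x ->
  im (a *: u + v) x = Re a * im u x + (Im a * re u x + im v x)}.
Proof.
have F := ae_filter_ringOfSetsType mu.
by apply: filterS (L2_lin a u v) => x + x0 => /(_ x0); rewrite /im => ->; rewrite Im_lin addrA.
Qed.

Lemma conjcD (x y : R[i]) : (x + y)^*%C = x^*%C + y^*%C.
Proof. exact: rmorphD. Qed.

Lemma conjcM (x y : R[i]) : (x * y)^*%C = x^*%C * y^*%C.
Proof. exact: rmorphM. Qed.

Lemma conjcN (x : R[i]) : (- x)^*%C = - x^*%C.
Proof. exact: rmorphN. Qed.

Lemma ipE u v : ip u v = ((rip (re u) (re v) + rip (im u) (im v)) +i*
  (rip (re u) (im v) - rip (im u) (re v)))%C.
Proof.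
have mRp := @measurable_Rpos R.
have i1 := sqM_rint (sq_re u) (sq_re v); have i2 := sqM_rint (sq_im u) (sq_im v).
have i3 := sqM_rint (sq_re u) (sq_im v); have i4 := sqM_rint (sq_im u) (sq_re v).
rewrite /ip /cintegral; congr (_ +i* _)%C.
  rewrite -RintegralD //; apply: eq_Rint => x _.
  by rewrite /re /im; case: (u x) (v x) => ? ? [? ?] /=; ring.
rewrite -RintegralB //; apply: eq_Rint => x _.
by rewrite /re /im; case: (u x) (v x) => ? ? [? ?] /=; ring.
Qed.

(** Three terms because the real part, or the imaginary part, of [a *: u + v] mixes both parts of
    [u] with one part of [v]. *)
Lemma rip_lin3 (c d : R) k f1 f2 f3 g : sq k -> sq f1 -> sq f2 -> sq f3 -> sq g ->
  {ae mu, forall x, Rp x -> g x = c * f1 x + (d * f2 x + f3 x)} ->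
  rip k g = c * rip k f1 + (d * rip k f2 + rip k f3).
Proof.
move=> sk s1 s2 s3 sg E.
have z1 := sqZ c s1; have z2 := sqZ d s2; have z3 := sqD z2 s3.
rewrite -ripZr // -[d * _]ripZr // -ripDr // -ripDr //.
apply: rip_ae => //; try by case: (sk).
- by case: (sg).
- by case: (sqD z1 z3).
- by apply: aeW.
Qed.

Lemma ip_lin u a v w : ip u (a *: v + w) = a * ip u v + ip u w.
Proof.
rewrite !ipE.
have r k : sq k -> rip k (re (a *: v + w)) = Re a * rip k (re v) + ((- Im a) * rip k (im v) + rip k (re w)).
  by move=> sk; apply: rip_lin3 (re_lin a v w); rewrite //; exact: sq_re || exact: sq_im.
have i k : sq k -> rip k (im (a *: v + w)) = Re a * rip k (im v) + (Im a * rip k (re v) + rip k (im w)).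
  by move=> sk; apply: rip_lin3 (im_lin a v w); rewrite //; exact: sq_re || exact: sq_im.
have sr := sq_re u; have si := sq_im u.
rewrite !r // !i //; case: (a) => ar ai /=.
by apply/eqP; rewrite eq_complex /=; apply/andP; split; apply/eqP; ring.
Qed.

Lemma ipC u v : ip v u = (ip u v)^*%C.
Proof.
rewrite !ipE /= (ripC (re v)) (ripC (im v)) (ripC (re v)) (ripC (im v)).
by congr (_ +i* _)%C; ring.
Qed.

Lemma ipDr u v w : ip u (v + w) = ip u v + ip u w.
Proof. by have := ip_lin u 1 v w; rewrite scale1r mul1r. Qed.

Lemma ip0r u : ip u 0 = 0.
Proof. by have /eqP := ipDr u 0 0; rewrite addr0 -subr_eq0 opprD addNKr oppr_eq0 => /eqP. Qed.

Lemma ipZr u a v : ip u (a *: v) = a * ip u v.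
Proof. by have := ip_lin u a v 0; rewrite !addr0 ip0r addr0. Qed.

Lemma ipNr u v : ip u (- v) = - ip u v.
Proof. by rewrite -scaleN1r ipZr mulN1r. Qed.

Lemma ipBr u v w : ip u (v - w) = ip u v - ip u w.
Proof. by rewrite ipDr ipNr. Qed.

Lemma ipDl u v w : ip (u + v) w = ip u w + ip v w.
Proof. by rewrite ipC ipDr conjcD -!ipC. Qed.

Lemma ip0l u : ip 0 u = 0.
Proof. by rewrite ipC ip0r conjc0. Qed.

Lemma ipZl a u v : ip (a *: u) v = a^*%C * ip u v.
Proof. by rewrite ipC ipZr conjcM -ipC. Qed.

Lemma ipNl u v : ip (- u) v = - ip u v.
Proof. by rewrite ipC ipNr conjcN -ipC. Qed.

Lemma ipBl u v w : ip (u - v) w = ip u w - ip v w.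
Proof. by rewrite ipDl ipNl. Qed.

Definition n2 u : R := rip (re u) (re u) + rip (im u) (im u).

Lemma ip_n2 u : ip u u = (n2 u)%:C%C.
Proof. by rewrite ipE /n2 (ripC (im u) (re u)) subrr. Qed.

Lemma n2_ge0 u : 0 <= n2 u.
Proof. by rewrite addr_ge0 // rip_ge0. Qed.

Lemma hnorm_n2 u : hnorm u ^+ 2 = n2 u.
Proof. by rewrite /hnorm ip_n2 /= sqr_sqrtr ?n2_ge0. Qed.

Lemma n2_lin a u v : n2 (a *: u + v) =
  (Re a ^+ 2 + Im a ^+ 2) * n2 u + n2 v + 2 * Re (a * ip v u).
Proof.
have := ip_n2 (a *: u + v).
rewrite ip_lin !ipDl !ipZl (ipC v u) !ip_n2.
move: (n2 (a *: u + v)) (ip v u) => N [zr zi]; case: a => ar ai /eqP.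
by rewrite eq_complex /= => /andP[/eqP <- _]; ring.
Qed.

(* Optimising the quadratic polynomial t |-> e + 2 Re (t z) + |t|^2 q *)
Lemma quad_bound (z : R[i]) (e q : R) : 0 <= q ->
  (forall t : R[i], 0 <= (Re t ^+ 2 + Im t ^+ 2) * q + e + 2 * Re (t * z)) ->
  Re z ^+ 2 + Im z ^+ 2 <= e * q.
Proof.
case: z => zr zi q0 /= Ht.
pose s := zr ^+ 2 + zi ^+ 2.
have s0 : 0 <= s by rewrite addr_ge0 ?sqr_ge0.
have Hs (r : R) : 0 <= r ^+ 2 * s * q + e - 2 * r * s.
  have := Ht (- r * zr +i* (r * zi))%C; rewrite /= /s => H; apply: le_trans H _.
  by rewrite le_eqVlt; apply/orP; left; apply/eqP; ring.
rewrite -/s; move: q0; rewrite le_eqVlt => /predU1P[q0|q0].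
  rewrite -q0 mulr0 leNgt; apply/negP => sp.
  have := Hs ((e + 1) / (2 * s)); rewrite -q0 mulr0 add0r.
  have -> : 2 * ((e + 1) / (2 * s)) * s = e + 1 by field; exact: lt0r_neq0.
  lra.
have := Hs q^-1.
have -> : q^-1 ^+ 2 * s * q + e - 2 * q^-1 * s = (e * q - s) / q by field; exact: lt0r_neq0.
by rewrite pmulr_lge0 ?invr_gt0 // subr_ge0.
Qed.

Lemma cauchy_schwarz u v : Re (ip u v) ^+ 2 + Im (ip u v) ^+ 2 <= n2 u * n2 v.
Proof.
apply: quad_bound; first exact: n2_ge0.
by move=> t; rewrite -n2_lin n2_ge0.
Qed.

Lemma n2_eq0 u : n2 u = 0 -> u = 0.
Proof.
move=> /eqP; rewrite paddr_eq0 ?rip_ge0 // => /andP[/eqP r0 /eqP i0].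
apply: L2_ext; have F := ae_filter_ringOfSetsType mu.
have r1 := rip_eq0 (sq_re u) r0; have i1 := rip_eq0 (sq_im u) i0.
apply: filterS3 r1 i1 L2_fun0 => x Hr Hi H0 x0.
rewrite H0 //; apply/eqP; rewrite eq_complex; apply/andP.
by split; apply/eqP; [exact: Hr|exact: Hi].
Qed.

Lemma n20 : n2 0 = 0.
Proof. by have := ip_n2 0; rewrite ip0r => /eqP; rewrite eq_complex /= => /andP[/eqP <-]. Qed.

Lemma n2N u : n2 (- u) = n2 u.
Proof.
have := ip_n2 (- u); rewrite ipNl ipNr opprK ip_n2 => /eqP.
by rewrite eq_complex /= => /andP[/eqP ->].
Qed.

Lemma hnorm_lt u e : 0 < e -> (hnorm u < e) = (n2 u < e ^+ 2).
Proof.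
move=> e0; rewrite -hnorm_n2 ltr_pXn2r //; rewrite nnegrE; last exact: ltW.
exact: sqrtr_ge0.
Qed.

Lemma L2_complete (u_ : nat -> H) : (forall n, n2 (u_ n.+1 - u_ n) <= 8^-1 ^+ n) ->
  exists u, n2 (u - u_ n) @[n --> \oo] --> 0.
Proof.
move=> hu.
have F := ae_filter_ringOfSetsType mu.
have r1 : Re (-1 : R[i]) = -1 by [].
have i1 : Im (-1 : R[i]) = 0 by exact: oppr0.
have reB u v : {ae mu, forall x, Rp x -> re (u - v) x = re u x - re v x}.
  rewrite addrC -scaleN1r; apply: filterS (re_lin (-1) v u) => x + x0 => /(_ x0) ->.
  by rewrite r1 i1 ?oppr0 mul0r add0r mulN1r addrC.
have imB u v : {ae mu, forall x, Rp x -> im (u - v) x = im u x - im v x}.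
  rewrite addrC -scaleN1r; apply: filterS (im_lin (-1) v u) => x + x0 => /(_ x0) ->.
  by rewrite r1 i1 ?oppr0 mul0r add0r mulN1r addrC.
have ripB k f g : sq k -> sq f -> sq g -> {ae mu, forall x, Rp x -> k x = f x - g x} ->
  rip k k = \int[mu]_(x in Rp) (f x - g x) ^+ 2.
  move=> sk sf sg E; have sfg : sq (fun x => f x - g x) by apply: sqD => //; exact: sqN.
  have -> : rip k k = rip (fun x => f x - g x) (fun x => f x - g x).
    by apply: (rip_ae _ _ _ _ E E); exact: sk.1 || exact: sfg.1.
  by apply: eq_Rint => x _; rewrite expr2.
have [r sr cr] : exists2 f, sq f & \int[mu]_(x in Rp) (f x - re (u_ n) x) ^+ 2 @[n --> \oo] --> 0.
  apply: sq_complete => n; first exact: sq_re.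
  apply: le_trans (hu n); rewrite -(ripB (re (u_ n.+1 - u_ n))); try exact: sq_re; last exact: reB.
  by rewrite lerDl rip_ge0.
have [i si ci] : exists2 f, sq f & \int[mu]_(x in Rp) (f x - im (u_ n) x) ^+ 2 @[n --> \oo] --> 0.
  apply: sq_complete => n; first exact: sq_im.
  apply: le_trans (hu n); rewrite -(ripB (im (u_ n.+1 - u_ n))); try exact: sq_im; last exact: imB.
  by rewrite lerDr rip_ge0.
have sqf : square_integrable (fun x => r x +i* i x)%C by apply/sqintP.
pose u := L2_of (fun x => r x +i* i x)%C.
have uE := L2_ofK sqf.
exists u.
rewrite -[X in _ --> X]addr0.
have -> : (fun n => n2 (u - u_ n)) = (fun n => \int[mu]_(x in Rp) (r x - re (u_ n) x) ^+ 2 +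
    \int[mu]_(x in Rp) (i x - im (u_ n) x) ^+ 2).
  apply/funext => n; congr (_ + _).
    apply: ripB => //; try exact: sq_re.
    apply: filterS2 uE (reB u (u_ n)) => x + + x0 => /(_ x0) E /(_ x0) ->.
    by rewrite /re E.
  apply: ripB => //; try exact: sq_im.
  apply: filterS2 uE (imB u (u_ n)) => x + + x0 => /(_ x0) E /(_ x0) ->.
  by rewrite /im E.
exact: cvgD.
Qed.

Lemma n2_close M u : hclosure M u <-> (forall e, 0 < e -> exists2 v, M v & n2 (u - v) < e).
Proof.
split=> Hu e e0.
  have [|v Mv] := Hu (Num.sqrt e); first by rewrite sqrtr_gt0.
  by rewrite hnorm_lt ?sqrtr_gt0 // sqr_sqrtr ?ltW // => ?; exists v.
have [|v Mv] := Hu (e ^+ 2); first by rewrite exprn_gt0.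
by rewrite -hnorm_lt // => ?; exists v.
Qed.

Lemma closed_subspaceD M u v : closed_subspace M -> M u -> M v -> M (u + v).
Proof. by move=> [_ ML _] Mu Mv; have := ML 1 _ _ Mu Mv; rewrite scale1r. Qed.

Lemma closed_subspaceZ M a u : closed_subspace M -> M u -> M (a *: u).
Proof. by move=> [M0 ML _] Mu; have := ML a _ _ Mu M0; rewrite addr0. Qed.

Lemma closed_subspaceB M u v : closed_subspace M -> M u -> M v -> M (u - v).
Proof.
by move=> cM Mu Mv; apply: closed_subspaceD => //; rewrite -scaleN1r; exact: closed_subspaceZ.
Qed.

Lemma projection M u : closed_subspace M ->
  exists2 p, M p & forall v, M v -> ip v (u - p) = 0.
Proof.
move=> cM; have [M0 ML Mcl] := cM.
pose S := [set n2 (u - v) | v in M].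
have S0 : S !=set0 by exists (n2 (u - 0)), 0.
have Slb : has_lbound S by exists 0 => _ [v _ <-]; exact: n2_ge0.
pose d := inf S.
have dle v : M v -> d <= n2 (u - v) by move=> Mv; apply: ge_inf => //; exists v.
(* By the parallelogram law near-minimisers with these excesses satisfy
   [|p_(n+1) - p_n|^2 <= 2 e_n + 2 e_(n+1)], which is below the rate [8^-n] that [L2_complete] asks
   for. *)
pose e n : R := 8^-1 ^+ n / 4.
have e0 n : 0 < e n by rewrite /e divr_gt0 // exprn_gt0 // invr_gt0.
have /choice[p Hp] : forall n, exists v, M v /\ n2 (u - v) < d + e n.
  move=> n; have [|_ [v Mv <-] Hv] := @inf_adherent _ S (e n) (e0 n); first by split.
  by exists v.
have n2D v w : n2 (v + w) = n2 v + n2 w + 2 * Re (ip w v).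
  by have := n2_lin 1 v w; rewrite scale1r mul1r /= expr1n expr0n addr0 mul1r.
have par v w : n2 (v + w) + n2 (v - w) = 2 * n2 v + 2 * n2 w.
  by rewrite !n2D n2N ipNl; case: (ip w v) => zr zi /=; ring.
have cau n : n2 (p n.+1 - p n) <= 8^-1 ^+ n.
  have := par (u - p n) (u - p n.+1).
  have -> : u - p n - (u - p n.+1) = p n.+1 - p n by rewrite opprB addrC addrA subrK.
  have -> : u - p n + (u - p n.+1) = 2 *: (u - 2^-1 *: (p n + p n.+1)).
    rewrite scalerBr scalerA mulfV ?pnatr_eq0 // scale1r scaler_nat mulr2n opprD.
    by rewrite addrACA.
  have -> : n2 (2 *: (u - 2^-1 *: (p n + p n.+1))) = 4 * n2 (u - 2^-1 *: (p n + p n.+1)).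
    by have := n2_lin 2 (u - 2^-1 *: (p n + p n.+1)) 0; rewrite addr0 => ->; rewrite n20 ip0l mulr0 /= ; ring.
  have Mm : M (2^-1 *: (p n + p n.+1)).
    by apply: closed_subspaceZ => //; apply: closed_subspaceD => //; [exact: (Hp n).1|exact: (Hp n.+1).1].
  have := dle _ Mm; have := (Hp n).2; have := (Hp n.+1).2; rewrite /e exprS.
  have : 0 <= (8^-1 : R) ^+ n by rewrite exprn_ge0 // invr_ge0.
  by move: (8^-1 ^+ n) => t; lra.
have [q Hq] := L2_complete cau.
have Mq : M q.
  apply: Mcl; apply/n2_close => f f0.
  have /cvgrPdist_lt /(_ f f0) [n _ /(_ n (leqnn n))] := Hq.
  rewrite /= sub0r normrN ger0_norm ?n2_ge0 // => ?.
  by exists (p n) => //; exact: (Hp n).1.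
exists q => // v Mv.
(* Near-minimality is approximate orthogonality: moving [p n] along [t *: v] stays in [M] and gains
   at most [e n], which is the hypothesis of [quad_bound]. *)
have b1 n : Re (ip (u - p n) v) ^+ 2 + Im (ip (u - p n) v) ^+ 2 <= e n * n2 v.
  apply: quad_bound; first exact: n2_ge0.
  move=> t; have := n2_lin t v (u - p n).
  have := (Hp n).2; have : d <= n2 (t *: v + (u - p n)).
    have -> : t *: v + (u - p n) = u - (p n - t *: v) by rewrite opprB addrCA addrC -addrA.
    by apply: dle; apply: closed_subspaceB => //; [exact: (Hp n).1|exact: closed_subspaceZ].
  by move=> *; lra.
have b2 n : Re (ip (u - q) v) ^+ 2 + Im (ip (u - q) v) ^+ 2 <= 2 * (e n * n2 v) + 2 * (n2 (q - p n) * n2 v).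
  have := b1 n; have := cauchy_schwarz (q - p n) v.
  have -> : ip (u - q) v = ip (u - p n) v - ip (q - p n) v.
    by rewrite -ipBl opprB addrA subrK.
  case: (ip (u - p n) v) (ip (q - p n) v) => a b [a' b'] /= H1 H2.
  have := sqr_ge0 (a + a'); have := sqr_ge0 (b + b'); nra.
have lim0 : 2 * (e n * n2 v) + 2 * (n2 (q - p n) * n2 v) @[n --> \oo] --> 0.
  rewrite -[X in _ --> X](_ : 2 * (0 / 4 * n2 v) + 2 * (0 * n2 v) = 0); last by rewrite !mul0r !mulr0 addr0.
  apply: cvgD; apply: cvgM; try exact: cvg_cst; apply: cvgM; try exact: cvg_cst; last exact: Hq.
  apply: cvgM; try exact: cvg_cst.
  by apply: cvg_expr; rewrite ger0_norm ?invr_ge0 // invf_lt1 // ltr1n.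
have : Re (ip (u - q) v) ^+ 2 + Im (ip (u - q) v) ^+ 2 <= 0.
  rewrite -(cvg_lim (@Rhausdorff R) lim0); apply: limr_ge; first exact: cvgP lim0.
  exact: nearW.
rewrite le_eqVlt ltNge addr_ge0 ?sqr_ge0 // orbF paddr_eq0 ?sqr_ge0 // !sqrf_eq0 => H.
have z : ip (u - q) v = 0 by apply/eqP; rewrite eq_complex.
by rewrite ipC z conjc0.
Qed.

End HilbertSpace.

(** * Weak derivatives and traces of classes of functions; Green's formula *)

Section Sobolev.
Variable R : realType.
Local Notation mu := (@lebesgue_measure R).
Local Notation mset := (set (measurableTypeR R)).
Local Notation Rp := (Rpos R).
Local Notation Re := complex.Re.
Local Notation Im := complex.Im.
Local Notation H := (L2 R).
Implicit Types (f g : R -> R) (u v w : H) (a : R[i]).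

Lemma indic_itv_sq b : sq (\1_(`]0, b]) : R -> R).
Proof.
have mI : measurable (`]0, b] : mset) by exact: measurable_itv.
split; first exact: measurable_indic.
apply: (@rint_eq _ _ (\1_(`]0, b]))); first exact: measurable_Rpos.
  by move=> x _; rewrite indicE; case: (_ \in _); rewrite ?expr1n ?expr0n.
have := locint_cst 1 b; rewrite integrable_mkcond // restrict_EFin => i1.
apply: (@rint_eq R Rp (((fun=> 1) : R -> R) \_ `]0, b])); first exact: measurable_Rpos.
  by move=> x _; rewrite patchE indicE; case: (_ \in _).
by apply: integrableS i1 => //; exact: measurable_Rpos.
Qed.

Lemma sq_supp f b C : measurable_fun Rp f -> (forall x, `|f x| <= C) ->
  (forall x, b < x -> f x = 0) -> sq f.
Proof.
move=> mf fC f0.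
have S : sq (fun x => f x * (\1_(`]0, b]) : R -> R) x).
  by apply: (@sqMb _ _ _ C) => //; exact: indic_itv_sq.
apply: (sq_le mf S) => x; rewrite RposE => x0.
have [bx|xb] := ltP b x; first by rewrite f0 // mul0r.
by rewrite indicE mem_set ?mulr1 //= in_itv /= x0.
Qed.

Lemma test_sq (phi : R -> R) : test_function phi -> sq phi /\ sq (derive1 phi).
Proof.
move=> tphi; have [m1 m2 [C HC]] := test_bounded tphi.
have [dphi cphi [a [b [a0 supp]]]] := tphi.
split; apply: (@sq_supp _ b C) => //; try by move=> x; have [] := HC x.
  by move=> x bx; apply: supp; rewrite in_itv /= negb_and -!ltNge bx orbT.
move=> x bx; rewrite derive1E.
have D : is_derive x 1 phi 0.
  by apply: (derive1_supp supp); rewrite in_itv /= negb_and -!ltNge bx orbT.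
by rewrite derive_val.
Qed.

Lemma wderiv_lin3 (c d : R) f1 f2 f3 f g1 g2 g3 g :
  sq f1 -> sq f2 -> sq f3 -> sq f -> sq g1 -> sq g2 -> sq g3 -> sq g ->
  {ae mu, forall x, Rp x -> f x = c * f1 x + (d * f2 x + f3 x)} ->
  {ae mu, forall x, Rp x -> g x = c * g1 x + (d * g2 x + g3 x)} ->
  wderiv f1 g1 -> wderiv f2 g2 -> wderiv f3 g3 -> wderiv f g.
Proof.
move=> sf1 sf2 sf3 sf sg1 sg2 sg3 sg fE gE w1 w2 w3 phi tphi.
have [s0 s1] := test_sq tphi.
change (rip f (derive1 phi) = - rip g phi).
rewrite ripC (ripC g) (rip_lin3 s1 sf1 sf2 sf3 sf fE) (rip_lin3 s0 sg1 sg2 sg3 sg gE).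
have E (p q : R -> R) : wderiv p q -> rip (derive1 phi) p = - rip phi q.
  by move=> W; rewrite ripC (ripC phi); exact: W.
by rewrite (E _ _ w1) (E _ _ w2) (E _ _ w3); ring.
Qed.

(** Two weak derivatives give two continuous representatives of [f]. These coincide on the closed
    half-line, so the primitives coincide, and so do their derivatives almost everywhere. *)
Lemma wderiv_unique f g1 g2 : sq f -> sq g1 -> sq g2 -> wderiv f g1 -> wderiv f g2 ->
  {ae mu, forall x, Rp x -> g1 x = g2 x}.
Proof.
move=> sf s1 s2 w1 w2; have F := ae_filter_ringOfSetsType mu.
have [c1 E1] := wderiv_rep sf s1 w1; have [c2 E2] := wderiv_rep sf s2 w2.
have l1 := sq_locint s1; have l2 := sq_locint s2.
have E x : 0 <= x -> c1 + prim g1 x = c2 + prim g2 x.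
  apply: (@continuous_ae_eq _ (fun x => c1 + prim g1 x) (fun x => c2 + prim g2 x)).
  - by apply: continuous_subspaceT => y; apply: cvgD; [exact: cvg_cst|exact: continuous_prim].
  - by apply: continuous_subspaceT => y; apply: cvgD; [exact: cvg_cst|exact: continuous_prim].
  - by apply: filterS2 E1 E2 => y + + y0 => /(_ y0) <- /(_ y0) <-.
have c12 : c1 = c2 by have := E 0 (lexx _); rewrite !prim0 // !addr0.
have p12 : prim g1 = prim g2.
  apply/funext => x; have [x0|x0] := leP 0 x; first by have := E x x0; rewrite c12 => /addrI.
  by rewrite !prim0 // ltW.
apply: filterS2 (derive_prim_ae l1) (derive_prim_ae l2) => x + + x0.
rewrite RposE in x0; rewrite p12 => /(_ x0) [_ <-] /(_ x0) [_ <-] //.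
Qed.

Lemma weak_derivativeP u v : is_weak_derivative u v <->
  wderiv (re u) (re v) /\ wderiv (im u) (im v).
Proof.
have E (z : H) (phi : R -> R) : cintegral (fun x => z x * (phi x)%:C%C) =
    (rip (re z) phi +i* rip (im z) phi)%C.
  rewrite /cintegral; congr (_ +i* _)%C; apply: eq_Rint => x _; rewrite /re /im.
    by case: (z x) => zr zi /=; ring.
  by case: (z x) => zr zi /=; ring.
split=> [W|[W1 W2] phi tphi].
  by split=> phi tphi; have := W phi tphi; rewrite !E => /eqP; rewrite eq_complex /= => /andP[/eqP ? /eqP ?].
by rewrite !E; apply/eqP; rewrite eq_complex /=; apply/andP; split; apply/eqP; [exact: W1|exact: W2].
Qed.

Lemma is_weak_derivative_unique u v w :
  is_weak_derivative u v -> is_weak_derivative u w -> v = w.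
Proof.
move=> /weak_derivativeP[r1 i1] /weak_derivativeP[r2 i2]; apply: L2_ext.
have F := ae_filter_ringOfSetsType mu.
have Er := wderiv_unique (sq_re u) (sq_re v) (sq_re w) r1 r2.
have Ei := wderiv_unique (sq_im u) (sq_im v) (sq_im w) i1 i2.
apply: filterS2 Er Ei => x Hr Hi x0.
by apply/eqP; rewrite eq_complex; apply/andP; split; apply/eqP; [exact: Hr|exact: Hi].
Qed.

Lemma weak_derivativeE u v : is_weak_derivative u v -> weak_derivative u = v.
Proof.
move=> W; rewrite /weak_derivative; case: xgetP => [w _ Hw|/(_ v)//].
exact: is_weak_derivative_unique Hw W.
Qed.

Lemma H2P u : H2 u -> is_weak_derivative u (weak_derivative u) /\
  is_weak_derivative (weak_derivative u) (weak_derivative (weak_derivative u)).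
Proof.
by move=> [v [w [W1 W2]]]; rewrite (weak_derivativeE W1) (weak_derivativeE W2).
Qed.

Lemma is_weak_derivative_lin a u u' v v' :
  is_weak_derivative u u' -> is_weak_derivative v v' ->
  is_weak_derivative (a *: u + v) (a *: u' + v').
Proof.
move=> /weak_derivativeP[r1 i1] /weak_derivativeP[r2 i2]; apply/weak_derivativeP; split.
  by apply: (wderiv_lin3 _ _ _ _ _ _ _ _ (re_lin a u v) (re_lin a u' v')); rewrite //; exact: sq_re || exact: sq_im.
by apply: (wderiv_lin3 _ _ _ _ _ _ _ _ (im_lin a u v) (im_lin a u' v')); rewrite //; exact: sq_re || exact: sq_im.
Qed.

(** Whatever representative [xget] selects agrees with [fr] and [fi] almost everywhere, hence at 0
    by continuity from the right. *)
Lemma trace0E u (fr fi : R -> R) : continuous fr -> continuous fi ->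
  {ae mu, forall x, Rp x -> re u x = fr x} -> {ae mu, forall x, Rp x -> im u x = fi x} ->
  trace0 u = (fr 0 +i* fi 0)%C.
Proof.
move=> cr ci Er Ei; have F := ae_filter_ringOfSetsType mu.
rewrite /trace0; case: xgetP => [c _ [g [gr gi ge <-]]|/(_ (fr 0 +i* fi 0)%C)].
  have Hr : Re (g 0) = fr 0.
    apply: (@continuous_ae_eq _ (fun x => Re (g x)) fr) => //; first exact: continuous_subspaceT.
    by apply: filterS2 ge Er => x + + x0 => /(_ x0) <- /(_ x0).
  have Hi : Im (g 0) = fi 0.
    apply: (@continuous_ae_eq _ (fun x => Im (g x)) fi) => //; first exact: continuous_subspaceT.
    by apply: filterS2 ge Ei => x + + x0 => /(_ x0) <- /(_ x0).
  by rewrite -Hr -Hi; case: (g 0).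
case; exists (fun x => fr x +i* fi x)%C; split=> //; try exact: continuous_subspaceT.
apply: filterS2 Er Ei => x + + x0 => /(_ x0) Hr /(_ x0) Hi.
by rewrite -Hr -Hi /re /im; case: (u x).
Qed.

Lemma weak_derivative_rep u v : is_weak_derivative u v ->
  {ae mu, forall x, Rp x -> re u x = Re (trace0 u) + prim (re v) x} /\
  {ae mu, forall x, Rp x -> im u x = Im (trace0 u) + prim (im v) x}.
Proof.
move=> /weak_derivativeP[wr wi].
have [cr Er] := wderiv_rep (sq_re u) (sq_re v) wr.
have [ci Ei] := wderiv_rep (sq_im u) (sq_im v) wi.
rewrite (@trace0E u (fun x => cr + prim (re v) x) (fun x => ci + prim (im v) x)) //=.
- by rewrite !prim0 // !addr0.
- move=> x; apply: cvgD; first exact: cvg_cst.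
  by apply: continuous_prim; apply: sq_locint; exact: sq_re.
- move=> x; apply: cvgD; first exact: cvg_cst.
  by apply: continuous_prim; apply: sq_locint; exact: sq_im.
Qed.

Lemma trace0_lin a u u' v v' : is_weak_derivative u u' -> is_weak_derivative v v' ->
  trace0 (a *: u + v) = a * trace0 u + trace0 v.
Proof.
move=> W1 W2; have [r1 i1] := weak_derivative_rep W1; have [r2 i2] := weak_derivative_rep W2.
have F := ae_filter_ringOfSetsType mu.
have cp (z : H) c : continuous (fun x => c + prim (re z) x) /\ continuous (fun x => c + prim (im z) x).
  split=> x; apply: cvgD; try exact: cvg_cst; apply: continuous_prim; apply: sq_locint.
    exact: sq_re.
  exact: sq_im.
pose fr z c x := c + prim (re z) x : R; pose fi z c x := c + prim (im z) x : R.
rewrite (@trace0E _ (fun x => Re a * fr u' (Re (trace0 u)) x + ((- Im a) * fi u' (Im (trace0 u)) x + fr v' (Re (trace0 v)) x))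
  (fun x => Re a * fi u' (Im (trace0 u)) x + (Im a * fr u' (Re (trace0 u)) x + fi v' (Im (trace0 v)) x))).
- rewrite /fr /fi !prim0 // !addr0.
  by case: a (trace0 u) (trace0 v) => ? ? [? ?] [? ?]; apply/eqP; rewrite eq_complex /=; apply/andP; split; apply/eqP; ring.
- move=> x; apply: cvgD; first by apply: cvgM; [exact: cvg_cst|exact: (cp _ _).1].
  by apply: cvgD; [apply: cvgM; [exact: cvg_cst|exact: (cp _ _).2]|exact: (cp _ _).1].
- move=> x; apply: cvgD; first by apply: cvgM; [exact: cvg_cst|exact: (cp _ _).2].
  by apply: cvgD; [apply: cvgM; [exact: cvg_cst|exact: (cp _ _).1]|exact: (cp _ _).2].
- apply: filterS2 (filterI r1 (filterI i1 r2)) (re_lin a u v) => x [Hr [Hi Hr']] Hl x0.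
  by rewrite Hl // Hr // Hi // Hr'.
- apply: filterS2 (filterI r1 (filterI i1 i2)) (im_lin a u v) => x [Hr [Hi Hr']] Hl x0.
  by rewrite Hl // Hr // Hi // Hr'.
Qed.

(** [by_parts] needs a continuous [f1]. A second weak derivative [f2] supplies such a representative
    [g1], and integrating it gives the C^1 representative [g] of [f]. *)
Lemma by_parts_ae (f f1 f2 v w : R -> R) c c1 d :
  sq f -> sq f1 -> sq f2 -> sq v -> sq w -> wderiv v w ->
  {ae mu, forall x, Rp x -> f x = c + prim f1 x} ->
  {ae mu, forall x, Rp x -> f1 x = c1 + prim f2 x} ->
  {ae mu, forall x, Rp x -> v x = d + prim w x} ->
  rip f1 v + rip f w = - (c * d).
Proof.
move=> sf sf1 sf2 sv sw vw fE f1E vE.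
have F := ae_filter_ringOfSetsType mu.
pose g1 x := c1 + prim f2 x; pose g x := c + prim g1 x.
have cg1 : continuous g1.
  by move=> x; apply: cvgD; [exact: cvg_cst|apply: continuous_prim; exact: sq_locint].
have mg1 : measurable_fun Rp g1 by apply: measurable_funTS; exact: continuous_measurable_fun.
have pE : prim f1 = prim g1 by apply: prim_ae => //; exact: sq_locint.
have sqae p q : sq p -> measurable_fun Rp q -> {ae mu, forall x, Rp x -> p x = q x} -> sq q.
  move=> [mp ip] mq pq; split => //.
  apply/integrableP; split; first by apply/measurable_EFinP; exact: measurable_funX.
  have /integrableP[_] := ip; apply: le_lt_trans; rewrite le_eqVlt; apply/orP; left; apply/eqP.
  apply: ge0_ae_eq_integral => //; first exact: measurable_Rpos.
  - by apply/measurableT_comp => //; apply/measurable_EFinP; exact: measurable_funX.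
  - by apply/measurableT_comp => //; apply/measurable_EFinP; exact: measurable_funX.
  - by apply: filterS pq => x pqx x0 /=; rewrite pqx.
have sg1 : sq g1 by apply: sqae f1E.
have cg : continuous g.
  by move=> x; apply: cvgD; [exact: cvg_cst|apply: continuous_prim; exact: sq_locint].
have mg : measurable_fun Rp g by apply: measurable_funTS; exact: continuous_measurable_fun.
have gE : {ae mu, forall x, Rp x -> f x = g x} by apply: filterS fE => x Hx x0; rewrite Hx // pE.
have sg : sq g by apply: sqae gE.
have := by_parts cg1 erefl sg sg1 sv sw vw vE.
rewrite -[LHS]/(\int[mu]_(x in Rp) (g1 x * v x + g x * w x)) RintegralD; [|exact: measurable_Rpos|exact: sqM_rint|exact: sqM_rint].
move=> <-; congr (_ + _).
- by apply: rip_ae f1E _; rewrite ?sf1.1 ?sv.1 //; [exact: sf1.1|exact: sv.1|exact: sv.1|exact: aeW].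
- by apply: rip_ae gE _; [exact: sf.1|exact: sw.1|exact: mg|exact: sw.1|exact: aeW].
Qed.

(** Half of Green's formula, applied with [v1] the derivative of a domain function. The two halves,
    with [u] and [v] exchanged, share the term [<u', v'>], which cancels in the boundary form. *)
Lemma green u u1 u2 v1 v2 :
  is_weak_derivative u u1 -> is_weak_derivative u1 u2 -> is_weak_derivative v1 v2 ->
  ip u1 v1 + ip u v2 = - ((trace0 u)^*%C * trace0 v1).
Proof.
move=> Wu Wu1 Wv1.
have [ur ui] := weak_derivative_rep Wu; have [u1r u1i] := weak_derivative_rep Wu1.
have [v1r v1i] := weak_derivative_rep Wv1.
have [wr wi] := (weak_derivativeP _ _).1 Wv1.
have sr (z : H) := sq_re z; have si (z : H) := sq_im z.
have rr := by_parts_ae (sr u) (sr u1) (sr u2) (sr v1) (sr v2) wr ur u1r v1r.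
have ri := by_parts_ae (sr u) (sr u1) (sr u2) (si v1) (si v2) wi ur u1r v1i.
have ir := by_parts_ae (si u) (si u1) (si u2) (sr v1) (sr v2) wr ui u1i v1r.
have ii := by_parts_ae (si u) (si u1) (si u2) (si v1) (si v2) wi ui u1i v1i.
rewrite !ipE; move: rr ri ir ii; case: (trace0 u) (trace0 v1) => a b [c d] /= rr ri ir ii.
by apply/eqP; rewrite eq_complex /=; apply/andP; split; apply/eqP; lra.
Qed.

End Sobolev.

(** * Exponentially weighted estimates for second-order equations with zero Cauchy data *)

Section Volterra.
Variable R : realType.
Local Notation mu := (@lebesgue_measure R).
Local Notation rint D f := (mu.-integrable D (EFin \o f)).
Local Notation mset := (set (measurableTypeR R)).
Local Notation Rp := (Rpos R).
Local Notation Re := complex.Re.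
Local Notation Im := complex.Im.
Local Notation H := (L2 R).
Implicit Types (f g : R -> R) (u v w y p : H) (a z : R[i]) (s x X Q K C : R).

(** This norm is a sum over components, so bounds on real primitives of the two parts add up
    directly; compared with the modulus it costs a factor 2. *)
Definition nrm1 z : R := `|Re z| + `|Im z|.

Lemma nrm1_ge0 z : 0 <= nrm1 z.
Proof. by rewrite addr_ge0. Qed.

Lemma nrm1D z a : nrm1 (z + a) <= nrm1 z + nrm1 a.
Proof.
by case: z a => zr zi [ar ai]; rewrite /nrm1 /= addrACA lerD // ler_normD.
Qed.

Lemma nrm1M z a : nrm1 (z * a) <= nrm1 z * nrm1 a.
Proof.
case: z a => zr zi [ar ai]; rewrite /nrm1 /=.
have H1 := ler_normB (zr * ar) (zi * ai); have H2 := ler_normD (zr * ai) (zi * ar).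
rewrite !normrM in H1 H2; apply: le_trans (lerD H1 H2) _.
by rewrite le_eqVlt; apply/orP; left; apply/eqP; ring.
Qed.

Lemma Rintegral_expR s x : 0 < s -> 0 < x ->
  \int[mu]_(t in `]0, x]) expR (s * t) = (expR (s * x) - 1) / s.
Proof.
move=> s0 x0.
have D (t : R) : is_derive t 1 (fun t : R => expR (s * t) / s) (expR (s * t)).
  have d1 : is_derive t 1 (fun t : R => s * t) s.
    by apply: is_derive_eq; rewrite /GRing.scale /= mulr1.
  have d2 : is_derive t 1 (expR \o (fun t : R => s * t)) (expR (s * t) * s).
    by apply: is_derive1_comp.
  rewrite (_ : (fun t => _) = s^-1 \*: (expR \o (fun t : R => s * t))); last first.
    by apply/funext => r; rewrite /= mulrC.
  by apply: is_derive_eq; rewrite /GRing.scale /=; field; exact: lt0r_neq0.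
have ce : continuous (fun t : R => expR (s * t)).
  move=> t; apply: (@continuous_comp _ _ _ (fun t : R => s * t) expR); last exact: continuous_expR.
  by apply: cvgM; [exact: cvg_cst|exact: cvg_id].
have cF : continuous (fun t : R => expR (s * t) / s).
  by move=> t; apply: cvgM; [exact: ce|exact: cvg_cst].
have -> : \int[mu]_(t in `]0, x]) expR (s * t) = \int[mu]_(t in `[0, x]) expR (s * t).
  rewrite Rintegral_itv_obnd_cbnd //.
  have ic : rint `[0, x] (fun t => expR (s * t)).
    by apply: continuous_compact_integrable; [exact: segment_compact|exact: continuous_subspaceT].
  apply: integrableS ic; [exact: measurable_itv|exact: measurable_itv|].
    by move=> t /=; rewrite !in_itv /= => /andP[/ltW -> ->].
rewrite /Rintegral (@continuous_FTC2 _ _ (fun t => expR (s * t) / s)) //=.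
- by rewrite mulr0 expR0 mulrBl.
- exact: continuous_subspaceT.
- split; [by move=> t _; case: (D t)|exact: cvg_at_right_filter (cF _)|exact: cvg_at_left_filter (cF _)].
- by move=> t _; rewrite derive1E; have d := D t; rewrite derive_val.
Qed.

(* Since int_0^x e^(st) dt <= e^(sx) / s, each integration gains a factor 1/s
   for bounds of the form K e^(sx). *)
Lemma prim_exp_bound g s X K : 0 < s -> 0 <= K -> locint g ->
  {ae mu, forall x, 0 < x <= X -> `|g x| <= K * expR (s * x)} ->
  forall x, 0 <= x <= X -> `|prim g x| <= K / s * expR (s * x).
Proof.
move=> s0 K0 lg gK x /andP[x0 xX].
have [->|xn] := eqVneq x 0.
  by rewrite prim0 // normr0 mulr_ge0 ?divr_ge0 ?expR_ge0 // ltW.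
have xp : 0 < x by rewrite lt_def xn.
have ce : continuous (fun t : R => expR (s * t)).
  move=> t; apply: (@continuous_comp _ _ _ (fun t : R => s * t) expR); last exact: continuous_expR.
  by apply: cvgM; [exact: cvg_cst|exact: cvg_id].
have ie : rint `]0, x] (fun t => expR (s * t)).
  have ic : rint `[0, x] (fun t => expR (s * t)).
    by apply: continuous_compact_integrable; [exact: segment_compact|exact: continuous_subspaceT].
  apply: integrableS ic; [exact: measurable_itv|exact: measurable_itv|].
    by move=> t /=; rewrite !in_itv /= => /andP[/ltW -> ->].
have mx : measurable (`]0, x] : mset) by exact: measurable_itv.
apply: (@le_trans _ _ (\int[mu]_(t in `]0, x]) `|g t|)); first exact: le_normr_Rintegral.
apply: (@le_trans _ _ (\int[mu]_(t in `]0, x]) (K * expR (s * t)))); last first.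
  rewrite RintegralZl // Rintegral_expR // mulrA mulrAC mulrBr mulr1 -!mulrA.
  by rewrite lerBlDr lerDl divr_ge0 // ltW.
have ig : rint `]0, x] (fun t => `|g t|) by apply: rint_norm => //; exact: lg.
have iK := rintZ K mx ie.
rewrite /Rintegral fine_le //.
- exact: integrable_fin_num ig.
- exact: integrable_fin_num iK.
apply: ae_ge0_le_integral => //.
- exact: (measurable_int mu ig).
- by move=> t _; rewrite lee_fin mulr_ge0 ?expR_ge0.
- exact: (measurable_int mu iK).
- have F := ae_filter_ringOfSetsType mu.
  apply: filterS gK => t Ht /=; rewrite in_itv /= => /andP[t0 tx].
  by rewrite lee_fin Ht // t0 (le_trans tx).
Qed.

(** Let [Q0'] be the maximum of [|y| e^(-sx)] on [[0, X]]. With zero Cauchy data, integrating [y2]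
    twice gives [Q0' <= 2 (C Q0' + Q) / s^2], the 2 coming from the two components. The condition
    [4 C <= s^2] absorbs half of [Q0'] and leaves [4 Q / s^2]. *)
Lemma volterra_estimate y y1 y2 p C X s Q :
  is_weak_derivative y y1 -> is_weak_derivative y1 y2 ->
  trace0 y = 0 -> trace0 y1 = 0 -> 0 <= C -> 0 < s -> 4 * C <= s ^+ 2 -> 0 <= Q -> 0 < X ->
  {ae mu, forall x, Rp x -> nrm1 (y2 x) <= C * nrm1 (y x) + nrm1 (p x)} ->
  {ae mu, forall x, 0 < x <= X -> nrm1 (p x) <= Q * expR (s * x)} ->
  {ae mu, forall x, 0 < x <= X -> nrm1 (y x) <= 4 * Q / s ^+ 2 * expR (s * x)}.
Proof.
move=> W0 W1 t0 t1 C0 s0 Cs Q0 X0 hy hp.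
have F := ae_filter_ringOfSetsType mu.
have [] := weak_derivative_rep W0; rewrite t0 /= => yr yi.
have [] := weak_derivative_rep W1; rewrite t1 /= => y1r y1i.
have lr (z : H) := sq_locint (sq_re z); have li (z : H) := sq_locint (sq_im z).
pose fr := prim (re y1); pose fi := prim (im y1).
have cfr : continuous fr by exact: continuous_prim.
have cfi : continuous fi by exact: continuous_prim.
pose m x : R := `|fr x| + `|fi x|.
have cm : continuous (fun x => m x * expR (- s * x)).
  move=> x; apply: cvgM.
    by apply: cvgD; apply: cvg_norm; [exact: cfr|exact: cfi].
  apply: (@continuous_comp _ _ _ (fun t : R => - s * t) expR); last exact: continuous_expR.
  by apply: cvgM; [exact: cvg_cst|exact: cvg_id].
have em x : m x = m x * expR (- s * x) * expR (s * x).
  by rewrite -mulrA -expRD mulNr addNr expR0 mulr1.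
have [x0 x0X Hx0] := EVT_max (ltW X0) (continuous_subspaceT cm).
set Q0' := m x0 * expR (- s * x0) in Hx0.
have Q0'0 : 0 <= Q0' by rewrite mulr_ge0 ?addr_ge0 ?expR_ge0.
have mQ x : 0 < x <= X -> m x <= Q0' * expR (s * x).
  move=> /andP[xp xX]; rewrite em ler_wpM2r ?expR_ge0 //; apply: Hx0.
  by rewrite in_itv /= (ltW xp).
have ym : {ae mu, forall x, Rp x -> nrm1 (y x) = m x}.
  apply: filterS2 yr yi => x Hr Hi xp.
  by rewrite /nrm1 /m /fr /fi -[prim _ x]add0r -Hr // -[prim _ x]add0r -Hi.
pose K := C * Q0' + Q.
have K0 : 0 <= K by rewrite addr_ge0 // mulr_ge0.
have b2 : {ae mu, forall x, 0 < x <= X -> nrm1 (y2 x) <= K * expR (s * x)}.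
  apply: filterS3 hy hp ym => x H1 H2 H3 xX.
  have xp : Rp x by rewrite RposE; case/andP: xX.
  have := H1 xp; rewrite H3 // => H4; apply: le_trans H4 _; rewrite /K mulrDl lerD ?H2 //.
  by rewrite -mulrA ler_wpM2l // mQ.
have b1r x : 0 <= x <= X -> `|prim (re y2) x| <= K / s * expR (s * x).
  apply: prim_exp_bound => //; apply: filterS b2 => t Ht tX.
  by apply: le_trans (Ht tX); rewrite lerDl.
have b1i x : 0 <= x <= X -> `|prim (im y2) x| <= K / s * expR (s * x).
  apply: prim_exp_bound => //; apply: filterS b2 => t Ht tX.
  by apply: le_trans (Ht tX); rewrite lerDr.
have Ks0 : 0 <= K / s by rewrite divr_ge0 // ltW.
have b0r x : 0 <= x <= X -> `|fr x| <= K / s / s * expR (s * x).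
  apply: prim_exp_bound => //; apply: filterS y1r => t Ht tX.
  have /andP[tp tX'] := tX; rewrite Ht ?RposE // add0r; apply: b1r.
  by rewrite (ltW tp).
have b0i x : 0 <= x <= X -> `|fi x| <= K / s / s * expR (s * x).
  apply: prim_exp_bound => //; apply: filterS y1i => t Ht tX.
  have /andP[tp tX'] := tX; rewrite Ht ?RposE // add0r; apply: b1i.
  by rewrite (ltW tp).
have Qb : Q0' <= 2 * (K / s / s).
  have xx : 0 <= x0 <= X by move: x0X; rewrite in_itv.
  have e1 : expR (s * x0) * expR (- s * x0) = 1 by rewrite -expRD mulNr subrr expR0.
  have : m x0 <= 2 * (K / s / s) * expR (s * x0).
    by rewrite /m; have := b0r _ xx; have := b0i _ xx; lra.
  move=> /(ler_wpM2r (expR_ge0 (- s * x0))) H1; apply: le_trans H1 _.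
  by rewrite -(mulrA _ (expR (s * x0))) e1 mulr1.
have Qb' : Q0' <= 4 * Q / s ^+ 2.
  have s2 : 0 < s ^+ 2 by rewrite exprn_gt0.
  have E : K / s / s = K / s ^+ 2 by rewrite expr2 invfM mulrA.
  rewrite E mulrA ler_pdivlMr // in Qb; rewrite ler_pdivlMr //.
  have := ler_wpM2l Q0'0 Cs; rewrite /K in Qb; lra.
apply: filterS ym => x Hx xX; have /andP[xp _] := xX.
by rewrite Hx ?RposE //; apply: le_trans (mQ x xX) _; rewrite ler_wpM2r ?expR_ge0.
Qed.

(** The estimate with [p = 0] and [Q = 0], on every interval with integer right end. The choice
    [s = 4 C + 1] is at least 1, so [4 C <= s <= s^2]. *)
Lemma volterra_unique y y1 y2 C :
  is_weak_derivative y y1 -> is_weak_derivative y1 y2 ->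
  trace0 y = 0 -> trace0 y1 = 0 -> 0 <= C ->
  {ae mu, forall x, Rp x -> nrm1 (y2 x) <= C * nrm1 (y x)} -> y = 0.
Proof.
move=> W0 W1 t0 t1 C0 hy; have F := ae_filter_ringOfSetsType mu.
pose s := 4 * C + 1.
have s1 : 1 <= s by rewrite /s lerDr mulr_ge0.
have s0 : 0 < s by exact: lt_le_trans s1.
have Cs : 4 * C <= s ^+ 2 by rewrite expr2; apply: le_trans (_ : s <= _); [rewrite /s lerDl|rewrite ler_peMr ?(ltW s0)].
have key (n : nat) : {ae mu, forall x, 0 < x <= n.+1%:R -> nrm1 (y x) <= 0}.
  have n0 : (0 : R) < n.+1%:R by [].
  have := volterra_estimate (p := 0) W0 W1 t0 t1 C0 s0 Cs (lexx 0) n0 _ _.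
  rewrite mulr0 mul0r => H0.
  have H1 : {ae mu, forall x, Rp x -> nrm1 (y2 x) <= C * nrm1 (y x) + nrm1 ((0 : H) x)}.
    apply: filterS hy => x Hx x0; rewrite (le_trans (Hx x0)) // lerDl; exact: nrm1_ge0.
  have H2 : {ae mu, forall x, 0 < x <= n.+1%:R -> nrm1 ((0 : H) x) <= 0 * expR (s * x)}.
    apply: filterS (@L2_fun0 R) => x Hx /andP[xp _].
    by rewrite Hx ?RposE // /nrm1 /= normr0 addr0 mul0r.
  by apply: filterS (H0 H1 H2) => x Hx xn; have := Hx xn; rewrite mul0r.
apply: L2_ext; apply: filterS2 (ae_foralln key) (@L2_fun0 R) => x Hx Hz x0.
rewrite Hz //; have := Hx (Num.truncn x); rewrite RposE in x0.
rewrite x0 (ltW (truncnS_gt _)) => /(_ isT).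
rewrite le_eqVlt ltNge nrm1_ge0 orbF /nrm1 paddr_eq0 // !normr_eq0 => H0.
by apply/eqP; rewrite eq_complex.
Qed.

End Volterra.

(** * Multiplication by bounded functions *)

Section Multiplication.
Variable R : realType.
Local Notation mu := (@lebesgue_measure R).
Local Notation mset := (set (measurableTypeR R)).
Local Notation Rp := (Rpos R).
Local Notation Re := complex.Re.
Local Notation Im := complex.Im.
Local Notation H := (L2 R).
Implicit Types (f g : R -> R) (u v : H) (a : R[i]) (w : R -> R[i]).

Lemma normc_ge0 a : 0 <= normc a.
Proof. by case: a => ? ?; exact: sqrtr_ge0. Qed.

Lemma normcM a b : normc (a * b) = normc a * normc b.
Proof. exact: ComplexField.Normc.normcM. Qed.

Lemma Re_le_normc a : `|Re a| <= normc a.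
Proof.
by rewrite -ler_sqr ?nnegrE ?normc_ge0 // normcsq real_normK ?num_real // lerDl sqr_ge0.
Qed.

Lemma Im_le_normc a : `|Im a| <= normc a.
Proof.
by rewrite -ler_sqr ?nnegrE ?normc_ge0 // normcsq real_normK ?num_real // lerDr sqr_ge0.
Qed.

Lemma n2E u : (\int[mu]_(x in Rp) (normc (u x) ^+ 2)%:E)%E = (n2 u)%:E.
Proof.
have mRp := @measurable_Rpos R.
have i1 := (sq_re u).2; have i2 := (sq_im u).2.
have -> : n2 u = \int[mu]_(x in Rp) (re u x ^+ 2 + im u x ^+ 2).
  by rewrite RintegralD //; congr (_ + _); apply: eq_Rint => x _; rewrite expr2.
rewrite [RHS]fineK; last exact: integrable_fin_num (rintD mRp i1 i2).
by apply: eq_integral => x _; rewrite normcsq.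
Qed.

Lemma mul_sqint w u : Linfty w -> square_integrable (fun x => w x * u x).
Proof.
move=> [[mr mi] [C wC]]; have mRp := @measurable_Rpos R.
have F := ae_filter_ringOfSetsType mu.
have mwu : cmeasurable (fun x => w x * u x).
  have mur := (sq_re u).1; have mui := (sq_im u).1.
  split.
    have -> : (fun x => Re (w x * u x)) = (fun x => Re (w x) * re u x - Im (w x) * im u x).
      by apply/funext => x; rewrite /re /im; case: (w x) (u x) => ? ? [].
    by apply: measurable_funB; apply: measurable_funM.
  have -> : (fun x => Im (w x * u x)) = (fun x => Re (w x) * im u x + Im (w x) * re u x).
    by apply/funext => x; rewrite /re /im; case: (w x) (u x) => ? ? [].
  by apply: measurable_funD; apply: measurable_funM.
split=> //.
apply: (@le_lt_trans _ _ (\int[mu]_(x in Rp) ((C ^+ 2)%:E * (normc (u x) ^+ 2)%:E))%E).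
  apply: ae_ge0_le_integral => //.
  - by move=> x _; rewrite lee_fin sqr_ge0.
  - exact: measurable_normcsqE.
  - by move=> x _; rewrite mule_ge0 // lee_fin sqr_ge0.
  - by apply: measurable_funeM; apply: measurable_normcsqE; exact: (L2_sqint u).1.
  apply: filterS wC => x Hx x0; rewrite -EFinM lee_fin normcM exprMn.
  rewrite ler_wpM2r ?sqr_ge0 // ler_sqr ?nnegrE ?normc_ge0 //; first exact: Hx.
  exact: le_trans (normc_ge0 _) (Hx x0).
rewrite ge0_integralZl_EFin //; last 3 first.
- by move=> x _; rewrite lee_fin sqr_ge0.
- by apply: measurable_normcsqE; exact: (L2_sqint u).1.
- exact: sqr_ge0.
by rewrite n2E -EFinM ltry.
Qed.

Lemma mulL2E w u : Linfty w -> ae_eq_Rpos (mulL2 w u) (fun x => w x * u x).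
Proof. by move=> Lw; apply: L2_ofK; exact: mul_sqint. Qed.

Lemma mulL2_n2 w u C : Linfty w -> {ae mu, forall x, Rp x -> normc (w x) <= C} ->
  n2 (mulL2 w u) <= C ^+ 2 * n2 u.
Proof.
move=> Lw wC; rewrite -lee_fin -n2E EFinM -n2E.
have F := ae_filter_ringOfSetsType mu.
rewrite -ge0_integralZl_EFin //; last 4 first.
- exact: measurable_Rpos.
- by move=> x _; rewrite lee_fin sqr_ge0.
- by apply: measurable_normcsqE; exact: (L2_sqint u).1.
- exact: sqr_ge0.
apply: ae_ge0_le_integral => //.
- exact: measurable_Rpos.
- by move=> x _; rewrite lee_fin sqr_ge0.
- by apply: measurable_normcsqE; exact: (L2_sqint _).1.
- by move=> x _; rewrite mule_ge0 // lee_fin sqr_ge0.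
- by apply: measurable_funeM; apply: measurable_normcsqE; exact: (L2_sqint u).1.
apply: filterS2 (mulL2E u Lw) wC => x Hm Hx x0; rewrite -EFinM lee_fin Hm // normcM exprMn.
rewrite ler_wpM2r ?sqr_ge0 // ler_sqr ?nnegrE ?normc_ge0 //; first exact: Hx.
exact: le_trans (normc_ge0 _) (Hx x0).
Qed.

Lemma mulL2_lin w a u v : Linfty w ->
  mulL2 w (a *: u + v) = a *: mulL2 w u + mulL2 w v.
Proof.
move=> Lw; have F := ae_filter_ringOfSetsType mu; apply: L2_ext.
apply: filterS3 (mulL2E (a *: u + v) Lw) (L2_lin a u v)
  (filterI (filterI (mulL2E u Lw) (mulL2E v Lw)) (L2_lin a (mulL2 w u) (mulL2 w v))).
move=> x H1 H2 [[H3 H4] H5] x0.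
by rewrite H1 // H2 // H5 // H3 // H4 //; ring.
Qed.

Lemma ip_ae u v u' v' :
  {ae mu, forall x, Rp x -> (u x)^*%C * v x = (u' x)^*%C * v' x} -> ip u v = ip u' v'.
Proof.
move=> E; have F := ae_filter_ringOfSetsType mu.
have m (p q : H) : measurable_fun Rp (fun x => Re ((p x)^*%C * q x)) /\
    measurable_fun Rp (fun x => Im ((p x)^*%C * q x)).
  have mpr := (sq_re p).1; have mpi := (sq_im p).1.
  have mqr := (sq_re q).1; have mqi := (sq_im q).1.
  split.
    have -> : (fun x => Re ((p x)^*%C * q x)) = (fun x => re p x * re q x + im p x * im q x).
      by apply/funext => x; rewrite /re /im; case: (p x) (q x) => ? ? [? ?] /=; ring.
    by apply: measurable_funD; apply: measurable_funM.
  have -> : (fun x => Im ((p x)^*%C * q x)) = (fun x => re p x * im q x - im p x * re q x).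
    by apply/funext => x; rewrite /re /im; case: (p x) (q x) => ? ? [? ?] /=; ring.
  by apply: measurable_funB; apply: measurable_funM.
congr (_ +i* _)%C; apply: ae_eq_Rint; try exact: measurable_Rpos; try exact: (m _ _).1; try exact: (m _ _).2.
  by apply: filterS E => x Hx x0; rewrite Hx.
by apply: filterS E => x Hx x0; rewrite Hx.
Qed.

Lemma conj_Linfty w : Linfty w -> Linfty (fun x => (w x)^*%C).
Proof.
move=> [[mr mi] [C wC]]; split; last first.
  exists C; have F := ae_filter_ringOfSetsType mu; apply: filterS wC => x Hx x0.
  have -> : normc (w x)^*%C = normc (w x) by case: (w x) => p q /=; rewrite sqrrN.
  exact: Hx.
split.
  by rewrite (_ : (fun x => _) = (fun x => Re (w x))) //; apply/funext => x; case: (w x).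
rewrite (_ : (fun x => _) = (fun x => - Im (w x))); first exact: measurable_funN.
by apply/funext => x; case: (w x).
Qed.

Lemma ip_mulL2 w u v : Linfty w -> ip (mulL2 w u) v = ip u (mulL2 (fun x => (w x)^*%C) v).
Proof.
move=> Lw; apply: ip_ae; have F := ae_filter_ringOfSetsType mu.
apply: filterS2 (mulL2E u Lw) (mulL2E v (conj_Linfty Lw)) => x H1 H2 x0.
by rewrite H1 // H2 // conjcM; ring.
Qed.

Lemma real_Linfty (r : R -> R) C : measurable_fun Rp r ->
  {ae mu, forall x, Rp x -> `|r x| <= C} -> Linfty (fun x => (r x)%:C%C).
Proof.
move=> mr rC; split; first by split => //=; exact: measurable_cst.
exists C; have F := ae_filter_ringOfSetsType mu; apply: filterS rC => x Hx x0.
by rewrite /= expr0n addr0 sqrtr_sqr Hx.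
Qed.

Lemma ip_mulL2_real (r : R -> R) u v : Linfty (fun x => (r x)%:C%C) ->
  ip (mulL2 (fun x => (r x)%:C%C) u) v = ip u (mulL2 (fun x => (r x)%:C%C) v).
Proof.
move=> Lr; apply: ip_ae; have F := ae_filter_ringOfSetsType mu.
apply: filterS2 (mulL2E u Lr) (mulL2E v Lr) => x H1 H2 x0.
by rewrite (H1 x0) (H2 x0) conjcM conjc_real; ring.
Qed.

(** Inversion is total with value 0 at 0, so the line is cut there; on each open half-line inversion
    is continuous. *)
Lemma measurable_invr : measurable_fun [set: R] (@GRing.inv R).
Proof.
have -> : [set: R] = `]-oo, 0[ `|` ([set 0] `|` `]0, +oo[).
  apply/seteqP; split=> // x _ /=; rewrite !in_itv /= andbT.
  by case: (ltgtP x 0) => [x0|x0|->]; [left|right; right|right; left].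
have m0 : measurable ([set (0 : R)] : mset) by exact: measurable_set1.
have mn : measurable (`]-oo, 0[ : mset) by exact: measurable_itv.
have mp : measurable (`]0, +oo[ : mset) by exact: measurable_itv.
apply/measurable_funU => //; first exact: measurableU.
split.
  apply: open_continuous_measurable_fun; first exact: interval_open.
  by move=> x; rewrite inE /= in_itv /= => x0; apply: inv_continuous; rewrite lt_eqF.
apply/measurable_funU => //; split; first exact: measurable_fun_set1.
apply: open_continuous_measurable_fun; first exact: interval_open.
by move=> x; rewrite inE /= in_itv /= andbT => x0; apply: inv_continuous; rewrite gt_eqF.
Qed.

End Multiplication.

(** * Selfadjoint operators bounded below by 1 in a closed subspace *)

Section PositiveSelfadjoint.
Variable R : realType.
Local Notation Re := complex.Re.
Local Notation Im := complex.Im.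
Local Notation H := (L2 R).
Implicit Types (u v w : H) (a : R[i]).

Lemma n2D u v : n2 (u + v) = n2 u + n2 v + 2 * Re (ip v u).
Proof. by have := n2_lin 1 u v; rewrite scale1r mul1r /= expr1n expr0n addr0 mul1r. Qed.

Lemma n2D_le u v : n2 (u + v) <= 2 * n2 u + 2 * n2 v.
Proof.
have := n2_ge0 (u - v); rewrite !n2D n2N ipNl; case: (ip v u) => zr zi /=; lra.
Qed.

Lemma ip_closed (N : set H) u v :
  (forall w, N w -> ip u w = 0) -> hclosure N v -> ip u v = 0.
Proof.
move=> uN /n2_close vN.
have : Re (ip u v) ^+ 2 + Im (ip u v) ^+ 2 <= 0.
  apply/ler_addgt0Pr => e e0; rewrite add0r.
  have e1 : 0 < e / (n2 u + 1) by rewrite divr_gt0 // ltr_wpDl // n2_ge0.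
  have [w Nw Hw] := vN _ e1.
  have := cauchy_schwarz u (v - w); rewrite ipBr (uN w Nw) subr0 => H1.
  apply: le_trans H1 _; apply: (@le_trans _ _ ((n2 u + 1) * n2 (v - w))).
    by rewrite ler_wpM2r ?n2_ge0 // lerDl.
  by rewrite mulrC -ler_pdivlMr ?ltW // ltr_wpDl // n2_ge0.
rewrite le_eqVlt ltNge addr_ge0 ?sqr_ge0 // orbF paddr_eq0 ?sqr_ge0 // !sqrf_eq0 => H0.
by apply/eqP; rewrite eq_complex.
Qed.

(** The abstract form of [A + c] acting in [N]. Selfadjointness is recorded as symmetry together
    with [T_adj], by which the adjoint graph lies in the graph of [T]; membership of 0 in [D],
    closedness of the range and surjectivity all come from [T_adj]. *)
Variables (N D : set H) (T : H -> H).
Hypothesis cN : closed_subspace N.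
Hypothesis D_lin : forall a u v, D u -> D v -> D (a *: u + v).
Hypothesis T_lin : forall a u v, D u -> D v -> T (a *: u + v) = a *: T u + T v.
Hypothesis D_sub : D `<=` N.
Hypothesis T_sub : forall u, D u -> N (T u).
Hypothesis T_sym : forall u v, D u -> D v -> ip u (T v) = ip (T u) v.
Hypothesis T_adj : forall v w, N v -> N w ->
  (forall u, D u -> ip v (T u) = ip w u) -> D v /\ T v = w.
Hypothesis T_pos : forall u, D u -> n2 u <= Re (ip u (T u)).

Lemma D0 : D 0 /\ T 0 = 0.
Proof.
have N0 : N 0 by case: cN.
by apply: T_adj => // u _; rewrite !ip0l.
Qed.

Lemma T_B u v : D u -> D v -> D (u - v) /\ T (u - v) = T u - T v.
Proof.
move=> Du Dv; have := D_lin (-1) Dv Du; have := T_lin (-1) Dv Du.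
by rewrite !scaleN1r ![- _ + _]addrC.
Qed.

Lemma T_bound u : D u -> n2 u <= n2 (T u).
Proof.
move=> Du; have := T_pos Du.
have := n2_ge0 (T u - u); rewrite n2D n2N ipNl; case: (ip u (T u)) => zr zi /=; lra.
Qed.

Let range := [set T u | u in D].

(** By [T_bound], preimages of a Cauchy sequence in the range form a Cauchy sequence. The pair of
    limits satisfies the adjoint identity, hence belongs to the graph of [T]. *)
Lemma range_closed : closed_subspace range.
Proof.
have [d0 t0] := D0.
split; first by exists 0.
  by move=> a _ _ [u Du <-] [v Dv <-]; exists (a *: u + v); [exact: D_lin|exact: T_lin].
move=> v /n2_close Hv.
(* As in [projection]: errors of this size give increments with [2 e_n + 2 e_(n+1) <= 8^-n]. *)
pose e n : R := 8^-1 ^+ n / 4.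
have e0 n : 0 < e n by rewrite /e divr_gt0 // exprn_gt0 // invr_gt0.
have /choice[u Hu] : forall n, exists u, D u /\ n2 (v - T u) < e n.
  by move=> n; have [_ [u Du <-] Huv] := Hv _ (e0 n); exists u.
have cau n : n2 (u n.+1 - u n) <= 8^-1 ^+ n.
  have [Du1 Hu1] := Hu n.+1; have [Du Hu0] := Hu n.
  have [DB TB] := T_B Du1 Du.
  apply: le_trans (T_bound DB) _; rewrite TB.
  have -> : T (u n.+1) - T (u n) = (v - T (u n)) - (v - T (u n.+1)).
    by rewrite opprB [RHS]addrC subrKA.
  have := n2D_le (v - T (u n)) (- (v - T (u n.+1))); rewrite n2N.
  have : 0 <= (8^-1 : R) ^+ n by rewrite exprn_ge0 // invr_ge0.
  move: Hu0 Hu1; rewrite /e exprS; move: (8^-1 ^+ n) => t; lra.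
have [q Hq] := L2_complete cau.
have lim_close (x : nat -> H) (y : H) (S : set H) : (forall n, S (x n)) -> n2 (y - x n) @[n --> \oo] --> 0 -> hclosure S y.
  move=> Sx xy; apply/n2_close => f f0.
  have /cvgrPdist_lt /(_ f f0) [n _ /(_ n (leqnn n))] := xy.
  by rewrite /= sub0r normrN ger0_norm ?n2_ge0 // => ?; exists (x n).
have Nq : N q.
  by case: (cN) => _ _; apply; apply: lim_close Hq => n; apply: D_sub; exact: (Hu n).1.
have Tu : n2 (v - T (u n)) @[n --> \oo] --> 0.
  apply: (squeeze_cvgr (f := fun=> 0) (h := fun n => 4^-1 * 8^-1 ^+ n)).
  - by apply: nearW => n; rewrite n2_ge0 /= ltW // mulrC; exact: (Hu n).2.
  - exact: cvg_cst.
  - rewrite -[X in _ --> X](mulr0 4^-1); apply: cvgM; first exact: cvg_cst.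
    by apply: cvg_expr; rewrite ger0_norm ?invr_ge0 // invf_lt1 // ltr1n.
have Nv : N v.
  by case: (cN) => _ _; apply; apply: lim_close Tu => n; apply: T_sub; exact: (Hu n).1.
have lim_ip (x : nat -> H) (y z : H) : n2 (y - x n) @[n --> \oo] --> 0 ->
    forall e, 0 < e -> exists n0 : nat, forall n, (n0 <= n)%N -> Re (ip (y - x n) z) ^+ 2 + Im (ip (y - x n) z) ^+ 2 <= e.
  move=> xy f f0; have f1 : 0 < f / (n2 z + 1) by rewrite divr_gt0 // ltr_wpDl // n2_ge0.
  have /cvgrPdist_lt /(_ _ f1) [n0 _ Hn] := xy; exists n0 => n nn.
  apply: le_trans (cauchy_schwarz _ _) _.
  apply: (@le_trans _ _ (n2 (y - x n) * (n2 z + 1))); first by rewrite ler_wpM2l ?n2_ge0 // lerDl.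
  rewrite -ler_pdivlMr ?ltr_wpDl ?n2_ge0 // ltW //.
  by have := Hn n nn; rewrite /= sub0r normrN ger0_norm ?n2_ge0.
(* The identity [<u_n, T w> = <T u_n, w>] passes to the limit on both sides. Each side is taken
   within [f / 4], since the square of a difference at most doubles the two squares. *)
have [Dq Tq] : D q /\ T q = v.
  apply: T_adj => // w Dw; apply/eqP; rewrite -subr_eq0.
  have : Re (ip q (T w) - ip v w) ^+ 2 + Im (ip q (T w) - ip v w) ^+ 2 <= 0.
    apply/ler_addgt0Pr => f f0; rewrite add0r.
    have f4 : 0 < f / 4 by rewrite divr_gt0.
    have [n1 H1] := lim_ip _ _ (T w) Hq _ f4.
    have [n2' H2] := lim_ip _ _ w Tu _ f4.
    have := H1 _ (leq_maxl n1 n2'); have := H2 _ (leq_maxr n1 n2').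
    set n := maxn n1 n2'.
    have -> : ip q (T w) - ip v w = ip (q - u n) (T w) - ip (v - T (u n)) w.
      by rewrite !ipBl (T_sym (Hu n).1 Dw); ring.
    case: (ip (q - u n) (T w)) (ip (v - T (u n)) w) => a b [a' b'] /=.
    have := sqr_ge0 (a + a'); have := sqr_ge0 (b + b'); nra.
  rewrite le_eqVlt ltNge addr_ge0 ?sqr_ge0 // orbF paddr_eq0 ?sqr_ge0 // !sqrf_eq0 => H0.
  by rewrite eq_complex.
by exists q.
Qed.

(** The residual [r] of projecting [v] to the closed range is orthogonal to the range, so the
    adjoint identity gives [T r = 0], and positivity gives [r = 0]. *)
Lemma T_surj v : N v -> exists2 u, D u & T u = v.
Proof.
move=> Nv; have [_ [u Du <-] Hu] := projection v range_closed.
exists u => //; apply/esym/eqP; rewrite -subr_eq0; apply/eqP.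
set r := v - T u.
have Nr : N r by apply: closed_subspaceB => //; exact: T_sub.
have N0 : N 0 by case: cN.
have [Dr Tr] : D r /\ T r = 0.
  apply: T_adj => // w Dw; rewrite ip0l ipC.
  by rewrite (Hu (T w)) ?conjc0 //; exists w.
apply: n2_eq0; apply/eqP; rewrite eq_le n2_ge0 andbT.
by have := T_pos Dr; rewrite Tr ip0r.
Qed.

(* [p_n = T^-n p_0] satisfies [|p_n|^2 = <p_0, p_2n>] and is log-convex, so it
   cannot decay faster than every geometric sequence unless [p_0 = 0]. *)
Lemma fast_decay_orthogonal f :
  (forall p : nat -> H, (forall n, D (p n.+1) /\ T (p n.+1) = p n) ->
    forall q, 0 < q -> exists B, forall n,
      Re (ip f (p n)) ^+ 2 + Im (ip f (p n)) ^+ 2 <= B * q ^+ n) ->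
  forall v, N v -> ip v f = 0.
Proof.
move=> decay.
have [g Ng fg] := projection f cN.
suff g0 : g = 0 by move=> v Nv; have := fg v Nv; rewrite g0 subr0.
have /choice[G HG] : forall v, exists u, N v -> D u /\ T u = v.
  move=> v; have [Nv|nN] := pselect (N v); last by exists 0.
  by have [u Du Tu] := T_surj Nv; exists u.
pose p n := iter n G g.
have Np n : N (p n).
  elim: n => [//|n IH]; apply: D_sub; exact: (HG _ IH).1.
have Dp n : D (p n.+1) /\ T (p n.+1) = p n by exact: HG (Np n).
have shift m n : ip (p m.+1) (p n) = ip (p m) (p n.+1).
  by rewrite -{1}(Dp n).2 T_sym ?(Dp m).2 //; [exact: (Dp m).1|exact: (Dp n).1].
have shift0 n m : ip (p n) (p m) = ip (p 0%N) (p (n + m)%N).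
  by elim: n m => [//|n IH] m; rewrite shift IH addnS.
have np n : Re (ip (p 0%N) (p (n + n)%N)) = n2 (p n) by rewrite -shift0 ip_n2.
have convex n : n2 (p n.+1) ^+ 2 <= n2 (p n) * n2 (p n.+2).
  have := cauchy_schwarz (p n) (p n.+2); rewrite -shift ip_n2 /=.
  by rewrite expr0n addr0.
have [//|gn0] := eqVneq g 0; exfalso.
have pn0 n : 0 < n2 (p n).
  elim: n => [|n IH].
    rewrite lt_def n2_ge0 andbT; apply/negP => /eqP /n2_eq0 p0.
    by move: gn0; rewrite -[g]/(p 0%N) p0 eqxx.
  rewrite lt_def n2_ge0 andbT; apply/negP => /eqP /n2_eq0 p0.
  by move: IH; rewrite -(Dp n).2 p0 D0.2 n20 ltxx.
pose r := n2 (p 1%N) / n2 (p 0%N).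
have r0 : 0 < r by rewrite divr_gt0.
have ratio n : r * n2 (p n) <= n2 (p n.+1).
  elim: n => [|n IH]; first by rewrite /r divfK // gt_eqF.
  rewrite -(ler_pM2l (pn0 n)); apply: le_trans (convex n).
  by rewrite mulrCA mulrA expr2 ler_wpM2r // n2_ge0.
have lower n : r ^+ n * n2 (p 0%N) <= n2 (p n).
  elim: n => [|n IH]; first by rewrite expr0 mul1r.
  apply: le_trans (ratio n); rewrite exprS -mulrA ler_wpM2l // ltW //.
(* The norms satisfy [n2 (p n) >= r^n n2 (p 0)]. At index [2n] the rate [r / 2] then loses a factor
   [4^n] against the square of this lower bound. *)
have [B HB] := decay p Dp (r / 2) (divr_gt0 r0 (ltr0n _ 2)).
have key n : n2 (p 0%N) ^+ 2 * 4 ^+ n <= B.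
  have E : ip f (p (n + n)%N) = ip (p 0%N) (p (n + n)%N).
    apply/eqP; rewrite -subr_eq0 -ipBl ipC fg ?conjc0 //.
  have := HB (n + n)%N; rewrite E np => H1.
  have H2 : (r ^+ n * n2 (p 0%N)) ^+ 2 <= n2 (p n) ^+ 2.
    by rewrite ler_sqr ?nnegrE ?n2_ge0 ?lower // mulr_ge0 ?n2_ge0 // exprn_ge0 // ltW.
  have : (r ^+ n * n2 (p 0%N)) ^+ 2 <= B * (r / 2) ^+ (n + n).
    by apply: le_trans H2 (le_trans _ H1); rewrite lerDl sqr_ge0.
  have -> : (r / 2) ^+ (n + n) = (r ^+ n) ^+ 2 / 4 ^+ n.
    rewrite exprD expr_div_n; have -> : 4 = 2 * 2 :> R by ring.
    by rewrite [X in _ = _ / X]exprMn invfM expr2 mulrACA.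
  rewrite mulrA ler_pdivlMr ?exprn_gt0 // exprMn -mulrA [B * _]mulrC.
  by rewrite ler_pM2l // exprn_gt0 // exprn_gt0.
have c0 : 0 < n2 (p 0%N) ^+ 2 by rewrite exprn_gt0.
have := key (Num.truncn (B / n2 (p 0%N) ^+ 2)).+1; rewrite leNgt => /negP; apply.
set m := (Num.truncn _).+1.
rewrite mulrC -ltr_pdivrMr //; apply: (lt_le_trans (truncnS_gt _)).
by rewrite -natrX ler_nat -/m ltnW // ltn_expl.
Qed.

End PositiveSelfadjoint.

(** * The operator on functions with zero Cauchy data *)

Section SchroedingerOperator.
Variable R : realType.
Local Notation mu := (@lebesgue_measure R).
Local Notation mset := (set (measurableTypeR R)).
Local Notation Rp := (Rpos R).
Local Notation Re := complex.Re.
Local Notation Im := complex.Im.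
Local Notation H := (L2 R).
Implicit Types (u v w y z : H) (a : R[i]).

Definition cutoff (X : R) (x : R) : R[i] := ((\1_(`]0, X]) x : R)%:C)%C.

Lemma cutoff_Linfty X : Linfty (cutoff X).
Proof.
apply: (@real_Linfty _ _ 1); first by apply: measurable_indic; exact: measurable_itv.
by apply: aeW => x _; rewrite indicE; case: (_ \in _); rewrite ?normr1 ?normr0.
Qed.

Lemma cutoff_n2 z X K : 0 <= X -> 0 <= K ->
  {ae mu, forall x, 0 < x <= X -> nrm1 (z x) <= K} ->
  n2 (mulL2 (cutoff X) z) <= K ^+ 2 * X.
Proof.
move=> X0 K0 zK; rewrite -lee_fin -n2E.
have F := ae_filter_ringOfSetsType mu.
have mRp := @measurable_Rpos R.
have mI : measurable (`]0, X] : mset) by exact: measurable_itv.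
have mi : measurable_fun (Rp : mset) (\1_(`]0, X]) : R -> R) by exact: measurable_indic.
apply: (@le_trans _ _ (\int[mu]_(x in Rp) ((K ^+ 2)%:E * (\1_(`]0, X]) x)%:E))%E).
  apply: ae_ge0_le_integral => //.
  - by move=> x _; rewrite lee_fin sqr_ge0.
  - by apply: measurable_normcsqE; exact: (L2_sqint _).1.
  - by move=> x _; rewrite mule_ge0 // lee_fin ?sqr_ge0.
  - by apply: measurable_funeM; apply/measurable_EFinP.
  apply: filterS2 (mulL2E z (cutoff_Linfty X)) zK => x Hm Hx x0.
  have x0' : 0 < x by move: x0; rewrite RposE.
  rewrite -EFinM lee_fin Hm // /cutoff indicE.
  case: (boolP (x \in _)) => [|_]; last first.
    by rewrite mulr0 (_ : (0%:R)%:C%C = 0) // mul0r ComplexField.Normc.normc0 expr0n.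
  rewrite inE /= in_itv /= => /Hx H1; rewrite mulr1 (_ : (1%:R)%:C%C = 1) // mul1r normcsq.
  apply: (@le_trans _ _ (nrm1 (z x) ^+ 2)); last by rewrite ler_sqr ?nnegrE ?nrm1_ge0.
  rewrite /nrm1 -(real_normK (num_real (Re _))) -(real_normK (num_real (Im _))).
  by have := normr_ge0 (Re (z x)); have := normr_ge0 (Im (z x)); nra.
rewrite ge0_integralZl_EFin //; last 2 first.
- by apply/measurable_EFinP.
- exact: sqr_ge0.
rewrite integral_indic // (EFinM (K ^+ 2) X) lee_wpmul2l ?lee_fin ?sqr_ge0 //.
apply: (@le_trans _ _ (mu `]0, X])).
  by apply: le_measure; rewrite ?inE //; exact: measurableI || exact: subIsetl.
have := lebesgue_measure_itv `]0, X] => /= ->; case: ifPn => _; rewrite ?sube0 //.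
Qed.

Lemma vanish_rep (f f1 : R -> R) c (E : set R) : locint f1 ->
  {ae mu, forall x, Rp x -> f x = c + prim f1 x} ->
  {ae mu, forall x, Rp x -> E x -> f x = 0} ->
  {ae mu, forall x, Rp x -> E x -> f1 x = 0}.
Proof.
move=> l1 fE f0; have F := ae_filter_ringOfSetsType mu.
apply: (@ae_derive_vanish _ (fun x => c + prim f1 x)).
  apply: filterS (derive_prim_ae l1) => x Hx x0; have d := Hx x0.
  rewrite (_ : (fun x => _) = cst c + prim f1) //.
  by apply: is_derive_eq; rewrite add0r.
by apply: filterS2 fE f0 => x H1 H2 x0 Ex; rewrite -H1 // H2.
Qed.

Lemma H2_vanish u u1 u2 (E : set R) : is_weak_derivative u u1 -> is_weak_derivative u1 u2 ->
  {ae mu, forall x, Rp x -> E x -> u x = 0} -> {ae mu, forall x, Rp x -> E x -> u2 x = 0}.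
Proof.
move=> W0 W1 u0; have F := ae_filter_ringOfSetsType mu.
have [ur ui] := weak_derivative_rep W0; have [u1r u1i] := weak_derivative_rep W1.
have lr (p : H) := sq_locint (sq_re p); have li (p : H) := sq_locint (sq_im p).
have r0 : {ae mu, forall x, Rp x -> E x -> re u x = 0}.
  by apply: filterS u0 => x Hx x0 Ex; rewrite /re Hx.
have i0 : {ae mu, forall x, Rp x -> E x -> im u x = 0}.
  by apply: filterS u0 => x Hx x0 Ex; rewrite /im Hx.
have r2 := vanish_rep (lr u2) u1r (vanish_rep (lr u1) ur r0).
have i2 := vanish_rep (li u2) u1i (vanish_rep (li u1) ui i0).
apply: filterS2 r2 i2 => x Hr Hi x0 Ex; apply/eqP; rewrite eq_complex.
by apply/andP; split; apply/eqP; [exact: Hr|exact: Hi].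
Qed.

Variables (V : R -> R[i]) (h : R[i]) (k : H).
Hypothesis VL : Linfty V.
Local Notation A := (A_hk V h k).

Lemma dom_wd u : dom A u -> [/\ is_weak_derivative u (weak_derivative u),
  is_weak_derivative (weak_derivative u) (weak_derivative (weak_derivative u)) &
  trace0 (weak_derivative u) = h * trace0 u].
Proof. by move=> [/H2P[W0 W1] ?]. Qed.

Lemma dom_lin a u v : dom A u -> dom A v -> dom A (a *: u + v) /\
  act A (a *: u + v) = a *: act A u + act A v.
Proof.
move=> /dom_wd[U0 U1 tu] /dom_wd[V0 V1 tv].
have W0 := is_weak_derivative_lin a U0 V0; have W1 := is_weak_derivative_lin a U1 V1.
have T0 := trace0_lin a U0 V0; have T1 := trace0_lin a U1 V1.
split.
  split; first by exists (a *: weak_derivative u + weak_derivative v),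
    (a *: weak_derivative (weak_derivative u) + weak_derivative (weak_derivative v)).
  by rewrite (weak_derivativeE W0) T0 T1 tu tv; ring.
rewrite /= (weak_derivativeE W0) (weak_derivativeE W1) T0 mulL2_lin //.
rewrite scalerDl -scalerA.
move: (weak_derivative _) (weak_derivative _) (mulL2 V u) (mulL2 V v) (_ *: k) (_ *: k).
by move=> x1 x2 y1 y2 z1 z2; rewrite !scalerDr scalerN opprD [X in X + _ = _]addrACA [LHS]addrACA.
Qed.

Lemma trace0_dom_lin a u v : dom A u -> dom A v ->
  trace0 (a *: u + v) = a * trace0 u + trace0 v.
Proof. by move=> /dom_wd[U0 _ _] /dom_wd[V0 _ _]; exact: trace0_lin U0 V0. Qed.

Lemma V_bound : exists2 C : R, 0 <= C & {ae mu, forall x, Rp x -> normc (V x) <= C}.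
Proof.
have [_ [C VC]] := VL; exists (Num.max 0 C); first by rewrite le_max lexx.
have F := ae_filter_ringOfSetsType mu.
by apply: filterS VC => x Hx x0; rewrite le_max Hx ?orbT.
Qed.

Lemma act_trace0 u : trace0 u = 0 ->
  act A u = - weak_derivative (weak_derivative u) + mulL2 V u.
Proof. by move=> t0; rewrite /= t0 scale0r addr0. Qed.

(* If [(A + c) p_(n+1) = p_n] with zero Cauchy data at 0, the Volterra estimate
   makes [p_n] decay on ]0, X] faster than every geometric sequence. *)
Lemma volterra_trivial (N D : set H) : closed_subspace N ->
  (forall a u v, D u -> D v -> D (a *: u + v)) ->
  (forall u, D u -> [/\ N u, dom A u, trace0 u = 0 & N (act A u)]) ->
  (forall u v, D u -> D v -> ip u (act A v) = ip (act A u) v) ->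
  (forall v w, N v -> N w -> (forall u, D u -> ip v (act A u) = ip w u) ->
    D v /\ act A v = w) ->
  forall v, N v -> v = 0.
Proof.
move=> cN Dlin DP Asym Aadj; have F := ae_filter_ringOfSetsType mu.
have [C C0 VC] := V_bound.
(* The shift gives [Re <u, (A + c) u> >= |u|^2]: Green's formula without boundary term contributes
   [|u'|^2], the potential at worst [- C |u|^2]. *)
pose c := C + 1; have c0 : 0 <= c by rewrite addr_ge0.
pose T u := act A u + c%:C%C *: u.
have Tlin a u v : D u -> D v -> T (a *: u + v) = a *: T u + T v.
  move=> Du Dv; have [_ Au _ _] := DP u Du; have [_ Av _ _] := DP v Dv.
  rewrite /T (dom_lin a Au Av).2; move: (act A u) (act A v) => x y.
  by rewrite !scalerDr !scalerA (mulrC a) addrACA.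
have DN : D `<=` N by move=> u /DP[].
have TN u : D u -> N (T u).
  by move=> /DP[Nu _ _ NAu]; apply: closed_subspaceD => //; exact: closed_subspaceZ.
have Tsym u v : D u -> D v -> ip u (T v) = ip (T u) v.
  by move=> Du Dv; rewrite ipDr ipDl ipZr ipZl Asym // conjc_real.
have Tadj v w : N v -> N w -> (forall u, D u -> ip v (T u) = ip w u) -> D v /\ T v = w.
  move=> Nv Nw vw; have [] := Aadj v (w - c%:C%C *: v) Nv.
  - by apply: closed_subspaceB => //; exact: closed_subspaceZ.
  - move=> u Du; rewrite ipBl -vw // /T; move: (act A u) => x.
    by rewrite ipDr ipZr ipZl conjc_real addrK.
  by move=> Dv Av; split=> //; rewrite /T Av subrK.
have Tpos u : D u -> n2 u <= Re (ip u (T u)).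
  move=> /DP[_ Du t0 _]; have [W0 W1 t1] := dom_wd Du.
  have G := green W0 W1 W1; rewrite t0 conjc0 mul0r oppr0 in G.
  have E : ip u (T u) = ip (weak_derivative u) (weak_derivative u) + ip u (mulL2 V u) + c%:C%C * ip u u.
    rewrite /T act_trace0 // !ipDr ipNr ipZr; congr (_ + _ + _).
    by move/eqP: G; rewrite addr_eq0 => /eqP.
  have cs := cauchy_schwarz u (mulL2 V u).
  have nV := mulL2_n2 u VL VC.
  rewrite E !ip_n2; move: cs nV (n2_ge0 u) (n2_ge0 (weak_derivative u)).
  case: (ip u (mulL2 V u)) => zr zi /=; rewrite mul0r subr0.
  move: (n2 u) (n2 (weak_derivative u)) (n2 (mulL2 V u)) => n m nV cs nVle n0 m0.
  have H1 : zr ^+ 2 <= (C * n) ^+ 2.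
    have := ler_wpM2l n0 nVle; have := sqr_ge0 zi; rewrite !expr2; nra.
  have H2 : `|zr| <= C * n.
    by rewrite -ler_sqr ?nnegrE ?mulr_ge0 // real_normK ?num_real.
  by move: H2; rewrite ler_norml /c => /andP[H2 _]; lra.
have decay X v p : 0 < X -> (forall n, D (p n.+1) /\ T (p n.+1) = p n) ->
    forall q : R, 0 < q -> exists B, forall n,
      Re (ip (mulL2 (cutoff X) v) (p n)) ^+ 2 + Im (ip (mulL2 (cutoff X) v) (p n)) ^+ 2 <= B * q ^+ n.
  move=> X0 Hp q q0.
  (* From [y'' = V y + c y - p], where [nrm1] of [V] is at most [2 C]. In [s] the term [4 C'] serves
     the Volterra estimate, the 1 gives [s <= s^2], and [16 / q] makes the squared gain
     [(4 / s^2)^2] at most [q]; the square appears because squared inner products are estimated. *)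
  pose C' := 2 * C + c; have C'0 : 0 <= C' by rewrite addr_ge0 // mulr_ge0.
  pose s := 4 * C' + 1 + 16 / q.
  have q16 : 0 < 16 / q by rewrite divr_gt0.
  have s1 : 1 <= s by rewrite /s; lra.
  have s0 : 0 < s by exact: lt_le_trans s1.
  have ss : s <= s ^+ 2 by rewrite expr2 ler_peMr // ltW.
  have C's : 4 * C' <= s ^+ 2 by apply: le_trans ss; rewrite /s; lra.
  have qs : (4 / s ^+ 2) ^+ 2 <= q.
    have s2 : 0 < s ^+ 2 by rewrite exprn_gt0.
    rewrite expr_div_n ler_pdivrMr ?exprn_gt0 //.
    have H1 : 16 / q <= s ^+ 2 by apply: le_trans ss; rewrite /s; lra.
    have H2 : s ^+ 2 <= (s ^+ 2) ^+ 2 by rewrite [X in _ <= X]expr2 ler_peMr ?(ltW s2) // (le_trans s1).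
    by have := le_trans H1 H2; rewrite ler_pdivrMr // [_ * q]mulrC => H3; apply: le_trans H3; lra.
  (* The iteration of pointwise bounds starts at [p 1]: [p 0] need not be in the domain, so it has
     no continuous representative to bound. *)
  have [Q Q0 HQ] : exists2 Q : R, 0 <= Q & {ae mu, forall x, 0 < x <= X -> nrm1 (p 1%N x) <= Q * expR (s * x)}.
    have [_ D1 _ _] := DP _ (Hp 0%N).1; have [W0 W1 _] := dom_wd D1.
    have [yr yi] := weak_derivative_rep W0.
    set cr := Re _ in yr; set ci := Im _ in yi.
    set y1 := weak_derivative (p 1%N) in yr yi.
    have cm : continuous (fun x => `|cr + prim (re y1) x| + `|ci + prim (im y1) x|).
      move=> x; apply: cvgD; apply: cvg_norm; apply: cvgD; try exact: cvg_cst.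
        by apply: continuous_prim; apply: sq_locint; exact: sq_re.
      by apply: continuous_prim; apply: sq_locint; exact: sq_im.
    have [x0 _ Hx0] := EVT_max (ltW X0) (continuous_subspaceT cm).
    set Q := `|cr + _| + _ in Hx0.
    have Q0 : 0 <= Q by rewrite addr_ge0.
    exists Q => //; apply: filterS2 yr yi => x Hr Hi /andP[xp xX].
    have e1 : 1 <= expR (s * x) by rewrite -expR0 ler_expR mulr_ge0 // ltW.
    have := Hx0 x; rewrite in_itv /= (ltW xp) xX => /(_ isT).
    rewrite -Hr ?RposE // -Hi ?RposE // => H1; apply: le_trans H1 _.
    by rewrite ler_peMr.
  have step n : {ae mu, forall x, 0 < x <= X -> nrm1 (p n.+1 x) <= (4 / s ^+ 2) ^+ n * Q * expR (s * x)}.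
    elim: n => [|n IH]; first by rewrite expr0 mul1r.
    have [Dp Tp] := Hp n.+1; have [_ D1 t0 _] := DP _ Dp.
    have [W0 W1 t1] := dom_wd D1; rewrite t0 mulr0 in t1.
    set y := p n.+2 in Dp Tp D1 t0 W0 W1 t1 *.
    set y2 := weak_derivative (weak_derivative y) in W1.
    have y2E : y2 = mulL2 V y + c%:C%C *: y - p n.+1.
      rewrite -Tp /T act_trace0 // -/y2 -[- y2 + _ + _]addrA.
      by rewrite opprD opprK addrCA subrr addr0.
    have Q'0 : 0 <= (4 / s ^+ 2) ^+ n * Q by rewrite mulr_ge0 // exprn_ge0 // divr_ge0 // sqr_ge0.
    have := volterra_estimate (p := p n.+1) W0 W1 t0 t1 C'0 s0 C's Q'0 X0 _ IH.
    rewrite -/y2 (exprS (4 / s ^+ 2) n) => H1.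
    have {H1} H1 : {ae mu, forall x, Rp x -> nrm1 (y2 x) <= C' * nrm1 (y x) + nrm1 (p n.+1 x)} ->
      {ae mu, forall x, 0 < x <= X -> nrm1 (y x) <= 4 / s ^+ 2 * (4 / s ^+ 2) ^+ n * Q * expR (s * x)}.
      move=> H2; apply: filterS (H1 H2) => x Hx xX; apply: le_trans (Hx xX) _.
      by rewrite le_eqVlt; apply/orP; left; apply/eqP; ring.
    apply: H1.
    have E := L2_lin (-1) (p n.+1) (mulL2 V y + c%:C%C *: y).
    rewrite scaleN1r addrC -y2E in E.
    apply: filterS3 E (filterI (L2_funD (mulL2 V y) (c%:C%C *: y)) (L2_funZ c%:C%C y)) (filterI (mulL2E y VL) VC).
    move=> x E1 [E2 E3] [E4 E5] x0; rewrite E1 // E2 // E3 // E4 // mulN1r addrC.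
    apply: le_trans (nrm1D _ _) _; apply: lerD; last by rewrite /nrm1; case: (p n.+1 x) => ? ? /=; rewrite !normrN.
    apply: le_trans (nrm1D _ _) _; rewrite /C' mulrDl; apply: lerD.
      apply: le_trans (nrm1M _ _) _; rewrite ler_wpM2r ?nrm1_ge0 // /nrm1.
      have := Re_le_normc (V x); have := Im_le_normc (V x); have := E5 x0; lra.
    apply: le_trans (nrm1M _ _) _; rewrite ler_wpM2r ?nrm1_ge0 // /nrm1 /= normr0 addr0.
    by rewrite ger0_norm.
  pose e := expR (s * X).
  pose K n := (4 / s ^+ 2) ^+ n * Q * e.
  have K0 n : 0 <= K n by rewrite mulr_ge0 ?expR_ge0 // mulr_ge0 // exprn_ge0 // divr_ge0 // sqr_ge0.
  have ptK n : n2 (mulL2 (cutoff X) (p n.+1)) <= K n ^+ 2 * X.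
    apply: cutoff_n2 => //; first exact: ltW.
    apply: filterS (step n) => x Hx xX; apply: le_trans (Hx xX) _.
    rewrite ler_wpM2l ?ler_expR //; first by rewrite mulr_ge0 // exprn_ge0 // divr_ge0 // sqr_ge0.
    by rewrite ler_wpM2l ?(ltW s0) //; case/andP: xX.
  pose b0 := Re (ip (mulL2 (cutoff X) v) (p 0%N)) ^+ 2 + Im (ip (mulL2 (cutoff X) v) (p 0%N)) ^+ 2.
  have b00 : 0 <= b0 by rewrite addr_ge0 ?sqr_ge0.
  (* [b0] covers the index 0, which escapes the pointwise bounds; the division by [q] in [b1] makes
     up for the bound of [p n.+1] carrying only the power [n]. *)
  pose b1 := n2 v * ((Q * e) ^+ 2 * X) / q.
  have b10 : 0 <= b1 by rewrite divr_ge0 ?(ltW q0) // mulr_ge0 ?n2_ge0 // mulr_ge0 ?sqr_ge0 // ltW.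
  exists (b0 + b1) => -[|n]; first by rewrite expr0 mulr1 lerDl.
  have -> : ip (mulL2 (cutoff X) v) (p n.+1) = ip v (mulL2 (cutoff X) (p n.+1)).
    exact: ip_mulL2_real (cutoff_Linfty X).
  apply: le_trans (cauchy_schwarz _ _) _.
  apply: (@le_trans _ _ (b1 * q ^+ n.+1)); last first.
    by rewrite ler_wpM2r ?lerDr // exprn_ge0 // ltW.
  have -> : b1 * q ^+ n.+1 = n2 v * ((Q * e) ^+ 2 * X * q ^+ n).
    by rewrite /b1 (exprS q n); field; exact: lt0r_neq0.
  rewrite ler_wpM2l ?n2_ge0 //.
  apply: le_trans (ptK n) _; rewrite [leRHS]mulrAC ler_wpM2r ?(ltW X0) //.
  rewrite /K -mulrA exprMn mulrC ler_wpM2l ?sqr_ge0 //.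
  rewrite exprAC; apply: lerXn2r => //; rewrite nnegrE ?sqr_ge0 //; exact: ltW.
move=> v Nv.
(* The cutoff of [v] is orthogonal to [N] by the decay argument, and [v] is in [N]; but [<v, 1_X v>]
   is the squared norm of [1_X v]. *)
have key X : 0 < X -> mulL2 (cutoff X) v = 0.
  move=> X0; apply: n2_eq0.
  have := fast_decay_orthogonal cN Dlin Tlin DN TN Tsym Tadj Tpos (decay X v ^~ X0) Nv.
  move=> H0; have : ip (mulL2 (cutoff X) v) (mulL2 (cutoff X) v) = ip v (mulL2 (cutoff X) v).
    apply: ip_ae; apply: filterS (mulL2E v (cutoff_Linfty X)) => x Hx x0.
    rewrite Hx // /cutoff indicE; case: (x \in _).
      by rewrite (_ : (1%:R)%:C%C = 1) // mul1r.
    by rewrite (_ : (0%:R)%:C%C = 0) // mul0r !mulr0.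
  by rewrite H0 ip_n2 => /eqP; rewrite eq_complex /= => /andP[/eqP].
apply: L2_ext.
have key' (n : nat) : {ae mu, forall x, 0 < x <= n.+1%:R -> v x = 0}.
  have n0 : (0 : R) < n.+1%:R by [].
  have := mulL2E v (cutoff_Linfty n.+1%:R); rewrite key // => E.
  apply: filterS2 E (@L2_fun0 R) => x E1 E2 xn; have /andP[xp _] := xn.
  have := E1; rewrite RposE => /(_ xp); rewrite E2 ?RposE // /cutoff indicE mem_set /= ?in_itv //.
  by rewrite mul1r => ->.
apply: filterS2 (ae_foralln key') (@L2_fun0 R) => x Hx H0 x0; rewrite H0 //.
by apply: (Hx (Num.truncn x)); rewrite RposE in x0; rewrite x0 ltW // truncnS_gt.
Qed.

End SchroedingerOperator.

(** * The defect, reducing selfadjoint subspaces and the Langer decomposition *)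

Section Dissipation.
Variable R : realType.
Local Notation mu := (@lebesgue_measure R).
Local Notation mset := (set (measurableTypeR R)).
Local Notation Rp := (Rpos R).
Local Notation Im := complex.Im.
Local Notation H := (L2 R).
Local Notation j := ('i%C / 2 : R[i]).
Implicit Types (u v w K : H) (a : R[i]) (M : set H).

Lemma jE : j = (0 +i* 2^-1)%C.
Proof.
have E : (2 : R[i])^-1 = (2^-1 : R)%:C%C.
  have n2 : (2 : R[i]) != 0 by rewrite pnatr_eq0.
  apply: (mulfI n2); rewrite mulfV // -[X in X * _](rmorph_nat (real_complex R) 2).
  by rewrite -rmorphM /= mulfV ?rmorph1 // pnatr_eq0.
by rewrite E; apply/eqP; rewrite eq_complex /=; apply/andP; split; apply/eqP; ring.
Qed.

Lemma conj_j : j^*%C = - j.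
Proof. by rewrite jE; apply/eqP; rewrite eq_complex /= oppr0 !eqxx. Qed.

Lemma j_sqr : 4 * j * j = -1.
Proof.
have -> : (4 : R[i]) = (4 : R)%:C%C by rewrite -(rmorph_nat (real_complex R) 4).
by rewrite jE; apply/eqP; rewrite eq_complex /=; apply/andP; split; apply/eqP; field.
Qed.

Lemma j_neq0 : j != 0.
Proof. by apply/negP => /eqP j0; have := j_sqr; rewrite j0 mulr0 => /eqP; rewrite eq_sym oppr_eq0 oner_eq0. Qed.

(** Here [4 * j] is [2i]; writing it through [j] keeps the later identities polynomial in the factor
    of condition (i), with [j_sqr] as the only relation. *)
Lemma subr_conj a : a - a^*%C = 4 * j * (Im a)%:C%C.
Proof.
have -> : (4 : R[i]) = (4 : R)%:C%C by rewrite -(rmorph_nat (real_complex R) 4).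
by rewrite jE; case: a => p q; apply/eqP; rewrite eq_complex /=; apply/andP; split; apply/eqP; field.
Qed.

Lemma n2_neq0 u : u != 0 -> 0 < n2 u.
Proof. by move=> u0; rewrite lt_def n2_ge0 andbT; apply: contra_neq u0; exact: n2_eq0. Qed.

Lemma ip_neq0 u : u != 0 -> ip u u != 0.
Proof.
move=> /n2_neq0 u0; rewrite ip_n2; apply/negP => /eqP /(congr1 (@complex.Re _)) /= E.
by rewrite E ltxx in u0.
Qed.

Lemma ip_eq0 u : ip u u = 0 -> u = 0.
Proof. by move=> u0; apply/eqP; apply: contraT => /ip_neq0; rewrite u0 eqxx. Qed.

Lemma ip_sym0 u v : ip u v = 0 -> ip v u = 0.
Proof. by move=> E; rewrite ipC E conjc0. Qed.

Variables (V : R -> R[i]) (h : R[i]) (k : H).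
Hypothesis VL : Linfty V.
Hypothesis VI_ge0 : {ae mu, forall x, Rp x -> 0 <= Im (V x)}.
Local Notation VI := (fun x => (Im (V x))%:C%C).
Local Notation sVI := (fun x => (Num.sqrt (Im (V x)))%:C%C).
Local Notation A := (A_hk V h k).

Lemma VI_Linfty : Linfty VI.
Proof.
have [C _ VC] := V_bound VL; have F := ae_filter_ringOfSetsType mu.
apply: (@real_Linfty _ _ C); first exact: VL.1.2.
by apply: filterS VC => x Hx x0; apply: le_trans (Im_le_normc _) (Hx x0).
Qed.

Lemma sVI_Linfty : Linfty sVI.
Proof.
have [C C0 VC] := V_bound VL; have F := ae_filter_ringOfSetsType mu.
apply: (@real_Linfty _ _ (Num.sqrt C)).
  apply: measurableT_comp; last exact: VL.1.2.
  by apply: continuous_measurable_fun; exact: sqrt_continuous.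
apply: filterS VC => x Hx x0; rewrite ger0_norm ?sqrtr_ge0 // ler_wsqrtr //.
exact: le_trans (ler_norm _) (le_trans (Im_le_normc _) (Hx x0)).
Qed.

Lemma sVI_sqr u : mulL2 sVI (mulL2 sVI u) = mulL2 VI u.
Proof.
apply: L2_ext; have F := ae_filter_ringOfSetsType mu.
apply: filterS3 (mulL2E (mulL2 sVI u) sVI_Linfty) (mulL2E u VI_Linfty) (filterI (mulL2E u sVI_Linfty) VI_ge0).
move=> x H1 H2 [H3 H4] x0; rewrite (H1 x0) (H3 x0) (H2 x0) mulrA; congr (_ * _).
by rewrite -rmorphM /= -expr2 sqr_sqrtr // H4.
Qed.

(** A preimage of [k] under multiplication by [sqrt V_I] is arbitrary where [V_I = 0]. Multiplying
    it by the indicator [e] of [V_I <> 0] normalises it to [k / sqrt V_I], extended by 0, and the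
    integral hypothesis becomes the value of its squared norm. *)
Lemma sqrt_density :
  (exists g, k = mulL2 sVI g) ->
  ((4^-1)%:E * \int[mu]_(x in Rp `&` [set x | Im (V x) != 0%R])
        ((normc (k x)) ^+ 2 / Im (V x))%:E = (Im h)%:E)%E ->
  exists g0, [/\ mulL2 sVI g0 = k, n2 g0 = 4 * Im h &
    {ae mu, forall x, Rp x -> Im (V x) = 0 -> g0 x = 0}].
Proof.
move=> [g kE] hk; have F := ae_filter_ringOfSetsType mu.
have mRp := @measurable_Rpos R.
pose e x : R := \1_(~` [set 0]) (Im (V x)).
have m0 : measurable (~` [set (0 : R)] : mset) by apply: measurableC; exact: measurable_set1.
have eL : Linfty (fun x => (e x)%:C%C).
  apply: (@real_Linfty _ _ 1).
    apply: (measurableT_comp (f := \1_(~` [set (0 : R)]) : R -> R)); last exact: VL.1.2.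
    exact: measurable_indic.
  by apply: aeW => x _; rewrite /e indicE; case: (_ \in _); rewrite ?normr1 ?normr0.
have gE := mulL2E g sVI_Linfty; have egE := mulL2E g eL.
exists (mulL2 (fun x => (e x)%:C%C) g).
have e0 x : Im (V x) = 0 -> e x = 0.
  by move=> V0; rewrite /e indicE V0 memNset //= => /(_ erefl).
have e1 x : Im (V x) != 0 -> e x = 1.
  by move=> V0; rewrite /e indicE mem_set //=; apply/eqP.
have z0 : {ae mu, forall x, Rp x -> Im (V x) = 0 -> mulL2 (fun x => (e x)%:C%C) g x = 0}.
  by apply: filterS egE => x Hx x0 V0; rewrite (Hx x0) e0 // mul0r.
split=> //.
  apply: L2_ext; rewrite kE.
  apply: filterS3 gE egE (mulL2E (mulL2 (fun x => (e x)%:C%C) g) sVI_Linfty) => x H1 H2 H3 x0.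
  rewrite (H3 x0) (H1 x0) (H2 x0); have [V0|V0] := eqVneq (Im (V x)) 0.
    by rewrite V0 sqrtr0 !mul0r.
  by rewrite e1 // mul1r.
rewrite integral_mkcondr in hk.
have E : (\int[mu]_(x in Rp) ((fun x => (normc (k x) ^+ 2 / Im (V x))%:E) \_ [set x | Im (V x) != 0%R]) x =
    (n2 (mulL2 (fun x => (e x)%:C%C) g))%:E)%E.
  rewrite -n2E; apply: ae_eq_integral => //.
  - have -> : (fun x => (normc (k x) ^+ 2 / Im (V x))%:E) \_ [set x | Im (V x) != 0] =
        EFin \o (fun x => normc (k x) ^+ 2 / Im (V x)).
      apply/funext => x; rewrite patchE; case: ifPn => //; rewrite notin_setE /= => /negP; rewrite negbK => /eqP V0.
      by rewrite V0 invr0 mulr0.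
    apply/measurable_EFinP; apply: measurable_funM.
      by apply: measurable_normcsq; exact: (L2_sqint k).1.
    by apply: measurableT_comp; [exact: measurable_invr|exact: VL.1.2].
  - by apply: measurable_normcsqE; exact: (L2_sqint _).1.
  apply: filterS3 gE egE VI_ge0 => x H1 H2 H3 x0; rewrite (H2 x0) patchE.
  case: ifPn => [|]; rewrite ?inE ?notin_setE /= => V0; last first.
    move/negP: V0; rewrite negbK => /eqP V0.
    by rewrite e0 // mul0r ComplexField.Normc.normc0 expr0n.
  rewrite e1 // mul1r; congr EFin; rewrite kE (H1 x0) normcM exprMn.
  have -> : normc (Num.sqrt (Im (V x)))%:C%C ^+ 2 = Im (V x).
    by rewrite normcsq /= expr0n addr0 sqr_sqrtr // H3.
  by rewrite mulrAC mulfV // mul1r.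
move: hk; rewrite E -EFinM => -[<-].
by rewrite mulrA mulfV ?mul1r // pnatr_eq0.
Qed.

Variable g0 : H.
Hypothesis g0k : mulL2 sVI g0 = k.
Hypothesis g0n : n2 g0 = 4 * Im h.
Hypothesis g0z : {ae mu, forall x, Rp x -> Im (V x) = 0 -> g0 x = 0}.
Hypothesis Imh : 0 < Im h.

Definition defect u : H := mulL2 sVI u - (j * trace0 u) *: g0.

(** [Im h > 0] makes [g0] nonzero. Since [g0] vanishes where [V_I] does, multiplication by
    [sqrt V_I] does not annihilate it. *)
Lemma k_neq0 : k != 0.
Proof.
apply/negP => /eqP k0; have F := ae_filter_ringOfSetsType mu.
suff g00 : g0 = 0.
  have p : 0 < n2 g0 by rewrite g0n mulr_gt0.
  by rewrite g00 n20 ltxx in p.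
apply: L2_ext; have := mulL2E g0 sVI_Linfty; rewrite g0k k0 => E.
apply: filterS3 E g0z (filterI VI_ge0 (@L2_fun0 R)) => x H1 H2 [H3 H4] x0; rewrite (H4 x0).
have [V0|V0] := eqVneq (Im (V x)) 0; first exact: H2.
have := H1 x0; rewrite (H4 x0) => /esym/eqP; rewrite mulf_eq0 => /orP[|/eqP //].
move=> /eqP /(congr1 (@complex.Re _)) /= /eqP; rewrite sqrtr_eq0 => V0'.
by move: V0; rewrite eq_le V0' H3.
Qed.

(* The boundary form of [A] is a multiple of the positive form of the defect:
   the k-term completes the square because |g0|^2 = 4 Im h. *)
Lemma boundary_form u v : dom A u -> dom A v ->
  ip u (act A v) - ip (act A u) v = 4 * j * ip (defect u) (defect v).
Proof.
move=> /dom_wd[U0 U1 tu] /dom_wd[V0 V1 tv].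
have Guv := green U0 U1 V1; have Gvu := green V0 V1 U1.
rewrite tv in Guv; rewrite tu in Gvu.
set u2 := weak_derivative (weak_derivative u) in U1 Guv Gvu *.
set v2 := weak_derivative (weak_derivative v) in V1 Guv Gvu *.
set u1 := weak_derivative u in U0 U1 Guv Gvu *.
set v1 := weak_derivative v in V0 V1 Guv Gvu *.
have VE : ip u (mulL2 V v) - ip (mulL2 V u) v = 4 * j * ip u (mulL2 VI v).
  rewrite (ip_mulL2 u v VL) -ipZr -ipBr; apply: ip_ae.
  have F := ae_filter_ringOfSetsType mu.
  have B := L2_lin (-1) (mulL2 (fun x => (V x)^*%C) v) (mulL2 V v).
  rewrite scaleN1r addrC in B.
  apply: filterS3 B (filterI (mulL2E v VL) (mulL2E v (conj_Linfty VL))) (filterI (mulL2E v VI_Linfty) (L2_funZ (4 * j) (mulL2 VI v))).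
  move=> x H1 [H2 H3] [H4 H5] x0; rewrite (H1 x0) (H2 x0) (H3 x0) (H5 x0) (H4 x0).
  by rewrite [4 * j * (_ * _)]mulrA -(subr_conj (V x)); ring.
have sS : ip (mulL2 sVI u) (mulL2 sVI v) = ip u (mulL2 VI v).
  by rewrite (ip_mulL2_real u (mulL2 sVI v) sVI_Linfty) sVI_sqr.
have sg : ip (mulL2 sVI u) g0 = ip u k by rewrite (ip_mulL2_real u g0 sVI_Linfty) g0k.
have gs : ip g0 (mulL2 sVI v) = ip k v by rewrite -(ip_mulL2_real g0 v sVI_Linfty) g0k.
have actE w : act A w = - weak_derivative (weak_derivative w) + mulL2 V w + trace0 w *: k by [].
have E1 : ip u (act A v) = ip u1 v1 + (trace0 u)^*%C * (h * trace0 v) + ip u (mulL2 V v) + trace0 v * ip u k.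
  by rewrite actE -/v2 !ipDr ipNr ipZr -[ip u v2](addKr (ip u1 v1)) Guv; ring.
have E2 : ip (act A u) v = ip u1 v1 + (trace0 v * (h^*%C * (trace0 u)^*%C)) + ip (mulL2 V u) v + (trace0 u)^*%C * ip k v.
  rewrite actE -/u2 !ipDl ipNl ipZl (ipC v u2) (ipC v1 u1).
  rewrite -[ip v u2](addKr (ip v1 u1)) Gvu conjcD !conjcN !conjcM conjcK; ring.
rewrite E1 E2 /defect ipBl !ipBr !ipZl !ipZr sS sg gs ip_n2 g0n conjcM conj_j.
move: VE (subr_conj h) j_sqr; rewrite (_ : (4 * Im h)%:C%C = 4 * (Im h)%:C%C); last first.
  by rewrite rmorphM /= rmorph_nat.
move: (ip u (mulL2 V v)) (ip (mulL2 V u) v) (ip u (mulL2 VI v)) (ip u1 v1) (ip u k) (ip k v) => p q r s t z.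
move: (trace0 u)^*%C (trace0 v) (Im h)%:C%C h^*%C j => U T W hc jj VE hE jsq.
have -> : p = q + 4 * jj * r by rewrite -VE; ring.
have -> : h = hc + 4 * jj * W by rewrite -hE; ring.
apply/eqP; rewrite -subr_eq0; apply/eqP.
(* With [V] and [h] split into conjugate and imaginary parts, the two sides differ by a multiple of
   [4 j^2 + 1], which is 0. *)
transitivity ((4 * jj * jj + 1) * (T * t - U * z + 4 * jj * (U * T * W))); first by ring.
by rewrite jsq addNr mul0r.
Qed.

Lemma mulL20 (w : R -> R[i]) : Linfty w -> mulL2 w (0 : H) = 0.
Proof.
by move=> wL; have := mulL2_lin (-1) (0 : H) 0 wL; rewrite scaler0 addr0 scaleN1r addNr.
Qed.

(** Multiplying by [sqrt V_I] turns the vanishing of the defect into condition (i). Conversely one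
    divides by it where it is nonzero; elsewhere both terms of the defect vanish, thanks to the
    normalisation of [g0]. *)
Lemma defect0P u : defect u = 0 <-> mulL2 VI u = (j * trace0 u) *: k.
Proof.
have F := ae_filter_ringOfSetsType mu.
split=> [d0|VE].
  rewrite -sVI_sqr; have -> : mulL2 sVI u = (j * trace0 u) *: g0.
    by apply/eqP; rewrite -subr_eq0; apply/eqP.
  have := mulL2_lin (j * trace0 u) g0 0 sVI_Linfty; rewrite addr0 => ->.
  by rewrite (mulL20 sVI_Linfty) addr0 g0k.
apply/eqP; rewrite subr_eq0; apply/eqP; apply: L2_ext.
have E := mulL2E u VI_Linfty; rewrite VE in E.
have E' := mulL2E g0 sVI_Linfty; rewrite g0k in E'.
apply: filterS3 (filterI E E') (filterI (mulL2E u sVI_Linfty) (L2_funZ (j * trace0 u) k))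
  (filterI (filterI VI_ge0 g0z) (L2_funZ (j * trace0 u) g0)).
move=> x [H1 H2] [H3 H4] [[H5 H6] H7] x0.
rewrite (H3 x0) (H7 x0); have [V0|V0] := eqVneq (Im (V x)) 0.
  by rewrite V0 sqrtr0 mul0r (H6 x0 V0) mulr0.
have s0 : (Num.sqrt (Im (V x)))%:C%C != 0.
  rewrite eq_complex /= eqxx andbT sqrtr_eq0 -ltNge lt_def V0; exact: H5.
apply: (mulfI s0); rewrite mulrA -rmorphM /= -expr2 sqr_sqrtr; last exact: H5.
by rewrite -(H1 x0) (H4 x0) (H2 x0) mulrCA.
Qed.

(** This serves twice: it makes [A] map zero-trace vectors of a reducing selfadjoint subspace into
    [N], and it forces two eigenvalues to agree. *)
Lemma VI_act0 u : dom A u -> trace0 u = 0 -> mulL2 VI u = 0 -> mulL2 VI (act A u) = 0.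
Proof.
move=> Du t0 V0; have [W0 W1 _] := dom_wd Du; have F := ae_filter_ringOfSetsType mu.
set u2 := weak_derivative (weak_derivative u) in W1 *.
have E := mulL2E u VI_Linfty; rewrite V0 in E.
have u0 : {ae mu, forall x, Rp x -> [set x | Im (V x) != 0] x -> u x = 0}.
  apply: filterS2 E (@L2_fun0 R) => x H1 H2 x0 Vx.
  have := H1 x0; rewrite (H2 x0) => /esym/eqP; rewrite mulf_eq0 => /orP[|/eqP //].
  by rewrite eq_complex /= eqxx andbT (negbTE Vx).
have u20 := H2_vanish W0 W1 u0.
apply: L2_ext; rewrite act_trace0 //.
have B := L2_lin (-1) u2 (mulL2 V u); rewrite scaleN1r in B.
apply: filterS3 (filterI u0 u20) (filterI B (mulL2E u VL))
  (filterI (mulL2E (- u2 + mulL2 V u) VI_Linfty) (@L2_fun0 R)).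
move=> x [H1 H2] [H3 H4] [H5 H6] x0; rewrite (H5 x0) (H6 x0).
have [V0x|V0x] := eqVneq (Im (V x)) 0; first by rewrite V0x mul0r.
by rewrite (H3 x0) (H4 x0) (H1 x0 V0x) (H2 x0 V0x) !mulr0 addr0 mulr0.
Qed.

Definition eigen_defect K := [/\ dom A K, trace0 K != 0,
  mulL2 VI K = (j * trace0 K) *: k & span1 K (act A K)].

Lemma dom0 u : dom A u -> [/\ dom A 0, act A 0 = 0 & trace0 (0 : H) = 0].
Proof.
move=> Du; have [d e] := dom_lin VL (-1) Du Du; have t := trace0_dom_lin (-1) Du Du.
move: d e t; move: (act A) => act'; rewrite !scaleN1r !addNr => d e t; split=> //.
by rewrite t mulN1r addNr.
Qed.

Lemma domZ a u : dom A u -> [/\ dom A (a *: u), act A (a *: u) = a *: act A u &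
  trace0 (a *: u) = a * trace0 u].
Proof.
move=> Du; have [d0 a0 t0] := dom0 Du; have [d e] := dom_lin VL a Du d0.
have := trace0_dom_lin a Du d0; rewrite t0 addr0 => t.
by move: d e t; rewrite a0 !addr0.
Qed.

Lemma ip_decomp K u : K != 0 -> exists c r, u = c *: K + r /\ ip K r = 0.
Proof.
move=> /ip_neq0 K0; pose c := ip K u / ip K K; exists c, (u - c *: K).
by rewrite addrC subrK ipBr ipZr /c divfK // subrr.
Qed.

Lemma j4_neq0 : 4 * j != 0.
Proof. by rewrite mulf_neq0 ?j_neq0 // pnatr_eq0. Qed.

Lemma reducing_selfadjoint_span M : reducing_selfadjoint A M -> M <> [set 0] ->
  exists2 m, eigen_defect m & M = span1 m.
Proof.
move=> [[cM _ _ actM _] [[_ dense] adj]] Mn0.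
pose DM := dom A `&` M; have [M0 Mlin _] := cM.
have DMlin a u v : DM u -> DM v -> DM (a *: u + v).
  by move=> [Du Mu] [Dv Mv]; split; [exact: (dom_lin VL a Du Dv).1|exact: Mlin].
have actM' u : DM u -> M (act A u) by move=> Du; apply: actM; exists u.
have sym u v : DM u -> DM v -> ip u (act A v) = ip (act A u) v.
  by move=> Du Dv; have [_ _ E] := (adj u (act A u)).2 (conj Du erefl); exact: E.
have adj' v w : M v -> M w -> (forall u, DM u -> ip v (act A u) = ip w u) ->
    DM v /\ act A v = w.
  by move=> Mv Mw H1; exact: (adj v w).1 (And3 Mv Mw H1).
have VI0 u : DM u -> mulL2 VI u = (j * trace0 u) *: k.
  move=> Du; apply/defect0P/ip_eq0; apply: (mulfI j4_neq0).
  by rewrite mulr0 -boundary_form ?(sym _ _ Du Du) ?subrr //; exact: Du.1.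
have tr0 u : DM u -> mulL2 VI u = 0 -> trace0 u = 0.
  move=> Du; rewrite VI0 // => /eqP.
  by rewrite scaler_eq0 (negbTE k_neq0) orbF mulf_eq0 (negbTE j_neq0) => /eqP.
(* On the domain, [V_I v = 0] is equivalent to zero trace. The former is chosen because
   multiplication by [V_I] is bounded, so that [N] is closed in the Hilbert space; the trace is not
   even meaningful on all of [M]. *)
pose N := [set v | M v /\ mulL2 VI v = 0].
have cN : closed_subspace N.
  split; first by split=> //; exact: mulL20 VI_Linfty.
    move=> a u v [Mu u0] [Mv v0]; split; first exact: Mlin.
    by rewrite (mulL2_lin a u v VI_Linfty) u0 v0 scaler0 addr0.
  move=> u Nu; split.
    case: cM => _ _; apply=> e e0; have [v [Mv _] ?] := Nu e e0; by exists v.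
  apply: ip_eq0; rewrite -(ip_mulL2_real (mulL2 VI u) u VI_Linfty).
  apply: ip_closed Nu => w [_ w0].
  by rewrite (ip_mulL2_real (mulL2 VI u) w VI_Linfty) w0 ip0r.
have DN u : DM u -> trace0 u = 0 -> N u /\ N (act A u).
  move=> Du t0; have u0 : mulL2 VI u = 0 by rewrite VI0 // t0 mulr0 scale0r.
  split; first by split=> //; exact: Du.2.
  by split; [exact: actM'|exact: VI_act0 Du.1 t0 u0].
(* If all traces on the domain vanish, the uniqueness argument applies to [M] itself and makes it
   trivial. *)
have [[u0 [Du0 tu0]]|nex] := pselect (exists u0, DM u0 /\ trace0 u0 != 0); last first.
  exfalso; apply: Mn0; apply/seteqP; split=> [v|_ ->] //.
  apply: (volterra_trivial VL cM DMlin _ sym adj') => u Du.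
  split; [exact: Du.2|exact: Du.1| |exact: actM'].
  by apply/eqP; apply: contraPT isT => tu; case: nex; exists u.
(* The eigenvector will be the part [m] of [u0] orthogonal to [N]. It is not known to be in the
   domain, so the adjoint identity is established for it first. *)
have [n Nn nP] := projection u0 cN.
set m := u0 - n in nP.
have Mm : M m by apply: closed_subspaceB cM Du0.2 Nn.1.
have mN w : N w -> ip m w = 0 by move=> /nP /ip_sym0.
have m0 : m != 0.
  apply: contraNneq tu0 => m0; apply/eqP/tr0 => //.
  by have <- : n = u0; [apply/eqP; rewrite eq_sym -subr_eq0 -/m m0|exact: Nn.2].
have mm := ip_neq0 m0.
have mu0 : ip m u0 = ip m m by rewrite -[u0](subrK n) -/m ipDr (mN n Nn) addr0.
pose l := ip m (act A u0) / ip m m.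
(* A combination of [u0] and [u] with zero trace lies in [N] together with its image, so [m] is
   orthogonal to both; this reduces the claim to [u0], where it is the definition of [l]. *)
have key u : DM u -> ip m (act A u) = l * ip m u.
  move=> Du; pose c := - (trace0 u / trace0 u0).
  have Dw := DMlin c _ _ Du0 Du.
  have tw : trace0 (c *: u0 + u) = 0.
    by rewrite (trace0_dom_lin c Du0.1 Du.1) /c mulNr divfK // addNr.
  have [Nw NAw] := DN _ Dw tw.
  have := mN _ NAw; rewrite (dom_lin VL c Du0.1 Du.1).2 (ip_lin m c (act A u0)) => E1.
  have := mN _ Nw; rewrite (ip_lin m c u0) mu0 => E2.
  have -> : ip m u = - c * ip m m by apply/eqP; rewrite mulNr -addr_eq0 addrC E2.
  rewrite mulrCA /l divfK //.
  by apply/eqP; rewrite mulNr -addr_eq0 addrC E1.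
have [Dm Am] : DM m /\ act A m = l^*%C *: m.
  apply: adj' => //; first exact: closed_subspaceZ.
  by move=> u Du; rewrite ipZl conjcK; exact: key.
have tm : trace0 m != 0.
  apply: contraNneq mm => t0; have [Nm _] := DN m Dm t0; by rewrite (mN m Nm).
have split_m u : DM u -> exists c, let w := c *: m + u in
    [/\ DM w, trace0 w = 0 & act A w = (c * l^*%C) *: m + act A u].
  move=> Du; exists (- (trace0 u / trace0 m)); split; first exact: DMlin.
    by rewrite (trace0_dom_lin _ Dm.1 Du.1) mulNr divfK // addNr.
  by rewrite (dom_lin VL _ Dm.1 Du.1).2 Am (scalerA _ l^*%C).
pose D1 := [set u | DM u /\ trace0 u = 0].
have N0 : forall v, N v -> v = 0.
  apply: (volterra_trivial (h := h) (k := k) VL cN (D := D1)).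
  - move=> a u v [Du t0] [Dv s0]; split; first exact: DMlin.
    by rewrite (trace0_dom_lin a Du.1 Dv.1) t0 s0 mulr0 addr0.
  - by move=> u [Du t0]; have [? ?] := DN u Du t0; split => //; exact: Du.1.
  - by move=> u v [Du _] [Dv _]; exact: sym.
  (* The adjoint identity is given on zero-trace vectors only. It extends to the whole domain in
     [M], since [split_m] corrects the trace by a multiple of [m], and [m] is orthogonal to [v] and
     [w]. *)
  move=> v w Nv Nw vw.
  have [Dv Av] : DM v /\ act A v = w.
    apply: adj' => [||u Du]; [exact: Nv.1|exact: Nw.1|].
    have [c [Dw tw Aw]] := split_m u Du; have := vw _ (conj Dw tw).
    rewrite Aw (ip_lin v _ m) (ip_lin w c m).
    by rewrite (ip_sym0 (mN v Nv)) (ip_sym0 (mN w Nw)) !mulr0 !add0r.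
  by split => //; split=> //; exact: tr0 Nv.2.
have DMm u : DM u -> exists c, u = c *: m.
  move=> Du; have [c [Dw tw _]] := split_m u Du; exists (- c).
  by have := N0 _ (DN _ Dw tw).1 => /eqP; rewrite addrC addr_eq0 scaleNr => /eqP.
exists m.
  split; [exact: Dm.1|exact: tm|exact: VI0|by exists l^*%C].
apply/seteqP; split=> [v Mv|_ [a _ <-]]; last exact: closed_subspaceZ.
(* The domain in [M] consists of multiples of [m]; its density makes the residual [r] orthogonal to
   [v], hence to itself. *)
have [c [r [vE mr]]] := ip_decomp v m0.
have rv : ip r v = 0.
  apply: ip_closed (dense _ Mv) => w /DMm [a ->].
  by rewrite ipZr (ip_sym0 mr) mulr0.
have r0 : r = 0.
  by apply: ip_eq0; move: rv; rewrite vE (ip_lin r c m) (ip_sym0 mr) mulr0 add0r.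
by exists c => //; rewrite vE r0 addr0.
Qed.

Lemma eigen_defect_neq0 K : eigen_defect K -> K != 0.
Proof.
move=> [DK tK _ _]; apply: contraNneq tK => K0; have [_ _ t0] := dom0 DK.
by rewrite K0 t0.
Qed.

(** The boundary form of [K] with itself vanishes with its defect, and it equals the eigenvalue
    minus its conjugate, times [|K|^2]. *)
Lemma eigen_defect_real K : eigen_defect K ->
  exists2 l : R[i], act A K = l *: K & l^*%C = l.
Proof.
move=> eK; have K0 := ip_neq0 (eigen_defect_neq0 eK).
have [DK tK /defect0P dK [l _ lE]] := eK; exists l => //.
have := boundary_form DK DK; rewrite dK ip0l mulr0 -lE ipZl ipZr -mulrBl => /eqP.
by rewrite mulf_eq0 (negbTE K0) orbF subr_eq0 => /eqP.
Qed.

Lemma closed_span K : K != 0 -> closed_subspace (span1 K).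
Proof.
move=> K0; split; first by exists 0; rewrite ?scale0r.
  move=> a _ _ [b _ <-] [c _ <-]; exists (a * b + c) => //.
  by rewrite scalerDl scalerA.
move=> u Ku; have [c [r [uE Kr]]] := ip_decomp u K0.
have ru : ip r u = 0.
  by apply: ip_closed Ku => _ [a _ <-]; rewrite ipZr (ip_sym0 Kr) mulr0.
have r0 : r = 0.
  by apply: ip_eq0; move: ru; rewrite uE (ip_lin r c K) (ip_sym0 Kr) mulr0 add0r.
by exists c => //; rewrite uE r0 addr0.
Qed.

(** The vanishing defect of [K] kills the boundary form against every [u] in the domain. Hence
    [<K, A u>] is a multiple of [<K, u>], and the orthogonal complement is invariant although [A] is
    not symmetric there. *)
Lemma eigen_defect_reducing K : eigen_defect K -> reducing_selfadjoint A (span1 K).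
Proof.
move=> eK; have K0 := eigen_defect_neq0 eK; have [l lE lr] := eigen_defect_real eK.
have KK := ip_neq0 K0; have cK := closed_span K0; have [DK tK /defect0P dK _] := eK.
have actZ a : act A (a *: K) = (a * l) *: K.
  by have [_ -> _] := domZ a DK; rewrite lE (scalerA a l K).
have domKZ a : dom A (a *: K) by have [] := domZ a DK.
split.
  split=> //.
  - apply/seteqP; split=> [u Du|_ [u [Du _] [v [Dv _] <-]]]; last first.
      by have := (dom_lin VL 1 Du Dv).1; rewrite scale1r.
    have [c [r [uE Kr]]] := ip_decomp u K0.
    exists (c *: K); first by split=> //; exists c.
    exists r => //; split; last by split=> // _ [a _ <-]; rewrite ipZl Kr mulr0.
    have := (dom_lin VL (- c) DK Du).1.
    by rewrite uE addrA -scalerDl addNr scale0r add0r.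
  - by move=> _ [_ [_ [a _ <-]] <-]; rewrite actZ; exists (a * l).
  - move=> _ [u [Du [_ uK]] <-]; split=> // _ [a _ <-].
    have Ku : ip K u = 0 by apply: uK; exists 1; rewrite ?scale1r.
    have := boundary_form DK Du; rewrite dK ip0l mulr0 lE ipZl Ku mulr0 subr0.
    by rewrite ipZl => ->; rewrite mulr0.
split.
  split; first by move=> u [].
  move=> _ [a _ <-]; apply/n2_close => e e0; exists (a *: K); last by rewrite subrr n20.
  by split=> //; exists a.
move=> v w; split.
  move=> [[a _ <-] [b _ <-] /(_ K) H1].
  have : ip (a *: K) (act A K) = ip (b *: K) K.
    by apply: H1; split => //; exists 1; rewrite ?scale1r.
  rewrite lE ipZr !ipZl mulrA => /(mulIf KK) H2; split; first by split=> //; exists a.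
  rewrite actZ; congr (_ *: _); rewrite -[b]conjcK -H2 conjcM conjcK lr.
  by rewrite mulrC.
move=> [[_ [a _ <-]] <-]; rewrite actZ; split; [by exists a|by exists (a * l)|].
move=> _ [_ [c _ <-]]; rewrite actZ !ipZl !ipZr conjcM lr; ring.
Qed.

Lemma eigen_defect_sub K K' : eigen_defect K -> eigen_defect K' -> span1 K K'.
Proof.
move=> eK eK'; have [l lE _] := eigen_defect_real eK; have [l' lE' _] := eigen_defect_real eK'.
have [DK tK VK _] := eK; have [DK' tK' VK' _] := eK'.
pose c := trace0 K' / trace0 K; exists c => //.
pose u := - c *: K + K'.
have [Du Au] := dom_lin VL (- c) DK DK'; rewrite -/u lE lE' in Du Au.
have tu : trace0 u = 0 by rewrite /u (trace0_dom_lin (- c) DK DK') mulNr divfK // addNr.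
have cK : c * trace0 K = trace0 K' by rewrite divfK.
have Vu : mulL2 VI u = 0.
  rewrite /u (mulL2_lin (- c) K K' VI_Linfty) VK VK' scalerA -scalerDl.
  by rewrite -cK (_ : _ + _ = 0) ?scale0r //; ring.
have ll : l' = l.
  have := VI_act0 Du tu Vu; rewrite Au scalerA.
  have := mulL2_lin l' K' 0 VI_Linfty; rewrite !addr0 => E'.
  rewrite (mulL2_lin (- c * l) K (l' *: K') VI_Linfty) E' (mulL20 VI_Linfty) addr0 VK VK' !scalerA -scalerDl => /eqP.
  rewrite scaler_eq0 (negbTE k_neq0) orbF -cK.
  rewrite (_ : _ + _ = j * (c * trace0 K) * (l' - l)); last by ring.
  rewrite cK mulf_eq0 (negbTE (mulf_neq0 j_neq0 tK')).
  by rewrite subr_eq0 => /eqP.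
have Aul : act A u = l *: u.
  by rewrite Au ll /u (scalerDr l) !(scalerA _ _ K) (mulrC l).
have u0 : u = 0.
  have [W0 W1 t1] := dom_wd Du; rewrite tu mulr0 in t1.
  have [C C0 VC] := V_bound VL.
  (* Here [u'' = (V - l) u], and [nrm1] of [V] is at most [2 C]. *)
  apply: (volterra_unique (C := 2 * C + nrm1 l) W0 W1 tu t1).
    by rewrite addr_ge0 ?nrm1_ge0 // mulr_ge0.
  set u2 := weak_derivative (weak_derivative u).
  have u2E : u2 = - l *: u + mulL2 V u.
    rewrite scaleNr -Aul act_trace0 // -/u2; move: (mulL2 V u) => w.
    by rewrite opprD opprK subrK.
  have F := ae_filter_ringOfSetsType mu.
  have E := L2_lin (- l) u (mulL2 V u); rewrite -u2E in E.
  apply: filterS3 E (mulL2E u VL) VC => x E1 E2 E3 x0; rewrite E1 // E2 //.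
  apply: le_trans (nrm1D _ _) _; rewrite addrC mulrDl; apply: lerD.
    apply: le_trans (nrm1M _ _) _; rewrite ler_wpM2r ?nrm1_ge0 // /nrm1.
    have := Re_le_normc (V x); have := Im_le_normc (V x); have := E3 x0; lra.
  apply: le_trans (nrm1M _ _) _; rewrite ler_wpM2r ?nrm1_ge0 // /nrm1.
  by case: (l) => ? ? /=; rewrite !normrN.
by apply/eqP; rewrite eq_sym -subr_eq0 addrC -scaleNr -/u u0.
Qed.

Lemma eigen_defect_unique K K' : eigen_defect K -> eigen_defect K' -> span1 K = span1 K'.
Proof.
suff sub P Q : eigen_defect P -> eigen_defect Q -> span1 Q `<=` span1 P.
  by move=> eK eK'; apply/seteqP; split; exact: sub.
move=> eP eQ _ [a _ <-]; have [c _ <-] := eigen_defect_sub eP eQ.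
by exists (a * c); rewrite ?scalerA.
Qed.

Lemma orth_closed M : closed_subspace (orth A M).
Proof.
split; first by split=> // v _; rewrite ip0r.
  by move=> a u v [_ u0] [_ v0]; split=> // w Mw; rewrite ip_lin u0 // v0 // mulr0 addr0.
by move=> u Mu; split=> // v Mv; apply: ip_closed Mu => w [_ ->].
Qed.

Lemma orth_orth M : closed_subspace M -> orth A (orth A M) = M.
Proof.
move=> cM; apply/seteqP; split=> [u [_ uM]|u Mu]; last first.
  by split=> // v [_ /(_ u Mu)] /ip_sym0.
have [p Mp up] := projection u cM.
suff -> : u = p by [].
apply/eqP; rewrite -subr_eq0; apply/eqP/ip_eq0.
by rewrite ipBr (ip_sym0 (up p Mp)) subr0 uM.
Qed.

Lemma reducing_orth M : reducing A M -> reducing A (orth A M).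
Proof.
move=> [cM _ dM a1 a2]; split=> //; rewrite ?orth_orth //; first exact: orth_closed.
rewrite {1}dM; apply/seteqP; split=> _ [u Hu [v Hv <-]]; exists v => //; exists u => //.
all: by rewrite addrC.
Qed.

(** Complete non-selfadjointness of a part of [A] concerns subspaces that reduce that part; they
    must reduce [A] before [reducing_selfadjoint_span] applies. They do, since [N] is orthogonal to
    [M] and so its share of the domain joins the complement of [M]. *)
Lemma reducing_restriction M N : reducing A N ->
  reducing_selfadjoint (restriction A (orth A N)) M -> reducing_selfadjoint A M.
Proof.
move=> [cN _ dN a1 a2] [[cM MN dM b1 b2] sa].
have rM : restriction (restriction A (orth A N)) M = restriction A M.
  by rewrite /restriction /= -setIA (setIidr MN).
rewrite rM in sa; split=> //.
have orthN s : N s -> orth A M s.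
  by move=> Ns; split=> // v /MN[_ /(_ s Ns)] /ip_sym0.
have [M0 Mlin _] := orth_closed M.
split=> //.
- apply/seteqP; split=> [u|_ [u [Du _] [v [Dv _] <-]]]; last first.
    by have := (dom_lin VL 1 Du Dv).1; rewrite scale1r.
  rewrite {1}dN => -[s [Ds Ns] [n Hn <-]].
  have : dom (restriction A (orth A N)) n by [].
  rewrite dM => -[p [[Dp _] Mp] [q [[Dq _] [_ Mq]] <-]].
  exists p => //; exists (s + q); last by rewrite addrCA.
  split; first by have := (dom_lin VL 1 Ds Dq).1; rewrite scale1r.
  by have := Mlin 1 s q (orthN _ Ns); rewrite scale1r; apply; split.
- by move=> _ [u [Du Mu] <-]; apply: b1; exists u => //; split=> //; split=> //; exact: MN.
move=> _ [u [Du [_ uM]] <-].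
move: Du; rewrite {1}dN => -[s [Ds Ns] [n [Dn Nn] unE]].
have := (dom_lin VL 1 Ds Dn).2; rewrite !scale1r unE => ->.
have Ms : orth A M (act A s) by apply/orthN/a1; exists s.
have Mn : orth A M (act A n).
  have [] : orth (restriction A (orth A N)) M (act A n).
    apply: b2; exists n => //; split=> //; split=> // v Mv.
    have := uM v Mv; rewrite -unE ipDr.
    by have [_ /(_ v Mv) ->] := orthN s Ns; rewrite add0r.
  by move=> _ ?; split.
by have := Mlin 1 _ _ Ms Mn; rewrite scale1r.
Qed.

(** A nontrivial reducing selfadjoint subspace of the complement would be spanned by another such
    eigenvector, hence would be the span of [K], which is orthogonal to the complement. *)
Lemma langer_eigen_defect K : eigen_defect K ->
  langer_decomposition A (span1 K) (orth A (span1 K)).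
Proof.
move=> eK; have [rK saK] := eigen_defect_reducing eK; have K0 := eigen_defect_neq0 eK.
split=> //; first exact: reducing_orth.
- by move=> u v Ku [_]; apply.
- apply/seteqP; split=> // u _; have [c [r [uE Kr]]] := ip_decomp u K0.
  exists (c *: K); first by exists c.
  by exists r => //; split=> // _ [a _ <-]; rewrite ipZl Kr mulr0.
split=> // M rM; apply: contrapT => Mn0.
have [[_ MK _ _ _] _] := rM.
have [m em Mm] := reducing_selfadjoint_span (reducing_restriction rK rM) Mn0.
have [_ /(_ K)] : orth A (span1 K) K.
  by apply: MK; rewrite Mm (eigen_defect_unique em eK); exists 1; rewrite ?scale1r.
have K1 : span1 K K by exists 1; rewrite ?scale1r.
by move=> /(_ K1) /ip_eq0 E; rewrite E eqxx in K0.
Qed.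

Lemma span1_neq0 K : K != 0 -> span1 K <> [set 0].
Proof.
move=> K0 E; have : span1 K K by exists 1; rewrite ?scale1r.
by rewrite E => /eqP; rewrite (negbTE K0).
Qed.

(** Uniqueness of the decomposition for this operator, so that the choice in [H_sa] is determined. A
    nonzero [M] is spanned by such an eigenvector; if [M = 0], then [N] is the whole space and the
    span of [K] contradicts complete non-selfadjointness. *)
Lemma langer_unique K M N : eigen_defect K -> langer_decomposition A M N -> M = span1 K.
Proof.
move=> eK [rM rN _ spE [saM cns]].
have [M0|Mn0] := pselect (M = [set 0]); last first.
  have [m em ->] := reducing_selfadjoint_span (conj rM saM) Mn0.
  exact: eigen_defect_unique.
exfalso; apply: (span1_neq0 (eigen_defect_neq0 eK)).
apply: cns; have NT : N = setT.
  apply/seteqP; split=> // u _; have : Defs.space A u by [].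
  by rewrite spE M0 => -[_ -> [v Nv <-]]; rewrite add0r.
have -> : restriction A N = A by rewrite NT /restriction setIT.
exact: eigen_defect_reducing.
Qed.

Lemma H_sa_eigen_defect K : eigen_defect K -> H_sa A = span1 K.
Proof.
move=> eK; rewrite /H_sa.
have [N] := @xgetPex _ set0 [set M | exists N, langer_decomposition A M N]
  (ex_intro _ _ (ex_intro _ _ (langer_eigen_defect eK))).
exact: langer_unique.
Qed.

End Dissipation.

Theorem theorem3p14 (R : realType) (V : R -> R[i]) (h : R[i]) (k : L2 R)
  (VLinfty : Linfty V)
  (VI_ge0 : {ae @lebesgue_measure R,
    forall x, Rpos R x -> 0 <= complex.Im (V x)})
  (kRan : exists g : L2 R,
    k = mulL2 (fun x => (Num.sqrt (complex.Im (V x)))%:C%C) g)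
  (hk : ((4^-1)%:E *
     \int[@lebesgue_measure R]_(x in Rpos R `&` [set x | complex.Im (V x) != 0%R])
        ((normc (k x)) ^+ 2 / complex.Im (V x))%:E = (complex.Im h)%:E)%E)
  (Imh_gt0 : 0 < complex.Im h) :
  let A := A_hk V h k in
  let admissible (K : L2 R) :=
    [/\ dom A K, trace0 K != 0,
        mulL2 (fun x => (complex.Im (V x))%:C%C) K = ('i%C / 2 * trace0 K) *: k
      & span1 K (act A K)] in
  ((exists M : set (L2 R), reducing_selfadjoint A M /\ M <> [set 0]) <->
   (exists K : L2 R, admissible K)) /\
  (forall K : L2 R, admissible K -> H_sa A = span1 K).
Proof.
move=> A admissible.
have [g0 [g0k g0n g0z]] := sqrt_density VLinfty VI_ge0 kRan hk.
split; last by move=> K; exact: H_sa_eigen_defect g0k g0n g0z Imh_gt0 K.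
split=> [[M [rM M0]]|[K eK]].
  have [K eK _] := reducing_selfadjoint_span VLinfty VI_ge0 g0k g0n g0z Imh_gt0 rM M0.
  by exists K.
exists (span1 K); split.
  exact: (eigen_defect_reducing VLinfty VI_ge0 g0k g0n g0z (K := K) eK).
exact/span1_neq0/(eigen_defect_neq0 VLinfty eK).
Qed.
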